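(* Suppose that $a_1:=\mathbf{E}[\xi(1)]<b$. Then there is a probability measure $\mu$ on $[0,\infty)$ such that $\bar Q_t(x,\cdot)\to\mu$ weakly as $t\to\infty$ for every $x\ge0$ if and only if $$\int_1^\infty\log(u)\,n(du)<\infty.$$ Under the condition $\int_1^\infty\log(u)\,n(du)<\infty$, we have, for $\lambda\ge 0$, $$\int_{[0,\infty)}e^{-\lambda y}\,\mu(dy)=\mathbf{E}\bigg[\exp\bigg\{-\int_{-\infty}^0\psi(v^\xi_{s,0}(\lambda))\,ds\bigg\}\bigg].$$
   Context: ''Positive'' means nonnegative. $\mathbf{E}$ is expectation under $\mathbf{P}$; $a_1=\mathbf{E}[\xi(1)]$ is assumed to exist as a real number. Branching mechanism: $b\in\mathbb{R}$, $c\ge 0$, $m$ a measure on $(0,\infty)$ with $\int_0^\infty (z\wedge z^2)\,m(dz)<\infty$, and $\phi(z)=bz+cz^2+\int_0^\infty(e^{-uz}-1+uz)\,m(du)$, $z\ge0$. Immigration mechanism: $h\ge0$ is a constant, $n$ is a measure on $(0,\infty)$ with $\int_0^\infty(1\wedge u)\,n(du)<\infty$, and $\psi(\lambda)=h\lambda+\int_0^\infty(1-e^{-\lambda u})\,n(du)$, $\lambda\ge0$. Environment: $\xi=\{\xi(t):t\ge0\}$ is a real Lévy process with càdlàg paths, $\xi(0)=0$, and Lévy–Itô decomposition $$\xi(t)=at+\sigma B(t)+\int_0^t\int_{[-1,1]}z\,\tilde N(ds,dz)+\int_0^t\int_{\mathbb{R}\setminus[-1,1]}z\,N(ds,dz),$$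 where $a\in\mathbb{R}$, $\sigma\ge0$, $B$ is a Brownian motion, and $N$ is a Poisson random measure on $(0,\infty)\times\mathbb{R}$ with intensity $ds\,\nu(dz)$ and compensated measure $\tilde N$, $\nu$ being a measure on $\mathbb{R}\setminus\{0\}$ with $\int(1\wedge z^2)\,\nu(dz)<\infty$. Two-sided extension: let $\xi'$ be an independent copy of $\xi$ with $\xi'(0)=0$, and set $\xi(t)=\xi(0)-\xi'((-t)-)$ for $t<0$, so that $\{\xi(t):-\infty<t<\infty\}$ is a time-homogeneous Lévy process. For $r\le t\in\mathbb{R}$ and $\lambda\ge0$, $r\mapsto v^\xi_{r,t}(\lambda)$ is the unique positive solution of $$v^\xi_{r,t}(\lambda)=e^{\xi(t)-\xi(r)}\lambda-\int_r^t e^{\xi(s)-\xi(r)}\phi(v^\xi_{s,t}(\lambda))\,ds,\qquad r\le t.$$ $(\bar Q_t)_{t\ge0}$ is the transition semigroup on $[0,\infty)$ defined by $$\int_{[0,\infty)}e^{-\lambda y}\,\bar Q_t(x,dy)=\mathbf{E}\bigg[\exp\bigg\{-xv^\xi_{0,t}(\lambda)-\int_0^t\psi(v^\xi_{s,t}(\lambda))\,ds\bigg\}\bigg],\qquad\lambda\ge0.$$ It is the transition semigroup of the CBIRE-process, the unique nonnegative strong solution of $$Y(t)=Y(0)-b\int_0^tY(s)\,ds+\int_0^t\sqrt{2cY(s)}\,dW(s)+\eta(t)+\int_0^t\int_0^\infty\int_0^{Y(s-)}z\,\tilde M(ds,dz,du)+\int_0^tY(s-)\,dL(s),$$ where $W$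 is a Brownian motion, $\tilde M$ is a compensated Poisson random measure on $(0,\infty)^3$ with intensity $ds\,m(dz)\,du$, $\eta$ is an increasing Lévy process with $\eta(0)=0$ and $\mathbf{E}[e^{-\lambda\eta(t)}]=e^{-t\psi(\lambda)}$, and $L(t)=\beta t+\sigma B(t)+\int_0^t\int_{[-1,1]}(e^z-1)\,\tilde N(ds,dz)+\int_0^t\int_{\mathbb{R}\setminus[-1,1]}(e^z-1)\,N(ds,dz)$ with $\beta=a+\frac{\sigma^2}{2}+\int_{[-1,1]}(e^z-1-z)\,\nu(dz)$; all these noises are independent of each other. *)

(* Defs.v *)
From HB Require Import structures.
From mathcomp Require Import all_boot all_order all_algebra.
From mathcomp Require Import all_classical all_reals all_analysis.
From mathcomp Require Import measurable_realfun.

Set Implicit Arguments.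
Unset Strict Implicit.
Unset Printing Implicit Defensive.

Import Order.TTheory GRing.Theory Num.Theory.
Import numFieldNormedType.Exports.

Local Open Scope classical_set_scope.
Local Open Scope ring_scope.

(* Measures on (0, +oo) (resp. on R \ {0}) are represented by Borel measures on
   R that are only ever evaluated inside that set. *)

Section Mechanisms.
Context {R : realType}.
Local Notation BR := (measurableTypeR R).
Implicit Types m n : {measure set BR -> \bar R}.

Definition branching_mechanism (c : R) m : Prop :=
  0 <= c /\ (\int[m]_(z in `]0%R, +oo[) (Num.min z (z ^+ 2))%:E < +oo)%E.

Definition phi (b c : R) m (z : R) : R :=
  b * z + c * z ^+ 2
  + \int[m]_(u in `]0, +oo[) (expR (- (u * z)) - 1 + u * z).

Definition immigration_mechanism (h : R) n : Prop :=
  0 <= h /\ (\int[n]_(u in `]0%R, +oo[) (Num.min 1 u)%:E < +oo)%E.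

Definition psi (h : R) n (lambda : R) : R :=
  h * lambda + \int[n]_(u in `]0, +oo[) (1 - expR (- (lambda * u))).

End Mechanisms.

Section Independence.
Context {d : measure_display} {T : measurableType d} {R : realType}.
Variable P : probability T R.

(* The events C i may be the full space, so the product rule also covers all
   subfamilies. *)
Definition mutually_independent {d' : measure_display} {S : measurableType d'}
    (n : nat) (X : nat -> T -> S) : Prop :=
  forall C : nat -> set S, (forall i, measurable (C i)) ->
    P (\bigcap_(i < n) (X i @^-1` C i)) =
    (\prod_(i < n) P (X i @^-1` C i))%E.

Definition sigma_of {I : Type} {d' : measure_display} {S : measurableType d'}
    (D : set I) (X : I -> T -> S) : set (set T) :=
  <<s [set E | exists2 i, D i & exists2 C, measurable C & E = X i @^-1` C] >>.

Definition independent_families {I J : Type} {d1 d2 : measure_display}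
    {S1 : measurableType d1} {S2 : measurableType d2}
    (D1 : set I) (X : I -> T -> S1) (D2 : set J) (Y : J -> T -> S2) : Prop :=
  forall E F, sigma_of D1 X E -> sigma_of D2 Y F ->
    P (E `&` F) = (P E * P F)%E.

End Independence.

(* Processes are functions R -> T -> R used at times t >= 0 only. *)
Section Processes.
Context {d : measure_display} {T : measurableType d} {R : realType}.
Variable P : probability T R.
Local Notation BR := (measurableTypeR R).
Local Notation leb := (@lebesgue_measure R).
Implicit Types X Y : R -> T -> BR.

Definition cadlag (f : R -> R) : Prop :=
  (forall t, 0 <= t -> f s @[s --> t^'+] --> f t) /\
  (forall t, 0 < t -> cvg (f s @[s --> t^'-])).

Definition independent_increments X : Prop :=
  forall (n : nat) (t : nat -> R), 0 <= t 0%N ->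
    (forall i, t i <= t i.+1) ->
    mutually_independent P n (fun i w => X (t i.+1) w - X (t i) w : BR).

Definition stationary_increments X : Prop :=
  forall s t (A : set BR), 0 <= s -> 0 <= t -> measurable A ->
    P [set w | A (X (s + t) w - X s w)] = P [set w | A (X t w)].

Definition levy_process X : Prop :=
  [/\ forall t, 0 <= t -> measurable_fun setT (X t),
      forall w, X 0 w = 0,
      forall w, cadlag (X ^~ w),
      independent_increments X
    & stationary_increments X].

Definition brownian_motion X : Prop :=
  [/\ forall t, 0 <= t -> measurable_fun setT (X t),
      forall w, X 0 w = 0,
      forall w, {within `[0, +oo[, continuous (X ^~ w : R -> R)},
      independent_increments X
    & forall s t (A : set BR), 0 <= s -> s < t -> measurable A ->
        P [set w | A (X t w - X s w)] = normal_prob 0 (Num.sqrt (t - s)) A].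

Definition time_jump : set (BR * BR) := `]0, +oo[ `*` [set~ 0].

(* The product measure ds nu(dz) of a set A included in time_jump. *)
Definition intensity (nu : {measure set BR -> \bar R}) (A : set (BR * BR)) :
  \bar R := (\int[leb]_s nu (xsection A s))%E.

(* The middle argument of [poisson_prob] is a dummy. *)
Definition poisson_random_measure (nu : {measure set BR -> \bar R})
    (N : R.-ker T ~> (BR * BR)%type) : Prop :=
  [/\ forall A (k : nat), measurable A -> A `<=` time_jump ->
        (intensity nu A < +oo)%E ->
        P [set w | N w A = (k%:R)%:E] =
          poisson_prob (fine (intensity nu A)) 0%N [set k],
      forall A, measurable A -> A `<=` time_jump ->
        (intensity nu A = +oo)%E -> {ae P, forall w, N w A = +oo%E}
    & forall (k : nat) (A : nat -> set (BR * BR)),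
        (forall i, measurable (A i) /\ A i `<=` time_jump) ->
        trivIset setT A ->
        mutually_independent (S := \bar R) P k (fun i w => N w (A i))].

(* int_0^t int_{eps < |z| <= 1} z N~(ds, dz) *)
Definition compensated_jumps (nu : {measure set BR -> \bar R})
    (N : R.-ker T ~> (BR * BR)%type) (eps t : R) (w : T) : R :=
  \int[N w]_(p in `]0, t] `*` [set z : BR | eps < `|z| <= 1]) p.2
  - t * \int[nu]_(z in [set z : BR | eps < `|z| <= 1]) z.

Definition large_jumps (N : R.-ker T ~> (BR * BR)%type) (t : R) (w : T) : R :=
  \int[N w]_(p in `]0, t] `*` [set z : BR | 1 < `|z|]) p.2.

(* The compensated integral over [-1,1] is the L^2 limit J of its truncations
   as eps goes to 0. *)
Definition levy_ito (a sigma : R) (nu : {measure set BR -> \bar R})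
    (B : R -> T -> BR) (N : R.-ker T ~> (BR * BR)%type) (xi : R -> T -> BR) :
    Prop :=
  [/\ 0 <= sigma,
      (\int[nu]_(z in [set~ 0%R]) (Num.min 1 (z ^+ 2))%:E < +oo)%E,
      brownian_motion B /\ poisson_random_measure nu N,
      independent_families (S2 := \bar R) P [set t : R | 0 <= t] B
        [set A : set (BR * BR) | measurable A /\ A `<=` time_jump]
        (fun A w => N w A)
    & exists J : R -> T -> BR, forall t, 0 <= t ->
        [/\ measurable_fun setT (J t),
            (\int[P]_w ((J t w - compensated_jumps nu N eps t w) ^+ 2)%:E)%E
              @[eps --> 0^'+] --> 0%E
          & {ae P, forall w,
              xi t w = a * t + sigma * B t w + J t w + large_jumps N t w}]].

Definition same_law X Y : Prop :=
  forall (n : nat) (t : nat -> R) (A : nat -> set BR),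
    (forall i, 0 <= t i) -> (forall i, measurable (A i)) ->
    P (\bigcap_(i < n) (X (t i) @^-1` A i)) =
    P (\bigcap_(i < n) (Y (t i) @^-1` A i)).

Definition independent_copy X Y : Prop :=
  [/\ levy_process Y,
      same_law X Y
    & independent_families P [set t : R | 0 <= t] X [set t : R | 0 <= t] Y].

Definition two_sided X Y (t : R) (w : T) : R :=
  if 0 <= t then X t w else X 0 w - lim ((Y s w : R) @[s --> (- t)^'-]).

End Processes.

Section Semigroup.
Context {R : realType}.
Local Notation BR := (measurableTypeR R).
Local Notation leb := (@lebesgue_measure R).

Definition positive_solution (f x : R -> R) (t lambda : R) (u : R -> R) :
    Prop :=
  forall r, r <= t ->
    [/\ 0 <= u r,
        leb.-integrable `[r, t] (fun s => (expR (x s - x r) * f (u s))%:E)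
      & u r = expR (x t - x r) * lambda
              - \int[leb]_(s in `[r, t]) (expR (x s - x r) * f (u s))].

Definition unique_positive_solution (f x : R -> R) (t lambda : R)
    (u : R -> R) : Prop :=
  positive_solution f x t lambda u /\
  forall u', positive_solution f x t lambda u' ->
    forall r, r <= t -> u' r = u r.

(* A transition semigroup on [0, +oo), given by kernels on R whose values at
   negative starting points are irrelevant. *)
Definition transition_semigroup (Q : R -> R.-pker BR ~> BR) : Prop :=
  [/\ forall t x, 0 <= t -> 0 <= x -> Q t x `[0, +oo[%classic = 1%E,
      forall x (A : set BR), 0 <= x -> measurable A -> Q 0 x A = \d_x A
    & forall s t x (A : set BR), 0 <= s -> 0 <= t -> 0 <= x -> measurable A ->
        Q (s + t) x A = (\int[Q s x]_(y in `[0%R, +oo[) Q t y A)%E].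

Definition laplace (mu : {measure set BR -> \bar R}) (lambda : R) : \bar R :=
  (\int[mu]_(y in `[0%R, +oo[) (expR (- (lambda * y)))%:E)%E.

Definition weakly_cvg (Q : R -> {measure set BR -> \bar R})
    (mu : {measure set BR -> \bar R}) : Prop :=
  forall f : R -> R, {within `[0, +oo[, continuous f} ->
    (exists M, forall y, 0 <= y -> `|f y| <= M) ->
    \int[Q t]_(y in `[0, +oo[) f y @[t --> +oo]
      --> \int[mu]_(y in `[0, +oo[) f y.

Definition ergodic_limit (Q : R -> R.-pker BR ~> BR) (mu : probability BR R) :
    Prop :=
  mu `[0, +oo[%classic = 1%E /\ forall x, 0 <= x -> weakly_cvg (fun t => Q t x) mu.

End Semigroup.

(* Main.v *)
Require Import Defs.
From HB Require Import structures.
From mathcomp Require Import all_boot all_order all_algebra.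
From mathcomp Require Import all_classical all_reals all_analysis.
From mathcomp Require Import measurable_realfun.
From mathcomp Require Import ring lra.

Set Implicit Arguments.
Unset Strict Implicit.
Unset Printing Implicit Defensive.

Import Order.TTheory GRing.Theory Num.Theory.
Import numFieldNormedType.Exports.

Local Open Scope classical_set_scope.
Local Open Scope ring_scope.

(** The equation for [v] is solved backwards from its final time, so that the
solution on [[r, t]] is a function of the increments [x t - x s] of the
environment up to [t]. Since a Lévy process has the same increments in law when
read backwards, the exponent of the semigroup at time [t] has the law of the same
exponent over the past interval [[- t, 0]]:

  E exp (- x v(0,t) - int_0^t psi(v(s,t)) ds)
    = E exp (- x v(-t,0) - int_(-t)^0 psi(v(s,0)) ds).

This is [expectation_reversal]. It is proved for an Euler scheme, which depends on
finitely many increments, and passes to the limit by [euler_cost_cvg].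

With the final time fixed at 0 all limits are pathwise. A Lévy process of mean [a1]
stays below a line of any slope greater than [a1] ([levy_sup_bounded]); as
[phi z >= b * z] and [a1 < b], the solution v(s,0) decays exponentially as s tends to
-oo. Hence the term with x disappears, the integral increases to the one over the
half-line, and the Laplace transforms of the semigroup converge, from every
starting point, to

  L(lambda) = E exp (- int_(-oo)^0 psi(v(s,0)) ds)

([expectation_cvg]).

It remains to decide whether L tends to 1 at 0. The environment lies between two
lines with large probability, so that on the k-th unit interval of the past v(s,0)
lies between two geometric sequences, and the question becomes the convergence of
the sums of psi(a q^k). Since 1 - exp(-y) is comparable to ln(1 + y) - ln(1 + q y),
which telescopes along geometric sequences, these sums converge exactly when
the logarithmic moment of [n] is finite ([sum_psi_le_potential],
[log_moment_of_sum_psi]). If it is, the half-line integral is bounded by a potential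
that vanishes with lambda, and L tends to 1 ([limit_laplace_cvg1]); otherwise the
integral is infinite with probability at least 3/4 for all small lambda, and L stays
below 1/4 ([limit_laplace_small]), which no Laplace transform of a probability does.

When L tends to 1, convergence of transforms gives weak convergence
([laplace_continuity]). The proof works with quantile functions on the unit
interval: convergent integrals of finite combinations of exponentials, which
approximate indicators of half-lines, prevent these monotone functions from
oscillating outside of a countable set, and the behaviour of L at 0 keeps them
bounded; so they converge almost everywhere. *)

(** * Real-valued integrals *)

Section RealDominated.
Context d (T : measurableType d) (R : realType) (mu : {measure set T -> \bar R}).
Variables (D : set T) (mD : measurable D).

Lemma Rintegrable_le (f g : T -> R) : measurable_fun D f ->
  mu.-integrable D (EFin \o g) -> (forall x, D x -> `|f x| <= g x) ->
  mu.-integrable D (EFin \o f).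
Proof.
move=> mf ig fg; apply: le_integrable ig => //; first exact/measurable_EFinP.
by move=> x Dx /=; rewrite lee_fin (le_trans (fg x Dx))// ler_norm.
Qed.

Lemma RintegrableD (f g : T -> R) : mu.-integrable D (EFin \o f) ->
  mu.-integrable D (EFin \o g) -> mu.-integrable D (EFin \o (fun x => f x + g x)).
Proof. by move=> i1 i2; have := integrableD mD i1 i2; exact. Qed.

Lemma RintegrableZ (k : R) (f : T -> R) : mu.-integrable D (EFin \o f) ->
  mu.-integrable D (EFin \o (fun x => k * f x)).
Proof. by move=> i1; have := integrableZl mD k i1; exact. Qed.

Lemma RintegrableN (f : T -> R) : mu.-integrable D (EFin \o f) ->
  mu.-integrable D (EFin \o (fun x => - f x)).
Proof. by move=> i1; have := integrableN i1; exact. Qed.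

Lemma RintegrableB (f g : T -> R) : mu.-integrable D (EFin \o f) ->
  mu.-integrable D (EFin \o g) -> mu.-integrable D (EFin \o (fun x => f x - g x)).
Proof. by move=> i1 /RintegrableN i2; exact: RintegrableD. Qed.

Lemma RintegralN (f : T -> R) : mu.-integrable D (EFin \o f) ->
  \int[mu]_(x in D) (- f x) = - \int[mu]_(x in D) f x.
Proof.
move=> i1; under eq_Rintegral do rewrite -mulN1r.
by rewrite RintegralZl// mulN1r.
Qed.

Lemma Rdominated_cvg (f_ : nat -> T -> R) (f g : T -> R) :
  (forall n, measurable_fun D (f_ n)) ->
  (forall x, D x -> f_ ^~ x @ \oo --> f x) ->
  mu.-integrable D (EFin \o g) ->
  (forall n x, D x -> `|f_ n x| <= g x) ->
  mu.-integrable D (EFin \o f) /\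
  \int[mu]_(x in D) f_ n x @[n --> \oo] --> \int[mu]_(x in D) f x.
Proof.
move=> mf_ f_f ig f_g.
have mf : measurable_fun D f by exact: measurable_fun_cvg mf_ f_f.
have [] := @dominated_convergence _ _ _ mu D mD (fun n => EFin \o f_ n)
  (EFin \o f) (EFin \o g).
- by move=> n; exact/measurable_EFinP.
- exact/measurable_EFinP.
- by apply: aeW => x Dx; apply: cvg_EFin; [exact: nearW|exact: f_f].
- exact: ig.
- by apply: aeW => x n Dx /=; rewrite lee_fin f_g.
move=> intf _ cv; split=> //; rewrite /Rintegral.
by apply: fine_cvg; rewrite fineK//; exact: integrable_fin_num.
Qed.

End RealDominated.

(** * Branching and immigration mechanisms *)

Section Mechanism_estimates.
Context {R : realType}.
Local Notation BR := (measurableTypeR R).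
Implicit Types m n : {measure set BR -> \bar R}.
Local Notation Rpos := (`]0%R, +oo[%classic : set BR).

Let mRpos : measurable Rpos. Proof. exact: measurable_itv. Qed.

Definition kernel_phi (z u : R) : R := expR (- (u * z)) - 1 + u * z.

(** The derivative of the kernel in [z] is [u * (1 - expR (- (u * z)))], which is
at most [u] and at most [u ^+ 2 * z]: one bound serves the large atoms of [m],
the other the small ones. Both the sign of the branching mechanism and its
Lipschitz constant come from here. *)
Lemma kernel_phi_incr (K z z' u : R) : 0 < u -> 1 <= K -> 0 <= z -> z <= z' ->
  z' <= K -> 0 <= kernel_phi z' u - kernel_phi z u
             <= (z' - z) * K * Num.min u (u ^+ 2).
Proof.
move=> u0 K1 z0 zz' zK.
pose a := u * (z' - z).
have a0 : 0 <= a by rewrite mulr_ge0 ?subr_ge0// ltW.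
have -> : kernel_phi z' u - kernel_phi z u =
    a - expR (- (u * z)) * (1 - expR (- a)).
  rewrite /kernel_phi mulrBr mulr1 -expRD.
  by rewrite (_ : - (u * z) + - a = - (u * z')); [rewrite /a; ring|rewrite /a; ring].
have e1 : expR (- (u * z)) <= 1.
  by rewrite expR_le1 oppr_le0 mulr_ge0 // ltW.
have e0 := expR_gt0 (- (u * z)).
have ea : 1 - expR (- a) <= a by have := expR_ge1Dx (- a); lra.
have ea0 : 0 <= 1 - expR (- a) by rewrite subr_ge0 expR_le1 oppr_le0.
have ea2 : a * expR (- a) <= 1 - expR (- a).
  have h := expR_ge1Dx a; have p := expR_gt0 (- a).
  have := expRxMexpNx_1 a; nra.
apply/andP; split; first by nra.
have key : a - expR (- (u * z)) * (1 - expR (- a)) <= a * (1 - expR (- (u * z'))).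
  rewrite (_ : expR (- (u * z')) = expR (- (u * z)) * expR (- a)); first nra.
  by rewrite -expRD; congr expR; rewrite /a; ring.
apply: (le_trans key).
have b1 : 1 - expR (- (u * z')) <= 1 by have := expR_gt0 (- (u * z')); lra.
have b2 : 1 - expR (- (u * z')) <= u * z' by have := expR_ge1Dx (- (u * z')); lra.
have z'0 : 0 <= z' by exact: le_trans zz'.
rewrite minEle; case: ifPn => _; rewrite /a.
  have : u * (z' - z) * (1 - expR (- (u * z'))) <= u * (z' - z) * 1.
    by rewrite ler_wpM2l.
  move/le_trans; apply; rewrite mulr1 mulrC -mulrA ler_wpM2l ?subr_ge0//.
  by rewrite ler_peMl// ltW.
have : u * (z' - z) * (1 - expR (- (u * z'))) <= u * (z' - z) * (u * z').
  by rewrite ler_wpM2l.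
move/le_trans; apply.
rewrite (_ : _ * (u * z') = (z' - z) * z' * u ^+ 2); last by ring.
by rewrite ler_wpM2r ?sqr_ge0// ler_wpM2l// subr_ge0.
Qed.

Lemma kernel_phi0 u : kernel_phi 0 u = 0.
Proof. by rewrite /kernel_phi mulr0 oppr0 expR0; ring. Qed.

Lemma measurable_kernel_phi (z : R) : measurable_fun Rpos (kernel_phi z).
Proof.
apply: measurable_funD; last exact: mulrr_measurable.
apply: measurable_funB => //.
by do 2 apply: measurableT_comp => //; exact: mulrr_measurable.
Qed.

Section Phi.
Variables (b c : R) (m : {measure set BR -> \bar R}).
Hypothesis hm : branching_mechanism c m.

Definition branching_mass : R :=
  \int[m]_(u in `]0, +oo[) Num.min u (u ^+ 2).

Lemma integrable_min_sqr :
  m.-integrable Rpos (EFin \o (fun u : R => Num.min u (u ^+ 2))).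
Proof.
apply/integrableP; split.
  by apply/measurable_EFinP; apply: measurable_minr.
case: hm => _; apply: le_lt_trans; rewrite le_eqVlt; apply/orP; left; apply/eqP.
apply: eq_integral => u; rewrite inE/= in_itv/= andbT => u0.
by rewrite ger0_norm// le_min ltW//= sqr_ge0.
Qed.

Lemma integrable_kernel_phi (z : R) : 0 <= z ->
  m.-integrable Rpos (EFin \o kernel_phi z).
Proof.
move=> z0; pose K := Num.max 1 z.
have K1 : 1 <= K by rewrite le_max lexx.
have zK : z <= K by rewrite le_max lexx orbT.
apply: (@Rintegrable_le _ _ _ m _ _ _
  (fun u : R => z * K * Num.min u (u ^+ 2))) => //.
- exact: measurable_kernel_phi.
- have := integrableZl mRpos (z * K) integrable_min_sqr.
  exact.
- move=> u /=; rewrite in_itv/= andbT => u0.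
  have := kernel_phi_incr u0 K1 (lexx 0) z0 zK.
  by rewrite kernel_phi0 !subr0 => /andP[h1 h2]; rewrite ger0_norm.
Qed.

Definition phi_rem (z : R) : R := \int[m]_(u in `]0, +oo[) kernel_phi z u.

Lemma phi_rem_incr (K z z' : R) : 1 <= K -> 0 <= z -> z <= z' -> z' <= K ->
  0 <= phi_rem z' - phi_rem z <= (z' - z) * K * branching_mass.
Proof.
move=> K1 z0 zz' zK.
have z'0 := le_trans z0 zz'.
rewrite /phi_rem -RintegralB//; [|exact: integrable_kernel_phi..].
apply/andP; split.
  apply: Rintegral_ge0 => u /=; rewrite in_itv/= andbT => u0.
  by have /andP[] := kernel_phi_incr u0 K1 z0 zz' zK.
rewrite /branching_mass -RintegralZl//; last exact: integrable_min_sqr.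
apply: le_Rintegral => //.
- have := integrableB mRpos (integrable_kernel_phi z'0)
    (integrable_kernel_phi z0).
  exact.
- have := integrableZl mRpos ((z' - z) * K) integrable_min_sqr.
  exact.
- move=> u /=; rewrite in_itv/= andbT => u0.
  by have /andP[] := kernel_phi_incr u0 K1 z0 zz' zK.
Qed.

Lemma phi_rem0 : phi_rem 0 = 0.
Proof.
rewrite /phi_rem /Rintegral integral0_eq// => u _.
by rewrite kernel_phi0.
Qed.

Lemma phi0 : phi b c m 0 = 0.
Proof. by rewrite /phi -/(phi_rem 0) phi_rem0; ring. Qed.

Lemma phi_ge (z : R) : 0 <= z -> b * z <= phi b c m z.
Proof.
move=> z0; case: (hm) => c0 _.
have zK : z <= Num.max 1 z by rewrite le_max lexx orbT.
have K1 : 1 <= Num.max 1 z by rewrite le_max lexx.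
have /andP[+ _] := phi_rem_incr K1 (lexx 0) z0 zK.
rewrite phi_rem0 subr0 /phi -/(phi_rem z) => r0.
by rewrite -addrA lerDl addr_ge0// mulr_ge0// sqr_ge0.
Qed.

(** A Lipschitz constant of [phi] on [[0, K]], for [K] at least 1. *)
Definition phi_lip (K : R) : R := `|b| + 2 * c * K + K * branching_mass.

Lemma branching_mass_ge0 : 0 <= branching_mass.
Proof.
by apply: Rintegral_ge0 => u /=; rewrite in_itv/= andbT => u0; rewrite le_min (ltW u0) sqr_ge0.
Qed.

Lemma phi_lipschitz (K z z' : R) : 1 <= K -> 0 <= z <= K -> 0 <= z' <= K ->
  `|phi b c m z' - phi b c m z| <= phi_lip K * `|z' - z|.
Proof.
move=> K1; wlog zz' : z z' / z <= z' => [hw zK z'K|/andP[z0 zK] /andP[z'0 z'K]].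
  by have [|/ltW] := leP z z' => h; [exact: hw|rewrite distrC (distrC z') hw].
case: (hm) => c0 _.
have /andP[r0 r1] := phi_rem_incr K1 z0 zz' z'K.
have -> : phi b c m z' - phi b c m z =
    b * (z' - z) + c * (z' + z) * (z' - z) + (phi_rem z' - phi_rem z).
  by rewrite /phi -/(phi_rem z) -/(phi_rem z'); ring.
have d0 : 0 <= z' - z by rewrite subr_ge0.
apply: (le_trans (ler_normD _ _)); rewrite (ger0_norm r0) (ger0_norm d0).
apply: (@le_trans _ _ ((`|b| * (z' - z) + 2 * c * K * (z' - z)) +
   (z' - z) * K * branching_mass)); last first.
  by rewrite /phi_lip le_eqVlt; apply/orP; left; apply/eqP; ring.
apply: lerD => //; apply: (le_trans (ler_normD _ _)).
apply: lerD; first by rewrite normrM (ger0_norm d0).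
rewrite ger0_norm; last by rewrite mulr_ge0// mulr_ge0// addr_ge0.
rewrite ler_wpM2r// (mulrC 2) -mulrA ler_wpM2l//; lra.
Qed.

Lemma phi_le_lin (z : R) : 0 <= z <= 1 -> phi b c m z <= phi_lip 1 * z.
Proof.
move=> z01; have := phi_lipschitz (lexx 1) _ z01 => /(_ 0).
rewrite phi0 !subr0 lexx ler01 (ger0_norm (proj1 (andP z01))) => /(_ isT).
exact: le_trans (ler_norm _).
Qed.

Lemma phi_lip_ge0 (K : R) : 0 <= K -> 0 <= phi_lip K.
Proof.
move=> K0; case: (hm) => c0 _; rewrite !addr_ge0// mulr_ge0//.
  by rewrite mulr_ge0.
exact: branching_mass_ge0.
Qed.

(** [phi] is meaningful at nonnegative arguments only, hence the truncation. *)
Lemma measurable_phi_pos :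
  measurable_fun setT (fun z : R => phi b c m (Num.max 0 z)).
Proof.
have -> : (fun z : R => phi b c m (Num.max 0 z)) =
  (fun z => b * (Num.max 0 z) + c * (Num.max 0 z) ^+ 2) \+
  (fun z => phi_rem (Num.max 0 z)) by [].
have mmax : measurable_fun setT (fun z : R => Num.max 0 z).
  exact: measurable_maxr.
apply: measurable_funD.
  apply: measurable_funD.
    by apply: (measurableT_comp (@mulrl_measurable _ _ b)).
  apply: (measurableT_comp (@mulrl_measurable _ _ c)).
  exact: measurable_funX.
apply: nondecreasing_measurable => // z z' zz'.
have h0 (x : R) : 0 <= Num.max 0 x by rewrite le_max lexx.
have hh : Num.max 0 z <= Num.max 0 z'.
  by rewrite ge_max h0 /= le_max zz' orbT.
have K1 : 1 <= Num.max 1 (Num.max 0 z') by rewrite le_max lexx.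
have zK : Num.max 0 z' <= Num.max 1 (Num.max 0 z') by rewrite le_max lexx orbT.
have /andP[+ _] := phi_rem_incr K1 (h0 z) hh zK.
by rewrite subr_ge0.
Qed.

End Phi.

Section Psi.
Variables (h : R) (n : {measure set BR -> \bar R}).
Hypothesis hn : immigration_mechanism h n.

Let kern (x u : R) : R := 1 - expR (- (x * u)).

Lemma measurable_psi_kernel (x : R) D : measurable_fun D (kern x).
Proof.
apply: measurable_funTS; apply: measurable_funB => //.
by do 2 apply: measurableT_comp => //; exact: mulrl_measurable.
Qed.

Lemma psi_kernel_ge0 (x u : R) : 0 <= x -> 0 <= u -> 0 <= kern x u.
Proof.
by move=> x0 u0; rewrite subr_ge0 expR_le1 oppr_le0 mulr_ge0.
Qed.

Lemma psi_kernel_le (x x' u : R) : x <= x' -> 0 <= u -> kern x u <= kern x' u.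
Proof.
by move=> xx' u0; rewrite /kern lerD2l lerN2 ler_expR lerN2 ler_wpM2r.
Qed.

Lemma psi_kernel_bound (x u : R) : 0 <= x -> 0 < u ->
  kern x u <= Num.max 1 x * Num.min 1 u.
Proof.
move=> x0 u0.
have k1 : kern x u <= 1 by have := expR_gt0 (- (x * u)); rewrite /kern; lra.
have k2 : kern x u <= x * u by have := expR_ge1Dx (- (x * u)); rewrite /kern; lra.
have m1 : 1 <= Num.max 1 x by rewrite le_max lexx.
have m2 : x <= Num.max 1 x by rewrite le_max lexx orbT.
rewrite minEle; case: ifPn => _; first by rewrite mulr1; exact: le_trans m1.
by apply: (le_trans k2); rewrite ler_wpM2r// ltW.
Qed.

Lemma integrable_min1 :
  n.-integrable Rpos (EFin \o (fun u : R => Num.min 1 u)).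
Proof.
apply/integrableP; split.
  by apply/measurable_EFinP; apply: measurable_minr.
case: hn => _; apply: le_lt_trans; rewrite le_eqVlt; apply/orP; left; apply/eqP.
apply: eq_integral => u; rewrite inE/= in_itv/= andbT => u0.
by rewrite ger0_norm// le_min ltW//= ltW.
Qed.

Lemma integrable_psi_kernel (x : R) : 0 <= x -> n.-integrable Rpos (EFin \o kern x).
Proof.
move=> x0.
apply: (@Rintegrable_le _ _ _ n _ _ _
  (fun u : R => Num.max 1 x * Num.min 1 u)) => //.
- exact: measurable_psi_kernel.
- have := integrableZl mRpos (Num.max 1 x) integrable_min1.
  exact.
- move=> u /=; rewrite in_itv/= andbT => u0.
  by rewrite ger0_norm; [exact: psi_kernel_bound|exact/psi_kernel_ge0/ltW].
Qed.

Lemma psi_ge0 (x : R) : 0 <= x -> 0 <= psi h n x.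
Proof.
move=> x0; case: hn => h0 _; rewrite addr_ge0// ?mulr_ge0//.
by apply: Rintegral_ge0 => u /=; rewrite in_itv/= andbT => u0; rewrite psi_kernel_ge0// ltW.
Qed.

Lemma psi_le (x x' : R) : 0 <= x -> x <= x' -> psi h n x <= psi h n x'.
Proof.
move=> x0 xx'; have x'0 := le_trans x0 xx'; case: hn => h0 _.
apply: lerD; first by rewrite ler_wpM2l.
apply: le_Rintegral => //; [exact: integrable_psi_kernel..|].
by move=> u /=; rewrite in_itv/= andbT => u0; rewrite psi_kernel_le// ltW.
Qed.

(** The kernel at an upper bound of the sequence dominates all the others. *)
Lemma psi_cvg (x_ : nat -> R) (x : R) : (forall k, 0 <= x_ k) ->
  x_ @ \oo --> x -> (fun k => psi h n (x_ k)) @ \oo --> psi h n x.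
Proof.
move=> x_0 cx.
have /cvg_seq_bounded[M [_ hM]] : cvgn x_ by apply/cvg_ex; exists x.
pose K := M + 1.
have xK k : x_ k <= K.
  by apply: (le_trans (ler_norm _)); apply: hM => //; rewrite ltrDl.
have K0 : 0 <= K by exact: le_trans (xK 0%N).
apply: cvgD; first by apply: cvgM => //; exact: cvg_cst.
have [] := @Rdominated_cvg _ _ _ n Rpos mRpos
  (fun k => kern (x_ k)) (kern x) (kern K); last by [].
- by move=> k; exact: measurable_psi_kernel.
- move=> u _; apply: cvgB; first exact: cvg_cst.
  apply: (continuous_cvg _ (@continuous_expR _ _)).
  by apply: cvgN; apply: cvgM => //; exact: cvg_cst.
- exact: integrable_psi_kernel.
- move=> k u /=; rewrite in_itv/= andbT => u0.
  by rewrite ger0_norm; [exact/psi_kernel_le/ltW|exact/psi_kernel_ge0/ltW].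
Qed.

Lemma measurable_psi_pos :
  measurable_fun setT (fun z : R => psi h n (Num.max 0 z)).
Proof.
apply: nondecreasing_measurable => // z z' zz'.
have h0 (x : R) : 0 <= Num.max 0 x by rewrite le_max lexx.
by apply: psi_le => //; rewrite ge_max h0 /= le_max zz' orbT.
Qed.

End Psi.
End Mechanism_estimates.

(** * Geometric sums of the immigration mechanism and the logarithmic moment *)

Section Log_moment.
Context {R : realType}.
Local Notation BR := (measurableTypeR R).
Local Notation Rpos := (`]0%R, +oo[%classic : set BR).
Local Notation Rge1 := (`[1%R, +oo[%classic : set BR).

Let mRpos : measurable Rpos. Proof. exact: measurable_itv. Qed.

Definition log_moment (n : {measure set BR -> \bar R}) : Prop :=
  (\int[n]_(u in `[1%R, +oo[) (ln u)%:E < +oo)%E.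

(** Both [1 - expR (- y)] and [ln (1 + y) - ln (1 + q * y)] are comparable to
[y / (1 + y)]. The second one telescopes along the geometric sequence
[q ^+ k * y], which is what turns sums of [psi] into logarithmic moments. *)
Lemma kernel_telescope_upper (q y : R) : 0 < q < 1 -> 0 <= y ->
  1 - expR (- y) <= 2 / (1 - q) * (ln (1 + y) - ln (1 + q * y)).
Proof.
move=> /andP[q0 q1] y0.
have qy0 : 0 <= q * y by rewrite mulr_ge0// ltW.
have p1 : 0 < 1 + y by lra.
have p2 : 0 < 1 + q * y by lra.
have k1 : 1 - expR (- y) <= 2 * (y / (1 + y)).
  have e1 := expR_gt0 (- y); have e2 := expR_ge1Dx (- y).
  rewrite mulrA ler_pdivlMr//; have [y1|y1] := leP y 1; nra.
have k2 : (1 - q) * (y / (1 + y)) <= ln (1 + y) - ln (1 + q * y).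
  rewrite -lerN2 opprB -ln_div ?posrE//.
  have -> : (1 + q * y) / (1 + y) = 1 + - ((1 - q) * (y / (1 + y))).
    by field; rewrite gt_eqF.
  apply: le_ln1Dx; rewrite ltrN2 mulrA ltr_pdivrMr//; nra.
apply: (le_trans k1); rewrite -mulrA; apply: ler_wpM2l => //.
by rewrite ler_pdivlMl ?subr_gt0.
Qed.

Lemma kernel_telescope_lower (q y : R) : 0 < q < 1 -> 0 <= y ->
  ln (1 + y) - ln (1 + q * y) <= (1 - q) / q * (1 - expR (- y)).
Proof.
move=> /andP[q0 q1] y0.
have qy0 : 0 <= q * y by rewrite mulr_ge0// ltW.
have p1 : 0 < 1 + y by lra.
have p2 : 0 < 1 + q * y by lra.
have k1 : y / (1 + y) <= 1 - expR (- y).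
  have e1 := expR_ge1Dx y; have e3 := expRxMexpNx_1 y; have e4 := expR_gt0 (- y).
  by rewrite ler_pdivrMr//; nra.
have k2 : ln (1 + y) - ln (1 + q * y) <= (1 - q) / q * (y / (1 + y)).
  rewrite -ln_div ?posrE//.
  have -> : (1 + y) / (1 + q * y) = 1 + (1 - q) * y / (1 + q * y).
    by field; rewrite gt_eqF.
  have c0 : 0 <= (1 - q) * y by rewrite mulr_ge0// subr_ge0 ltW.
  apply: (@le_trans _ _ ((1 - q) * y / (1 + q * y))).
    by apply: le_ln1Dx; apply: (@lt_le_trans _ _ 0) => //; rewrite divr_ge0// ltW.
  rewrite (_ : (1 - q) / q * _ = (1 - q) * y / (q * (1 + y))); last first.
    by field; rewrite !gt_eqF.
  rewrite ler_wpM2l// lef_pV2 ?posrE//; last by rewrite mulr_gt0.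
  by nra.
apply: (le_trans k2); rewrite ler_wpM2l// divr_ge0//; lra.
Qed.

Section Fixed.
Variables (h : R) (n : {measure set BR -> \bar R}).
Hypothesis hn : immigration_mechanism h n.

Lemma measurable_ln1 (x : R) (D : set R) :
  measurable_fun D (fun u : R => ln (1 + x * u)).
Proof.
apply: measurable_funTS; apply: (measurableT_comp (@measurable_ln R)).
by apply: measurable_funD => //; exact: mulrl_measurable.
Qed.

(** Near 0 the integrand is at most [x * u]; from 1 on it is at most
[ln (1 + x) + ln u]. *)
Lemma integrable_ln1 (x : R) : log_moment n -> 0 <= x ->
  n.-integrable Rpos (EFin \o (fun u : R => ln (1 + x * u))).
Proof.
move=> hlog x0.
have iln : n.-integrable Rge1 (EFin \o @ln R).
  apply/integrableP; split.
    by apply/measurable_EFinP; apply: measurable_funTS; exact: measurable_ln.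
  move: hlog; apply: le_lt_trans; rewrite le_eqVlt; apply/orP; left; apply/eqP.
  apply: eq_integral => u; rewrite inE/= in_itv/= andbT => u1.
  by rewrite ger0_norm// ln_ge0.
have iln' : n.-integrable Rpos (EFin \o ((@ln R) \_ Rge1)).
  rewrite -restrict_EFin; apply/integrable_restrict => //.
  by apply: integrableS iln => //; first [exact: measurableI|exact: subIsetr].
pose C := x + ln (1 + x).
have i1 := integrableZl mRpos C (integrable_min1 hn).
have i2 := integrableD mRpos i1 iln'.
apply: (@Rintegrable_le _ _ _ n _ _ _
  (fun u => C * Num.min 1 u + ((@ln R) \_ Rge1) u)) => //.
  exact: measurable_ln1.
have l0 : 0 <= ln (1 + x) by apply: ln_ge0; lra.
move=> u /=; rewrite in_itv/= andbT => u0.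
have xu0 : 0 <= x * u by rewrite mulr_ge0// ltW.
rewrite ger0_norm; last by apply: ln_ge0; lra.
rewrite patchE mem_setE in_itv/= andbT; case: ifPn => [u1|].
  rewrite min_l//; apply: (@le_trans _ _ (ln ((1 + x) * u))).
    rewrite ler_ln ?posrE; [|lra|by rewrite mulr_gt0//; lra].
    by rewrite mulrDl mul1r lerD2r.
  rewrite lnM ?posrE//; last lra.
  by rewrite mulr1 lerD2r /C; lra.
rewrite -ltNge => u1; rewrite (min_r (ltW u1)) addr0 /C.
apply: (@le_trans _ _ (x * u)); first by apply: le_ln1Dx; lra.
by rewrite ler_wpM2r ?(ltW u0)//; lra.
Qed.

(** Sum over [k] of the telescoping bounds for [psi h n (q ^+ k * x)]. *)
Definition psi_potential (q x : R) : R :=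
  h * x / (1 - q) + 2 / (1 - q) * \int[n]_(u in `]0, +oo[) ln (1 + x * u).

Lemma psi_potential_ge0 (q x : R) : 0 < q < 1 -> 0 <= x ->
  0 <= psi_potential q x.
Proof.
move=> /andP[q0 q1] x0; case: hn => h0 _.
have d0 : 0 < 1 - q by lra.
rewrite addr_ge0// ?divr_ge0 ?mulr_ge0 ?(ltW d0)//.
  by rewrite invr_ge0 ltW.
apply: Rintegral_ge0 => u /=; rewrite in_itv/= andbT => u0.
by apply: ln_ge0; rewrite lerDl mulr_ge0// ltW.
Qed.

Lemma psi_le_potential (q x : R) : log_moment n -> 0 < q < 1 -> 0 <= x ->
  psi h n x <= psi_potential q x - psi_potential q (q * x).
Proof.
move=> hlog q01 x0; have /andP[q0 q1] := q01.
have d0 : 0 < 1 - q by lra.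
have qx0 : 0 <= q * x by rewrite mulr_ge0// ltW.
rewrite /psi_potential /psi.
have -> : forall A B : R, h * x / (1 - q) + 2 / (1 - q) * A -
    (h * (q * x) / (1 - q) + 2 / (1 - q) * B) = h * x + 2 / (1 - q) * (A - B).
  by move=> A B; field; rewrite gt_eqF.
rewrite lerD2l.
have i1 := integrable_ln1 hlog x0; have i2 := integrable_ln1 hlog qx0.
have i3 := integrableB mRpos i1 i2.
rewrite -RintegralB// -RintegralZl//.
apply: le_Rintegral => //.
- exact: (integrable_psi_kernel hn).
- exact: (integrableZl mRpos (2 / (1 - q)) i3).
- move=> u /=; rewrite in_itv/= andbT => u0.
  rewrite -mulrA; apply: kernel_telescope_upper => //.
  by rewrite mulr_ge0// ltW.
Qed.

Lemma sum_psi_le_potential (q x : R) (N : nat) : log_moment n -> 0 < q < 1 ->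
  0 <= x -> \sum_(k < N) psi h n (q ^+ k * x) <= psi_potential q x.
Proof.
move=> hlog q01 x0; have /andP[q0 q1] := q01.
have qx0 k : 0 <= q ^+ k * x by rewrite mulr_ge0// exprn_ge0// ltW.
have : \sum_(k < N) psi h n (q ^+ k * x) <=
    psi_potential q x - psi_potential q (q ^+ N * x).
  elim: N => [|N ih]; first by rewrite big_ord0 expr0 mul1r subrr.
  rewrite big_ord_recr/= exprS.
  have := psi_le_potential hlog q01 (qx0 N).
  by rewrite mulrA; lra.
by have := psi_potential_ge0 q01 (qx0 N); lra.
Qed.

Lemma psi_potential_cvg0 (q x : R) : log_moment n -> 0 < q < 1 -> 0 <= x ->
  (fun j => psi_potential q (q ^+ j * x)) @ \oo --> (0 : R).
Proof.
move=> hlog q01 x0; have /andP[q0 q1] := q01.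
have cq : (fun j => q ^+ j * x) @ \oo --> (0 : R).
  rewrite -[X in _ --> X](mul0r x); apply: cvgM; last exact: cvg_cst.
  by apply: cvg_expr; rewrite gtr0_norm.
have -> : (0 : R) = h * 0 / (1 - q) + 2 / (1 - q) * 0 by rewrite mulr0 mul0r mulr0 addr0.
apply: cvgD.
  by apply: cvgM; [apply: cvgM => //; exact: cvg_cst|exact: cvg_cst].
apply: cvgM; first exact: cvg_cst.
rewrite [X in _ --> X](_ : 0 = \int[n]_(u in Rpos) (cst 0 u) :> R); last first.
  by rewrite /Rintegral integral0.
have [] := @Rdominated_cvg _ _ _ n Rpos mRpos
  (fun k u => ln (1 + q ^+ k * x * u)) (cst 0) (fun u => ln (1 + x * u)); last by move=> _ cv; exact: cv.
- by move=> k; exact: measurable_ln1.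
- move=> u _; rewrite -[X in _ --> X](@ln1 R).
  apply: (continuous_cvg _ (@continuous_ln _ _ ltr01)).
  rewrite -[X in _ --> X]addr0; apply: cvgD; first exact: cvg_cst.
  by rewrite -[X in _ --> X](mul0r u); apply: cvgM => //; exact: cvg_cst.
- exact: integrable_ln1.
- move=> k u /=; rewrite in_itv/= andbT => u0.
  have a0 : 0 <= q ^+ k * x * u by rewrite !mulr_ge0 ?exprn_ge0// ltW.
  rewrite ger0_norm; last by apply: ln_ge0; lra.
  have : q ^+ k * x * u <= x * u.
    rewrite ler_wpM2r// ?(ltW u0)// ler_piMl// exprn_ile1// ltW//.
  by move=> a1; rewrite ler_ln ?posrE; lra.
Qed.

(** The converse telescoping bound makes the integrals of
[ln (1 + a * u) - ln (1 + q ^+ N * a * u)] bounded in [N]; these integrands increase to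
[ln (1 + a * u)], and [ln u] is at most this plus [`|ln a|]. *)
Lemma log_moment_of_sum_psi (q a S : R) : 0 < q < 1 -> 0 < a ->
  (forall N, \sum_(k < N) psi h n (q ^+ k * a) <= S) -> log_moment n.
Proof.
move=> q01 a0 hS; have /andP[q0 q1] := q01; case: (hn) => h0 _.
pose C := (1 - q) / q.
have C0 : 0 <= C by rewrite divr_ge0//; lra.
pose f N (u : R) : R := ln (1 + a * u) - ln (1 + q ^+ N * a * u).
have qk k : 0 <= q ^+ k * a by rewrite mulr_ge0 ?exprn_ge0// ltW.
have fle N u : 0 < u -> f N u <= C * \sum_(k < N) (1 - expR (- (q ^+ k * a * u))).
  move=> u0; rewrite /f; elim: N => [|N ih].
    by rewrite big_ord0 mulr0 expr0 mul1r subrr.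
  rewrite big_ord_recr/= mulrDr.
  have := kernel_telescope_lower q01 (_ : 0 <= q ^+ N * a * u).
  rewrite mulr_ge0 ?(ltW u0)// => /(_ isT).
  by rewrite !mulrA -exprS -/C; lra.
have ik k : n.-integrable Rpos (EFin \o (fun u => 1 - expR (- (q ^+ k * a * u)))).
  exact: (integrable_psi_kernel hn).
have isum N : n.-integrable Rpos
    (EFin \o (fun u => \sum_(k < N) (1 - expR (- (q ^+ k * a * u))))).
  have := @integrable_sum _ _ _ n _ mRpos _ (index_enum 'I_N) xpredT
    (fun k : 'I_N => EFin \o (fun u => 1 - expR (- (q ^+ k * a * u)))).
  move=> /(_ (fun k _ => ik k)); apply: eq_integrable => // u _.
  by rewrite /= -sumEFin.
have f0 N u : 0 < u -> 0 <= f N u.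
  move=> u0; rewrite subr_ge0 ler_ln ?posrE.
  - rewrite lerD2l ler_wpM2r ?(ltW u0)// ler_piMl ?(ltW a0)//.
    by rewrite exprn_ile1// ltW.
  - by rewrite ltr_pwDl// mulr_ge0// ltW.
  - by rewrite ltr_pwDl// mulr_ge0// ltW.
have mf N : measurable_fun Rpos (EFin \o f N).
  by apply/measurable_EFinP; apply: measurable_funB; exact: measurable_ln1.
(* Integrate the telescoped bound term by term. *)
have intf N : (\int[n]_(u in Rpos) (f N u)%:E <= (C * S)%:E)%E.
  have i2 := integrableZl mRpos C (isum N).
  apply: (@le_trans _ _
    (\int[n]_(u in Rpos) (C * \sum_(k < N) (1 - expR (- (q ^+ k * a * u))))%:E)%E).
    apply: ge0_le_integral => //.
    - by move=> u /=; rewrite in_itv/= andbT => u0; rewrite lee_fin f0.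
    - exact: mf.
    - exact: (measurable_int n i2).
    - by move=> u /=; rewrite in_itv/= andbT => u0; rewrite lee_fin fle.
  have -> : (\int[n]_(u in Rpos) (C * \sum_(k < N) (1 - expR (- (q ^+ k * a * u))))%:E)%E =
     (C * \sum_(k < N) \int[n]_(u in `]0, +oo[) (1 - expR (- (q ^+ k * a * u))))%:E.
    under eq_integral do rewrite (EFinM C).
    rewrite integralZl//; last exact: isum.
    rewrite (EFinM C); congr (_ * _)%E.
    under eq_integral do rewrite -sumEFin.
    rewrite integral_sum//; [|by move=> k; exact: ik].
    rewrite -sumEFin; apply: eq_bigr => k _.
    by rewrite /Rintegral fineK//; exact: (integrable_fin_num mRpos (ik k)).
  rewrite lee_fin ler_wpM2l//; apply: le_trans (hS N).
  by apply: ler_sum => k _; rewrite /psi lerDr mulr_ge0.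
(* Let N tend to infinity by monotone convergence. *)
have intl : (\int[n]_(u in Rpos) (ln (1 + a * u))%:E <= (C * S)%:E)%E.
  have cv := @cvg_monotone_convergence _ _ R n Rpos mRpos
    (fun N => EFin \o f N) mf.
  have lf u : Rpos u -> (EFin \o f^~ u) @ \oo --> (ln (1 + a * u))%:E.
    move=> /=; rewrite in_itv/= andbT => u0.
    apply: cvg_EFin; first exact: nearW.
    rewrite /f -[X in _ --> X]subr0; apply: cvgB; first exact: cvg_cst.
    rewrite -(@ln1 R).
    apply: (continuous_cvg _ (@continuous_ln _ _ ltr01)).
    rewrite -[X in _ --> X]addr0; apply: cvgD; first exact: cvg_cst.
    rewrite -(mul0r u) -(mul0r a); apply: cvgM; last exact: cvg_cst.
    apply: cvgM; last exact: cvg_cst.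
    by apply: cvg_expr; rewrite gtr0_norm.
  have -> : (\int[n]_(u in Rpos) (ln (1 + a * u))%:E =
      \int[n]_(u in Rpos) limn (fun N => (EFin \o f N) u))%E.
    by apply: eq_integral => u; rewrite inE => Du; apply/esym/cvg_lim => //; exact: lf.
  have c1 : forall N u, Rpos u -> (0 <= (EFin \o f N) u)%E.
    by move=> N u /=; rewrite in_itv/= andbT => u0; rewrite lee_fin f0.
  have c2 : forall u, Rpos u -> {homo (fun N => (EFin \o f N) u) : N M / (N <= M)%N >-> (N <= M)%E}.
    move=> u /=; rewrite in_itv/= andbT => u0 N M NM; rewrite lee_fin.
    rewrite lerD2l lerN2 ler_ln ?posrE; last 2 first.
      by rewrite ltr_pwDl// mulr_ge0// ltW.
      by rewrite ltr_pwDl// mulr_ge0// ltW.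
    rewrite lerD2l !ler_wpM2r ?(ltW u0) ?(ltW a0)//.
    by apply: ler_wiXn2l => //; exact: ltW.
  have {}cv := cv c1 c2; rewrite -(cvg_lim _ cv)//.
  by apply: lime_le; [apply/cvg_ex; eexists; exact: cv|exact: nearW].
rewrite /log_moment.
have il : n.-integrable Rpos (EFin \o (fun u => ln (1 + a * u))).
  apply/integrableP; split; first by apply/measurable_EFinP; exact: measurable_ln1.
  apply: le_lt_trans (ltry (C * S)); apply: le_trans intl.
  rewrite le_eqVlt; apply/orP; left; apply/eqP.
  apply: eq_integral => u; rewrite inE/= in_itv/= andbT => u0.
  by rewrite ger0_norm// ln_ge0// lerDl mulr_ge0// ltW.
have ig := integrableD mRpos il (integrableZl mRpos `|ln a| (integrable_min1 hn)).
have sub : Rge1 `<=` Rpos.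
  by move=> u /=; rewrite !in_itv/= !andbT; exact: lt_le_trans.
have : n.-integrable Rge1 (EFin \o @ln R).
  apply: (@Rintegrable_le _ _ _ n _ _ _
    (fun u => ln (1 + a * u) + `|ln a| * Num.min 1 u)) => //.
  - by apply: measurable_funTS; exact: measurable_ln.
  - exact: integrableS ig.
  - move=> u /=; rewrite in_itv/= andbT => u1; rewrite (min_l u1) mulr1.
    have u0 : 0 < u by exact: lt_le_trans u1.
    rewrite ger0_norm ?ln_ge0//.
    have au : 0 < a * u by rewrite mulr_gt0.
    have : ln (a * u) <= ln (1 + a * u) by rewrite ler_ln ?posrE//; lra.
    rewrite lnM ?posrE//; have := ler_norm (- ln a); rewrite normrN; lra.
move=> /integrableP[_]; apply: le_lt_trans.
apply: ge0_le_integral => //.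
- by move=> u /=; rewrite in_itv/= andbT => u1; rewrite lee_fin ln_ge0.
- by apply/measurable_EFinP; apply: measurable_funTS; exact: measurable_ln.
- apply/measurable_EFinP; apply: measurableT_comp => //.
  by apply: measurable_funTS; exact: measurable_ln.
- by move=> u _ /=; rewrite lee_fin ler_norm.
Qed.

End Fixed.
End Log_moment.

(** * Backward integral equations *)

Section Backward_growth.
Context {R : realType}.
Local Notation leb := (@lebesgue_measure R).

Lemma within_cts_eps (a b : R) (f : R -> R) :
  {within `[a, b], continuous f} ->
  forall s, a <= s <= b -> forall e, 0 < e -> exists2 dl, 0 < dl &
    forall q, a <= q <= b -> `|q - s| < dl -> `|f q - f s| < e.
Proof.
move=> /subspace_continuousP cf s sab e e0.
have := cf s; rewrite /= in_itv/= => /(_ sab) /cvgrPdist_lt /(_ e e0).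
rewrite near_withinE => -[dl /= dl0 hdl]; exists dl => // q qab qs.
by rewrite distrC; apply: hdl; [rewrite /= distrC|rewrite /= in_itv].
Qed.

(** A Gronwall argument for functions known only through the growth of [f] over
intervals on which it is nonnegative. Were [f] positive somewhere, take the first
zero [s0] to the right of it: on an interval of length at most [1 / (2 * (K + 1))]
to the left of [s0], the maximum of [f] would be at most half of itself. *)
Lemma backward_comparison (r0 t K : R) (f : R -> R) : 0 <= K ->
  {within `[r0, t], continuous f} -> f t <= 0 ->
  (forall p s M, r0 <= p -> p <= s -> s <= t ->
     (forall q, p <= q <= s -> 0 <= f q <= M) ->
     f p - f s <= K * (s - p) * M) ->
  forall r, r0 <= r <= t -> f r <= 0.
Proof.
move=> K0 cf ft hf r /andP[r0r rt].
rewrite leNgt; apply/negP => fr.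
have ceps := within_cts_eps cf.
pose S := [set s | r <= s <= t /\ f s <= 0].
have St : S t by split; rewrite ?rt ?lexx.
have Slb : lbound S r by move=> s [/andP[]].
have hS : has_inf S by split; [exists t|exists r].
pose s0 := inf S.
have rs0 : r <= s0 by apply: lb_le_inf => //; exists t.
have s0t : s0 <= t by apply: (ge_inf _ St); exists r.
have r0s0 : r0 <= s0 by exact: le_trans rs0.
have fs0 : f s0 <= 0.
  rewrite leNgt; apply/negP => fs0.
  have [|dl dl0 hdl] := ceps s0 _ (f s0) fs0; first by rewrite r0s0.
  have [s Ss ss0] := inf_adherent dl0 hS; case: (Ss) => /andP[rs st] fs.
  have s0s : s0 <= s by apply: (ge_inf _ Ss); exists r => x [/andP[]].
  have := hdl s; rewrite st (le_trans r0r rs) => /(_ isT).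
  rewrite ger0_norm ?subr_ge0// ltrBlDl => /(_ ss0).
  by rewrite ltr_norml; lra.
have pos q : r <= q -> q < s0 -> 0 < f q.
  move=> rq qs0; rewrite ltNge; apply/negP => fq.
  have Sq : S q by split => //; rewrite rq (le_trans (ltW qs0) s0t).
  by have : s0 <= q by [apply: (ge_inf _ Sq); exists r => x [/andP[]]]; lra.
have rs0' : r < s0 by rewrite lt_neqAle rs0 andbT; apply/eqP => e; rewrite e in fr; lra.
have fs0' : 0 <= f s0.
  rewrite leNgt; apply/negP => fs1.
  have [||dl dl0 hdl] := ceps s0 _ (- f s0); [by rewrite r0s0|lra|].
  pose q := Num.max r (s0 - dl / 2).
  have rq : r <= q by rewrite le_max lexx.
  have qs0 : q < s0 by rewrite gt_max rs0' /=; lra.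
  have := pos q rq qs0.
  have := hdl q; rewrite (le_trans r0r rq) (le_trans (ltW qs0) s0t) => /(_ isT).
  have : s0 - dl / 2 <= q by rewrite le_max lexx orbT.
  move=> h; rewrite ltr0_norm ?subr_lt0// => h1.
  have : `|f q - f s0| < - f s0 by apply: h1; lra.
  by rewrite ltr_norml; lra.
(* The step k is chosen so that K * k is at most 1/2. *)
pose k := (2 * (K + 1))^-1.
have k0 : 0 < k by rewrite invr_gt0; lra.
pose r1 := Num.max r (s0 - k).
have rr1 : r <= r1 by rewrite le_max lexx.
have r1s0 : r1 < s0 by rewrite gt_max rs0' /=; lra.
have r1k : s0 - k <= r1 by rewrite le_max lexx orbT.
have r0r1 : r0 <= r1 by exact: le_trans rr1.
have [|p] := @EVT_max _ f r1 s0 (ltW r1s0).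
  apply: (continuous_subspaceW _ cf) => q /=; rewrite !in_itv/= => /andP[a1 a2].
  by rewrite (le_trans r0r1 a1) (le_trans a2 s0t).
rewrite in_itv/= => /andP[r1p ps0] fmax.
have fp : 0 < f p.
  apply: (lt_le_trans (pos r1 rr1 r1s0)); apply: fmax.
  by rewrite in_itv/= lexx ltW.
have := hf p s0 (f p) (le_trans r0r1 r1p) ps0 s0t.
have hq : forall q, p <= q <= s0 -> 0 <= f q <= f p.
  move=> q /andP[pq qs0]; rewrite fmax ?in_itv/= ?qs0 ?(le_trans r1p)// andbT.
  move: qs0; rewrite le_eqVlt => /predU1P[->//|qs0].
  by apply/ltW/pos => //; apply: le_trans pq; exact: le_trans r1p.
move=> /(_ hq).
have kK : K * k <= 1 / 2.
  rewrite /k ler_pdivrMr; [|lra]; lra.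
have : K * (s0 - p) * f p <= K * k * f p.
  by rewrite ler_wpM2r ?(ltW fp)// ler_wpM2l//; lra.
nra.
Qed.

Section Integral_equation.
Variables (r0 t l : R) (g w : R -> R).
Hypothesis r0t : r0 <= t.
Hypothesis ig : leb.-integrable `[r0, t] (EFin \o g).
Hypothesis wE : forall r, r0 <= r <= t -> w r = l - \int[leb]_(s in `[r, t]) g s.

Lemma igS (p s : R) : r0 <= p -> s <= t -> leb.-integrable `[p, s] (EFin \o g).
Proof.
move=> r0p st; apply: integrableS ig => //.
by move=> q /=; rewrite !in_itv/= => /andP[a1 a2]; rewrite (le_trans r0p a1) (le_trans a2 st).
Qed.

Lemma integral_split (a p s : R) : r0 <= a -> a <= p -> p <= s -> s <= t ->
  \int[leb]_(q in `[a, s]) g q =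
  \int[leb]_(q in `[a, p]) g q + \int[leb]_(q in `[p, s]) g q.
Proof.
move=> r0a ap ps st.
have := @Rintegral_itvB R g (BLeft a) (BRight s) p (igS r0a st) ap ps.
rewrite Rintegral_itv_obnd_cbnd; first by move=> <-; ring.
apply: integrableS (igS (le_trans r0a ap) st) => //.
by move=> q /=; rewrite !in_itv/= => /andP[/ltW -> ->].
Qed.

Lemma sol_diff (p s : R) : r0 <= p -> p <= s -> s <= t ->
  w p - w s = - \int[leb]_(q in `[p, s]) g q.
Proof.
move=> r0p ps st; rewrite !wE ?r0p ?st ?(le_trans ps) ?(le_trans r0p ps)//.
by rewrite (integral_split r0p ps st (lexx t)); ring.
Qed.

Lemma sol_cts : {within `[r0, t], continuous w}.
Proof.
have c1 := parameterized_integral_continuous r0t ig.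
have c2 : {within `[r0, t], continuous (fun x => w r0 + parameterized_integral leb r0 x g)}.
  move=> x; apply: cvgD; [exact: cvg_cst|exact: c1].
apply: (subspace_eq_continuous _ c2) => x; rewrite inE/= in_itv/= => /andP[a1 a2].
by rewrite -[RHS](subKr (w r0)) (sol_diff (lexx r0) a1 a2) opprK.
Qed.

Lemma integral_expR_itv (p s b : R) : p <= s ->
  leb.-integrable `[p, s] (EFin \o (fun q => b * (l * expR (- (b * (t - q)))))) /\
  \int[leb]_(q in `[p, s]) (b * (l * expR (- (b * (t - q))))) =
  l * expR (- (b * (t - s))) - l * expR (- (b * (t - p))).
Proof.
move=> ps; pose F q := l * expR (- (b * (t - q))).
have dF (q : R) : is_derive q 1 F (b * F q).
  rewrite /F; apply: is_derive_eq; rewrite /GRing.scale/=; ring.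
have cF (q : R) : {for q, continuous F}.
  by apply/differentiable_continuous/derivable1_diffP; case: (dF q).
have cbF : continuous (fun q => b * F q).
  by move=> q; apply: cvgM; [exact: cvg_cst|exact: cF].
have iF : leb.-integrable `[p, s] (EFin \o (fun q => b * F q)).
  apply: continuous_compact_integrable; first exact: segment_compact.
  exact: continuous_subspaceT.
split; first exact: iF.
move: ps; rewrite le_eqVlt => /predU1P[<-|ps].
  by rewrite set_itv1 Rintegral_set1 subrr.
rewrite /Rintegral (@continuous_FTC2 _ (fun q => b * F q) F)//.
- exact: continuous_subspaceT.
- split.
  + by move=> q _; case: (dF q).
  + by apply: cvg_at_right_filter; exact: cF.
  + by apply: cvg_at_left_filter; exact: cF.
- by move=> q _; rewrite derive1E; case: (dF q).
Qed.

(** Compare [w] with the solution [z] of [z' = b * z], [z t = l]. Where [w] exceeds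
[z], the derivative of [w - z] is at least [b * (w - z)], so the difference cannot
become positive when read backwards from its value 0 at [t]. *)
Lemma growth_upper (b : R) : (forall s, r0 <= s <= t -> b * w s <= g s) ->
  forall r, r0 <= r <= t -> w r <= l * expR (- (b * (t - r))).
Proof.
move=> hb r rr; pose z q := l * expR (- (b * (t - q))).
have zc : continuous z.
  move=> q; apply: cvgM; first exact: cvg_cst.
  apply: (continuous_cvg _ (@continuous_expR _ _)); apply: cvgN.
  apply: cvgM; first exact: cvg_cst.
  by apply: cvgB; [exact: cvg_cst|exact: cvg_id].
rewrite -subr_le0; apply: (@backward_comparison r0 t `|b| (fun q => w q - z q)) => //.
- move=> x; apply: cvgB; first exact: sol_cts.
  by move: x; apply: continuous_subspaceT => x; exact: zc.
- rewrite wE ?r0t ?lexx// set_itv1 Rintegral_set1 /z subrr mulr0 oppr0 expR0; lra.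
move=> p s M r0p ps st hM.
have [iz ez] := integral_expR_itv b ps.
have e1 : w p - z p - (w s - z s) =
    \int[leb]_(q in `[p, s]) (b * (l * expR (- (b * (t - q)))) - g q).
  rewrite RintegralB//; last exact: igS.
  by rewrite ez; have := sol_diff r0p ps st; rewrite /z; lra.
rewrite e1.
have -> : `|b| * (s - p) * M = \int[leb]_(q in `[p, s]) (`|b| * M).
  rewrite Rintegral_cst//= lebesgue_measure_itv/= lte_fin.
  by case: ltP => h; rewrite /=; [ring|rewrite (@le_anti _ _ s p) ?h//; ring].
apply: le_Rintegral => //.
- by apply: RintegrableB => //; exact: igS.
- apply: measurable_bounded_integrable => //=.
    by rewrite lebesgue_measure_itv/=; case: ifP => _; rewrite ?ltry// -EFinB ltry.
  exact: bounded_cst.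
- move=> q /=; rewrite in_itv/= => /andP[pq qs].
  have q0 : r0 <= q <= t by rewrite (le_trans r0p pq) (le_trans qs st).
  have /andP[m0 m1] : 0 <= w q - z q <= M by apply: hM; rewrite pq.
  apply: (@le_trans _ _ (b * z q - b * w q)); first by rewrite lerD2l lerN2; exact: hb.
  rewrite -mulrBr; apply: (le_trans (ler_norm _)); rewrite normrM ler_wpM2l//.
  by rewrite distrC ger0_norm.
Qed.

End Integral_equation.

(** The upper bound applied to the opposite functions. *)
Lemma growth_lower (r0 t l : R) (g w : R -> R) (r0t : r0 <= t)
  (ig : leb.-integrable `[r0, t] (EFin \o g))
  (wE : forall r, r0 <= r <= t -> w r = l - \int[leb]_(s in `[r, t]) g s) (C : R) :
  (forall s, r0 <= s <= t -> g s <= C * w s) ->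
  forall r, r0 <= r <= t -> l * expR (- (C * (t - r))) <= w r.
Proof.
move=> hC r rr.
have := @growth_upper r0 t (- l) (fun s => - g s) (fun s => - w s) r0t.
move=> /(_ (RintegrableN ig)) h; rewrite -lerN2 -mulNr; apply: h => //.
- move=> q /andP[r0q qt]; rewrite RintegralN//; last exact: (igS ig).
  by rewrite wE ?r0q//; ring.
- by move=> s ss; rewrite mulrN lerN2 hC.
Qed.

End Backward_growth.

(** * Step functions on a backward grid *)

Section Step_functions.
Context {R : realType}.
Local Notation leb := (@lebesgue_measure R).

(** Index of the cell [(t - (j + 1) * dl, t - j * dl]] containing [s]. The grid is
counted from the final time because the equation is solved backwards. *)
Definition grid_index (t dl s : R) : nat := Num.truncn ((t - s) / dl).

Lemma measurable_step (t dl : R) (H : nat -> R) (D : set R) : 0 < dl ->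
  measurable D -> measurable_fun D (fun s => H (grid_index t dl s)).
Proof.
move=> dl0 mD _ B mB.
have mk k : measurable_fun setT (fun s : R => (grid_index t dl s)%:R : R).
  apply: nonincreasing_measurable => // s s' ss'; rewrite ler_nat.
  by apply: le_truncn; rewrite ler_pM2r ?invr_gt0//; lra.
rewrite (_ : _ @^-1` B =
  \bigcup_(k in [set k | B (H k)]) ((fun s => (grid_index t dl s)%:R : R) @^-1` [set k%:R])).
  apply: measurableI => //; apply: bigcup_measurable => k _.
  by rewrite -[_ @^-1` _]setTI; exact: mk.
apply/seteqP; split => s /=; first by exists (grid_index t dl s).
by move=> [k Bk] /= /eqP; rewrite eqr_nat => /eqP ->.
Qed.

Lemma grid_index_eq (t dl s : R) (j : nat) : 0 < dl ->
  t - j.+1%:R * dl < s <= t - j%:R * dl -> grid_index t dl s = j.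
Proof.
move=> dl0 /andP[h1 h2]; apply: truncn_def.
by rewrite ler_pdivlMr// ltr_pdivrMr//; apply/andP; split; lra.
Qed.

Lemma grid_index_bounds (t dl s : R) : 0 < dl -> s <= t ->
  s <= t - (grid_index t dl s)%:R * dl < s + dl.
Proof.
move=> dl0 st; have h0 : 0 <= (t - s) / dl by rewrite divr_ge0 ?subr_ge0// ltW.
have /andP[] := truncn_itv h0; rewrite -/(grid_index t dl s).
rewrite ler_pdivlMr// ltr_pdivrMr// -natr1 mulrDl mul1r => h1 h2.
by apply/andP; split; lra.
Qed.

Lemma grid_index_lt (t dl s : R) (N : nat) : 0 < dl ->
  t - N%:R * dl < s <= t -> (grid_index t dl s < N)%N.
Proof.
move=> dl0 /andP[h1 h2]; have /andP[h3 _] := grid_index_bounds dl0 h2.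
rewrite -(ltr_nat R) -(ltr_pM2r dl0); lra.
Qed.

Lemma step_integrable (t dl : R) (H : nat -> R) (N : nat) : 0 < dl ->
  leb.-integrable `]t - N%:R * dl, t] (EFin \o (fun s => H (grid_index t dl s))).
Proof.
move=> dl0.
apply: (@Rintegrable_le _ _ _ leb _ _ _ (cst (\sum_(j < N) `|H j|))) => //=.
- exact: measurable_step.
- apply: measurable_bounded_integrable => //=; last exact: bounded_cst.
  by rewrite lebesgue_measure_itv/=; case: ifP => _; rewrite ?ltry// -EFinB ltry.
- move=> s; rewrite in_itv/= => /(grid_index_lt dl0) kN.
  rewrite (bigD1 (Ordinal kN))//= lerDl; exact: sumr_ge0.
Qed.

Lemma step_integral (t dl : R) (H : nat -> R) (N : nat) : 0 < dl ->
  \int[leb]_(s in `]t - N%:R * dl, t]) H (grid_index t dl s) =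
  dl * \sum_(j < N) H j.
Proof.
move=> dl0; elim: N => [|N ih].
  by rewrite mul0r subr0 set_itv_ge ?bnd_simp ?ltxx// Rintegral_set0 big_ord0 mulr0.
pose p := t - N%:R * dl.
have tp : p <= t by rewrite /p gerBl mulr_ge0// ltW.
have pE : t - N.+1%:R * dl = p - dl by rewrite /p -natr1; ring.
have eqI s : s \in `]p - dl, p]%classic -> H (grid_index t dl s) = H N.
  rewrite inE/= in_itv/= -pE => h; congr H; exact: grid_index_eq.
have mu1 : leb `]p - dl, p] = dl%:E.
  by rewrite lebesgue_measure_itv/= lte_fin gtrBl dl0 -EFinB; congr EFin; ring.
have e1 : \int[leb]_(s in `]p - dl, p]) H (grid_index t dl s) = dl * H N.
  rewrite (@eq_Rintegral _ _ _ leb _ (cst (H N))); last by move=> s sI; rewrite eqI.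
  by rewrite Rintegral_cst//= [X in fine X]mu1 mulrC.
have sU : `]p - dl, t]%classic = `]p - dl, p] `|` `]p, t] :> set R.
  by rewrite -itv_bndbnd_setU// bnd_simp// gerBl ltW.
have iU := step_integrable t H N.+1 dl0.
rewrite pE in iU *.
rewrite sU Rintegral_setU//=.
- by rewrite e1 ih big_ord_recr/=; ring.
- by rewrite -sU.
- apply/disj_setPS => s [] /=; rewrite !in_itv/= => /andP[_ h1] /andP[h2 _].
  by move: (le_lt_trans h1 h2); rewrite ltxx.
Qed.

End Step_functions.

(** * Solutions in normalised form *)

Section Backward_solution.
Context {R : realType}.
Local Notation leb := (@lebesgue_measure R).
Variables (f x v : R -> R) (r0 t l b : R).
Hypotheses (r0t : r0 <= t) (l0 : 0 <= l).
Hypothesis hv : positive_solution f x t l v.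
Hypothesis fge : forall z, 0 <= z -> b * z <= f z.

(** Multiplying by [expR (x r - x t)] removes [r] from the integrand of the
equation, so that the normalised solution is an indefinite integral and is
continuous even where [x] jumps. *)
Definition normalized (r : R) : R := expR (x r - x t) * v r.
Definition normalized_rate (s : R) : R := expR (x s - x t) * f (v s).
Local Notation w := normalized.
Local Notation g := normalized_rate.

Let mulCA (a p q : R) : a * (p * q) = p * (a * q). Proof. by ring. Qed.

Lemma sol_ge0 r : r <= t -> 0 <= v r.
Proof. by move=> /hv[]. Qed.

Lemma normalizedK r : v r = expR (x t - x r) * w r.
Proof.
rewrite /normalized mulrA -expRD.
by rewrite (_ : x t - x r + (x r - x t) = 0) ?expR0 ?mul1r//; ring.
Qed.

Lemma normalized_rate_scale r s :
  g s = expR (x r - x t) * (expR (x s - x r) * f (v s)).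
Proof. by rewrite /g mulrA -expRD; congr (expR _ * _); ring. Qed.

Lemma normalized_integrable : leb.-integrable `[r0, t] (EFin \o g).
Proof.
have [_ i1 _] := hv r0t.
have i2 : leb.-integrable `[r0, t]
    (EFin \o (fun s => expR (x r0 - x t) * (expR (x s - x r0) * f (v s)))).
  exact: RintegrableZ.
by apply: eq_integrable i2 => // s _ /=; rewrite -normalized_rate_scale.
Qed.

Lemma normalized_eq r : r0 <= r <= t -> w r = l - \int[leb]_(s in `[r, t]) g s.
Proof.
move=> /andP[_ rt]; have [_ i1 e1] := hv rt.
rewrite /normalized e1 mulrBr mulrA -expRD.
rewrite (_ : x r - x t + (x t - x r) = 0) ?expR0 ?mul1r; last by ring.
congr (_ - _); rewrite -RintegralZl//.
by apply: eq_Rintegral => s _; rewrite -normalized_rate_scale.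
Qed.

Lemma normalized_ge0 r : r <= t -> 0 <= w r.
Proof. by move=> rt; rewrite mulr_ge0 ?expR_ge0// sol_ge0. Qed.

Lemma normalized_upper r : r0 <= r <= t -> w r <= l * expR (- (b * (t - r))).
Proof.
move=> rr; apply: (growth_upper r0t normalized_integrable normalized_eq) => //.
move=> s /andP[_ st]; rewrite /normalized /normalized_rate mulCA.
by apply: ler_wpM2l; [exact: expR_ge0|apply: fge; exact: sol_ge0].
Qed.

(** With [f z >= b * z] the solution is dominated by that of the linear equation,
whatever the path [x]. *)
Lemma sol_upper r : r0 <= r <= t -> v r <= l * expR (x t - x r - b * (t - r)).
Proof.
move=> rr; rewrite normalizedK (expRD (x t - x r)) mulCA; apply: ler_wpM2l; first exact: expR_ge0.
exact: normalized_upper.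
Qed.

(** While the solution is below 1, [f] is at most linear along it, and the solution
dominates that of a linear equation. *)
Lemma sol_lower (C : R) : (forall z, 0 <= z <= 1 -> f z <= C * z) ->
  (forall r, r0 <= r <= t -> v r <= 1) ->
  forall r, r0 <= r <= t -> l * expR (x t - x r - C * (t - r)) <= v r.
Proof.
move=> fC v1 r rr; rewrite (normalizedK r) (expRD (x t - x r)) mulCA; apply: ler_wpM2l; first exact: expR_ge0.
apply: (growth_lower r0t normalized_integrable normalized_eq) => //.
move=> s /andP[r0s st]; rewrite /normalized /normalized_rate mulCA.
by apply: ler_wpM2l; [exact: expR_ge0|apply: fC; rewrite sol_ge0//= v1// r0s].
Qed.

End Backward_solution.

(** * The clipped Euler scheme *)

Section Clip.
Context {R : realType}.
(** Solutions stay in a known interval, so that clipping does not affect them; it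
makes the merely locally Lipschitz field globally Lipschitz. *)
Definition clip (C W : R) : R := Num.min C (Num.max 0 W).

Lemma clip_itv C W : 0 <= C -> 0 <= clip C W <= C.
Proof. by move=> C0; rewrite /clip le_min C0 /= le_max lexx /= ge_min lexx. Qed.

Lemma clip_id C W : 0 <= W <= C -> clip C W = W.
Proof. by move=> /andP[W0 WC]; rewrite /clip max_r// min_r. Qed.

Lemma clip_lip C W W' : `|clip C W - clip C W'| <= `|W - W'|.
Proof.
rewrite /clip /Num.min /Num.max.
by do ! case: ifPn; rewrite -?leNgt; move=> *; rewrite ler_norml; apply/andP; split;
  case: (ler0P (W - W')); lra.
Qed.

End Clip.

Section Euler.
Context {R : realType}.
(** Right-hand side of the normalised equation, written in terms of the increment
[yv = x t - x s] of the path up to the final time. *)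
Definition euler_field (f : R -> R) (C yv W : R) : R :=
  expR (- yv) * f (expR yv * clip C W).

Fixpoint euler (f : R -> R) (l C dl : R) (y : nat -> R) (j : nat) : R :=
  if j is i.+1 then
    euler f l C dl y i - dl * euler_field f C (y i) (euler f l C dl y i)
  else l.

Definition euler_val f l C dl y j : R := expR (y j) * clip C (euler f l C dl y j).

(** Discretisation of [x0 * v r0] plus the integral of [p \o v]. It depends on the
path only through the increments [y 0, ..., y N], hence on finitely many
variables. *)
Definition euler_cost (f p : R -> R) (l C x0 dl : R) (y : nat -> R) (N : nat) : R :=
  x0 * euler_val f l C dl y N + dl * \sum_(j < N) p (euler_val f l C dl y j).

End Euler.

(** * Convergence of the Euler scheme *)

Section Euler_convergence.
Context {R : realType}.
Local Notation leb := (@lebesgue_measure R).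
Variables (f p x v : R -> R) (r0 t l b X : R).
Hypotheses (r0t : r0 < t) (l0 : 0 <= l).
Hypothesis hv : positive_solution f x t l v.
Hypothesis fge : forall z, 0 <= z -> b * z <= f z.
Hypothesis f0 : f 0 = 0.
Hypothesis flip : forall K, 1 <= K -> exists2 L, 0 <= L &
  forall z z', 0 <= z <= K -> 0 <= z' <= K -> `|f z - f z'| <= L * `|z - z'|.
Hypothesis p_ge0 : forall z, 0 <= z -> 0 <= p z.
Hypothesis p_le : forall z z', 0 <= z -> z <= z' -> p z <= p z'.
Hypothesis p_cvg : forall (z_ : nat -> R) z, (forall k, 0 <= z_ k) ->
  z_ @ \oo --> z -> p \o z_ @ \oo --> p z.
Hypothesis xrc : forall s, r0 <= s < t -> x q @[q --> s^'+] --> x s.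
Hypothesis xb : forall s, r0 <= s <= t -> `|x s| <= X.

Local Notation w := (normalized x v t).
Local Notation g := (normalized_rate f x v t).

Definition clip_level : R := l * expR (`|b| * (t - r0)).
Local Notation C := clip_level.

Definition mesh (N : nat) : R := (t - r0) / N.+1%:R.
Definition grid (N j : nat) : R := t - j%:R * mesh N.
Definition grid_path (N j : nat) : R := x t - x (grid N j).
Local Notation W N := (euler f l C (mesh N) (grid_path N)).
Local Notation U N := (euler_val f l C (mesh N) (grid_path N)).
Local Notation idx N := (grid_index t (mesh N)).

Let r0t' : r0 <= t. Proof. exact: ltW. Qed.

Lemma mesh_gt0 N : 0 < mesh N.
Proof. by rewrite divr_gt0// subr_gt0. Qed.

Lemma mesh_cvg0 : mesh @ \oo --> (0 : R).
Proof.
rewrite -(mulr0 (t - r0)); apply: cvgM; first exact: cvg_cst.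
exact: cvg_harmonic.
Qed.

Lemma grid_last N : t - N.+1%:R * mesh N = r0.
Proof. by rewrite /mesh mulrC divfK ?pnatr_eq0//; ring. Qed.

Lemma grid_itv N j : (j <= N.+1)%N -> r0 <= grid N j <= t.
Proof.
move=> jN; rewrite /grid gerBl mulr_ge0 ?(ltW (mesh_gt0 N))// andbT.
by rewrite -[leLHS](grid_last N) lerD2l lerN2 ler_wpM2r ?(ltW (mesh_gt0 N))// ler_nat.
Qed.

Lemma grid_idx_bounds N s : s <= t -> s <= grid N (idx N s) < s + mesh N.
Proof. exact: grid_index_bounds (mesh_gt0 N). Qed.

Lemma grid_idx_le_t N s : grid N (idx N s) <= t.
Proof. by rewrite /grid gerBl mulr_ge0// ltW// mesh_gt0. Qed.

Lemma clip_level_ge0 : 0 <= C.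
Proof. by rewrite mulr_ge0// expR_ge0. Qed.

Lemma normalized_clip s : r0 <= s <= t -> 0 <= w s <= C.
Proof.
move=> ss; have /andP[r0s st] := ss; apply/andP; split.
  exact: (normalized_ge0 hv).
apply: (le_trans (normalized_upper r0t' hv fge ss)).
apply: ler_wpM2l => //; rewrite ler_expR -mulNr.
apply: (@le_trans _ _ (`|b| * (t - s))).
  by rewrite ler_wpM2r ?subr_ge0// -normrN ler_norm.
by rewrite ler_wpM2l//; lra.
Qed.

Lemma path_expR_le s : r0 <= s <= t -> expR (x t - x s) <= expR (2 * X).
Proof.
move=> /xb; have := xb (_ : r0 <= t <= t); rewrite lexx r0t' => /(_ isT).
by rewrite !ler_norml ler_expR; lra.
Qed.

Lemma path_expRN_le s : r0 <= s <= t -> expR (x s - x t) <= expR (2 * X).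
Proof.
move=> /xb; have := xb (_ : r0 <= t <= t); rewrite lexx r0t' => /(_ isT).
by rewrite !ler_norml ler_expR; lra.
Qed.

Definition sol_bound : R := Num.max 1 (expR (2 * X) * C).
Local Notation K := sol_bound.

Lemma sol_bound_ge1 : 1 <= K. Proof. by rewrite le_max lexx. Qed.

Lemma clip_bound s V : r0 <= s <= t -> 0 <= expR (x t - x s) * clip C V <= K.
Proof.
move=> ss; have /andP[c0 c1] := clip_itv V clip_level_ge0.
rewrite mulr_ge0 ?expR_ge0//= le_max; apply/orP; right.
by apply: ler_pM => //; exact: path_expR_le.
Qed.

Lemma sol_clip s : r0 <= s <= t -> v s = expR (x t - x s) * clip C (w s).
Proof. by move=> ss; rewrite clip_id ?normalized_clip// -normalizedK. Qed.

Lemma sol_le_bound s : r0 <= s <= t -> 0 <= v s <= K.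
Proof. by move=> ss; rewrite sol_clip// clip_bound. Qed.

Lemma rate_field s : r0 <= s <= t -> g s = euler_field f C (x t - x s) (w s).
Proof.
by move=> ss; rewrite /normalized_rate /euler_field -sol_clip// opprB.
Qed.

(** The grid points approach [s] from the right, the side on which the path is
continuous. *)
Lemma right_cvg (u : nat -> R) s : r0 <= s <= t -> (forall N, s <= u N <= t) ->
  u @ \oo --> s -> x \o u @ \oo --> x s.
Proof.
move=> /andP[r0s st] us cu.
move: st; rewrite le_eqVlt => /predU1P[st|st].
  have -> : x \o u = fun=> x s; last exact: cvg_cst.
  apply/funext => N /=; congr x; apply/eqP; rewrite eq_le; have := us N.
  by rewrite -st => /andP[-> ->].
have rc := xrc (_ : r0 <= s < t); rewrite r0s st in rc.
apply/cvgrPdist_lt => e e0.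
have /cvgrPdist_lt/(_ e e0) := rc isT.
move=> [dl /= dl0 hdl].
move/cvgrPdist_lt : cu => /(_ dl dl0); apply: filterS => N /= hN.
have /andP[] := us N; rewrite le_eqVlt => /predU1P[<-|su] _.
  by rewrite subrr normr0.
exact: hdl.
Qed.

Lemma grid_cvg s : r0 <= s <= t -> (fun N => grid N (idx N s)) @ \oo --> s.
Proof.
move=> /andP[r0s st]; apply: (@squeeze_cvgr _ _ _ _ (fun=> s) (fun N => s + mesh N)).
- by apply: nearW => N; have /andP[-> /ltW ->] := grid_idx_bounds N st.
- exact: cvg_cst.
- by rewrite -[X in _ --> X]addr0; apply: cvgD; [exact: cvg_cst|exact: mesh_cvg0].
Qed.

Lemma path_grid_cvg s : r0 <= s <= t ->
  (fun N => x (grid N (idx N s))) @ \oo --> x s.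
Proof.
move=> ss; apply: (right_cvg ss _ (grid_cvg ss)) => N.
by rewrite grid_idx_le_t andbT; have /andP[_ /(grid_idx_bounds N)/andP[]] := ss.
Qed.

Lemma grid_idx_itv s N : r0 <= s <= t -> r0 <= grid N (idx N s) <= t.
Proof.
move=> /andP[r0s st]; rewrite grid_idx_le_t andbT; apply: (le_trans r0s).
by have /andP[] := grid_idx_bounds N st.
Qed.

Lemma sol_grid_cvg s : r0 <= s <= t ->
  (fun N => v (grid N (idx N s))) @ \oo --> v s.
Proof.
move=> ss; rewrite (normalizedK x v t).
have -> : (fun N => v (grid N (idx N s))) =
    (fun N => expR (x t - x (grid N (idx N s))) * w (grid N (idx N s))).
  by apply/funext => N; exact: normalizedK.
apply: cvgM.
  apply: (continuous_cvg _ (@continuous_expR _ _)).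
  by apply: cvgB; [exact: cvg_cst|exact: path_grid_cvg].
have cw := sol_cts r0t' (normalized_integrable r0t' hv) (normalized_eq hv).
apply/cvgrPdist_lt => e e0.
have [dl dl0 hdl] := within_cts_eps cw ss e0.
move/cvgrPdist_lt : (grid_cvg ss) => /(_ dl dl0); apply: filterS => N /= hN.
by rewrite distrC; apply: hdl; [exact: grid_idx_itv|rewrite distrC].
Qed.

Lemma rate_grid_cvg s : r0 <= s <= t ->
  (fun N => g (grid N (idx N s))) @ \oo --> g s.
Proof.
move=> ss; have [L L0 hL] := flip sol_bound_ge1.
apply: cvgM.
  apply: (continuous_cvg _ (@continuous_expR _ _)).
  by apply: cvgB; [exact: path_grid_cvg|exact: cvg_cst].
apply/cvgrPdist_le => e e0.
have L1 : 0 < L + 1 by lra.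
move/cvgrPdist_le : (sol_grid_cvg ss) => /(_ (e / (L + 1))).
rewrite divr_gt0// => /(_ isT); apply: filterS => N hN.
apply: (le_trans (hL _ _ (sol_le_bound ss) (sol_le_bound (grid_idx_itv N ss)))).
apply: (@le_trans _ _ ((L + 1) * `|v s - v (grid N (idx N s))|)).
  by rewrite ler_wpM2r//; lra.
by rewrite mulrC -ler_pdivlMr.
Qed.

Lemma rate_bounded : exists M, forall s, r0 <= s <= t -> `|g s| <= M.
Proof.
have [L L0 hL] := flip sol_bound_ge1.
exists (expR (2 * X) * (L * K)) => s ss.
rewrite normrM (ger0_norm (expR_ge0 _)); apply: ler_pM => //.
  exact: path_expRN_le.
have /andP[v0 vK] := sol_le_bound ss.
have := hL (v s) 0 (sol_le_bound ss); rewrite f0 !subr0 lexx (ger0_norm v0).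
rewrite (le_trans ler01 sol_bound_ge1) => /(_ isT) /le_trans; apply.
by rewrite ler_wpM2l.
Qed.

Definition rate_gap (N : nat) (s : R) : R := `|g (grid N (idx N s)) - g s|.
(** Consistency error of the scheme. The rate is only right-continuous, so no
order of convergence is available; dominated convergence gives that it vanishes. *)
Definition total_gap (N : nat) : R := \int[leb]_(s in `]r0, t]) rate_gap N s.

Let rate_meas : measurable_fun `[r0, t] g.
Proof.
have /integrableP[+ _] := normalized_integrable r0t' hv.
by move/measurable_EFinP.
Qed.

Let oc_sub (a : R) : r0 <= a -> `]a, t]%classic `<=` (`[r0, t]%classic : set R).
Proof.
by move=> r0a s /=; rewrite !in_itv/= => /andP[/ltW h ->]; rewrite (le_trans r0a h).
Qed.

Lemma rate_gap_meas N : measurable_fun `[r0, t] (rate_gap N).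
Proof.
apply: measurableT_comp => //; apply: measurable_funB => //.
exact: (measurable_step _ (fun j => g (grid N j)) (mesh_gt0 N)).
Qed.

Let cst_int (a c M : R) : leb.-integrable `]a, c] (EFin \o cst M).
Proof.
apply: measurable_bounded_integrable => //=; last exact: bounded_cst.
by rewrite lebesgue_measure_itv/=; case: ifP => _; rewrite ?ltry// -EFinB ltry.
Qed.

Lemma rate_gap_integrable N a : r0 <= a ->
  leb.-integrable `]a, t] (EFin \o rate_gap N).
Proof.
move=> r0a; have [M hM] := rate_bounded.
apply: (@Rintegrable_le _ _ _ leb _ _ _ (cst (M + M))) => //.
  by apply: measurable_funS (rate_gap_meas N) => //; exact: oc_sub.
move=> s /(oc_sub r0a) /=; rewrite in_itv/= => ss.
rewrite normr_id; apply: (le_trans (ler_normB _ _)).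
by apply: lerD; apply: hM => //; exact: grid_idx_itv.
Qed.

Lemma total_gap_cvg0 : total_gap @ \oo --> (0 : R).
Proof.
have [M hM] := rate_bounded.
rewrite [X in _ --> X](_ : 0 = \int[leb]_(s in `]r0, t]) (cst 0 s)); last first.
  by rewrite /Rintegral integral0.
have [] := @Rdominated_cvg _ _ _ leb `]r0, t] (measurable_itv _)
  rate_gap (cst 0) (cst (M + M)); last by [].
- by move=> N; apply: measurable_funS (rate_gap_meas N) => //; exact: oc_sub.
- move=> s /(oc_sub (lexx r0)) /=; rewrite in_itv/= => ss.
  have h : (fun N => g (grid N (idx N s)) - g s) @ \oo --> (0 : R).
    by rewrite -(subrr (g s)); apply: cvgB; [exact: rate_grid_cvg|exact: cvg_cst].
  by have h2 := cvg_norm h; rewrite normr0 in h2; exact: h2.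
- exact: cst_int.
- move=> N s /(oc_sub (lexx r0)) /=; rewrite in_itv/= => ss.
  rewrite normr_id; apply: (le_trans (ler_normB _ _)).
  by apply: lerD; apply: hM => //; exact: grid_idx_itv.
Qed.

Lemma euler_field_lip L : 0 <= L ->
  (forall z z', 0 <= z <= K -> 0 <= z' <= K -> `|f z - f z'| <= L * `|z - z'|) ->
  forall s V V', r0 <= s <= t ->
  `|euler_field f C (x t - x s) V - euler_field f C (x t - x s) V'| <= L * `|V - V'|.
Proof.
move=> L0 hL s V V' ss; rewrite /euler_field -mulrBr normrM (ger0_norm (expR_ge0 _)).
have := hL _ _ (clip_bound V ss) (clip_bound V' ss).
rewrite -mulrBr normrM (ger0_norm (expR_ge0 _)) => h1.
have e1 := expRxMexpNx_1 (x t - x s).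
have h2 : expR (- (x t - x s)) * `|f (expR (x t - x s) * clip C V) -
    f (expR (x t - x s) * clip C V')| <= L * `|clip C V - clip C V'|.
  have := ler_wpM2l (expR_ge0 (- (x t - x s))) h1; move/le_trans; apply.
  rewrite (_ : expR (- (x t - x s)) * (L * (expR (x t - x s) * `|clip C V - clip C V'|)) =
     (expR (x t - x s) * expR (- (x t - x s))) * (L * `|clip C V - clip C V'|)).
    by rewrite e1 mul1r.
  by ring.
by apply: (le_trans h2); rewrite ler_wpM2l// clip_lip.
Qed.

(** Discrete Gronwall inequality, with the consistency error accumulated over the
cells already visited; [step] is the one-step estimate and [bound] its iteration. *)
Lemma euler_error : exists2 A, 0 <= A & forall N j, (j <= N.+1)%N ->
  `|W N j - w (grid N j)| <= A * total_gap N.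
Proof.
have [L L0 hL] := flip sol_bound_ge1.
exists (expR (L * (t - r0))) => [|N]; first exact: expR_ge0.
have d0 := mesh_gt0 N.
pose G a := \int[leb]_(s in `]a, t]) rate_gap N s.
have geom j : (j <= N)%N -> [/\ r0 <= grid N j.+1, grid N j.+1 <= grid N j & grid N j <= t].
  move=> jN; have /andP[a1 a2] := grid_itv (jN : (j.+1 <= N.+1)%N).
  have /andP[a3 a4] := grid_itv (leqW jN); split => //.
  by rewrite /grid lerD2l lerN2 ler_wpM2r ?(ltW d0)// ler_nat.
have eGap j : (j <= N)%N -> G (grid N j.+1) - G (grid N j) =
    \int[leb]_(s in `]grid N j.+1, grid N j]) rate_gap N s.
  move=> /geom[r0g' gg' gt]; rewrite /G.
  have sU : `]grid N j.+1, t]%classic =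
      `]grid N j.+1, grid N j] `|` `]grid N j, t] :> set R.
    by rewrite -itv_bndbnd_setU// bnd_simp.
  rewrite sU Rintegral_setU//; first by ring.
    by rewrite -sU; exact: rate_gap_integrable.
  apply/disj_setPS => s [] /=; rewrite !in_itv/= => /andP[_ h1] /andP[h2 _].
  by move: (le_lt_trans h1 h2); rewrite ltxx.
(* Lipschitz part on the previous error, plus the consistency error of the cell. *)
have step j : (j <= N)%N ->
    `|W N j.+1 - w (grid N j.+1)| <= (1 + mesh N * L) * `|W N j - w (grid N j)|
       + (G (grid N j.+1) - G (grid N j)).
  move=> jN; have ss := grid_itv (leqW jN); have ss' := grid_itv (jN : (j.+1 <= N.+1)%N).
  have /andP[r0g' g't] := ss'; have /andP[r0g gt] := ss.
  have gE : grid N j.+1 = grid N j - mesh N by rewrite /grid -natr1; ring.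
  have gg' : grid N j.+1 <= grid N j by rewrite gE gerBl ltW.
  have e1 := sol_diff (normalized_integrable r0t' hv) (normalized_eq hv) r0g' gg' gt.
  have igs : leb.-integrable `[grid N j.+1, grid N j] (EFin \o g).
    exact: igS (normalized_integrable r0t' hv) _ _ r0g' gt.
  have ioc : leb.-integrable `]grid N j.+1, grid N j] (EFin \o g).
    apply: integrableS igs => //.
    by move=> s /=; rewrite !in_itv/= => /andP[/ltW -> ->].
  rewrite -Rintegral_itv_obnd_cbnd// in e1.
  have idxj s : s \in `]grid N j.+1, grid N j]%classic -> idx N s = j.
    by rewrite inE/= in_itv/= => h; exact: grid_index_eq.
  have ecst : mesh N * g (grid N j) =
      \int[leb]_(s in `]grid N j.+1, grid N j]) g (grid N (idx N s)).
    rewrite (@eq_Rintegral _ _ _ leb _ (cst (g (grid N j)))); last first.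
      by move=> s /idxj ->.
    rewrite Rintegral_cst//= lebesgue_measure_itv/= lte_fin gE gtrBl d0 mulrC.
    by congr (_ * _); rewrite /=; ring.
  have istep : leb.-integrable `]grid N j.+1, grid N j]
      (EFin \o (fun s => g (grid N (idx N s)))).
    apply: (@integrableS _ _ _ leb `]t - N.+1%:R * mesh N, t]) => //.
      move=> s /=; rewrite !in_itv/= grid_last => /andP[h1 h2].
      by rewrite (le_lt_trans r0g' h1) (le_trans h2 gt).
    exact: (step_integrable t (fun j => g (grid N j)) N.+1 d0).
  have eint : `|mesh N * g (grid N j) - \int[leb]_(s in `]grid N j.+1, grid N j]) g s|
      <= G (grid N j.+1) - G (grid N j).
    rewrite ecst (eGap j jN) -RintegralB//; apply: le_normr_Rintegral => //.
    exact: RintegrableB.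
  have -> : W N j.+1 - w (grid N j.+1) = (W N j - w (grid N j)) -
      mesh N * (euler_field f C (grid_path N j) (W N j) -
                euler_field f C (grid_path N j) (w (grid N j)))
      - (mesh N * g (grid N j) - \int[leb]_(s in `]grid N j.+1, grid N j]) g s).
    rewrite (rate_field ss) /=.
    by rewrite -[w (grid N j.+1)](subrK (w (grid N j))) e1 /grid_path; ring.
  apply: (le_trans (ler_normB _ _)); apply: lerD => //.
  apply: (le_trans (ler_normB _ _)); rewrite mulrDl mul1r lerD2l normrM.
  rewrite (gtr0_norm d0) -mulrA ler_wpM2l ?(ltW d0)//.
  exact: euler_field_lip.
have G0 j : (j <= N.+1)%N -> 0 <= G (grid N j).
  by move=> jN; apply: Rintegral_ge0 => s _; exact: normr_ge0.
have Ginc j : (j <= N)%N -> G (grid N j) <= G (grid N j.+1).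
  move=> jN; rewrite -subr_ge0 eGap//.
  by apply: Rintegral_ge0 => s _; exact: normr_ge0.
have bound j : (j <= N.+1)%N ->
    `|W N j - w (grid N j)| <= expR (L * (j%:R * mesh N)) * G (grid N j).
  elim: j => [_|j ih jN].
    rewrite /= mul0r mulr0 expR0 mul1r /grid mul0r subr0.
    rewrite (@normalized_eq _ f x v r0 t l hv t) ?r0t' ?lexx// set_itv1 Rintegral_set1 subr0 subrr normr0.
    by have := G0 0%N isT; rewrite /grid mul0r subr0.
  have h1 := ih (ltnW jN); have h2 := step j jN; have h3 := Ginc j jN.
  apply: (le_trans h2).
  have -> : L * (j.+1%:R * mesh N) = mesh N * L + L * (j%:R * mesh N).
    by rewrite -natr1; ring.
  rewrite expRD.
  have h4 := expR_ge1Dx (mesh N * L).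
  have m0 : 0 <= mesh N * L by rewrite mulr_ge0// ltW.
  have h5 : 1 <= expR (L * (j%:R * mesh N)).
    rewrite -expR0 ler_expR mulr_ge0// mulr_ge0// ltW//.
  have h6 := G0 j (ltnW jN).
  set E1 := expR (mesh N * L) in h4 *; set E2 := expR (L * _) in h1 h5 *.
  apply: (@le_trans _ _ (E1 * (E2 * G (grid N j)) + (G (grid N j.+1) - G (grid N j)))).
    rewrite lerD2r; apply: ler_pM => //; lra.
  have h7 : 1 <= E1 * E2 by rewrite -[leLHS]mulr1; apply: ler_pM => //; lra.
  rewrite mulrA -[leRHS](subrK (E1 * E2 * G (grid N j))) -mulrBr addrC lerD2r.
  by rewrite ler_peMl// subr_ge0.
move=> j jN; apply: (le_trans (bound j jN)).
have gr : G (grid N j) <= total_gap N.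
  have -> : total_gap N = G (grid N N.+1) by rewrite /total_gap /G /grid grid_last.
  have H k i : (i <= N.+1)%N -> (N.+1 - i)%N = k -> G (grid N i) <= G (grid N N.+1).
    elim: k i => [|k ih] i iN e.
      by rewrite (_ : i = N.+1)//; apply/eqP; rewrite eqn_leq iN/= -subn_eq0 e.
    have iN' : (i <= N)%N by rewrite -ltnS -subn_gt0 e.
    by apply: (le_trans (Ginc i iN')); apply: ih => //; rewrite subnS e.
  exact: H jN erefl.
apply: ler_pM => //; first exact: G0.
rewrite ler_expR ler_wpM2l//.
by have /andP[] := grid_itv jN; rewrite /grid; lra.
Qed.

Lemma euler_val_error : exists2 A, 0 <= A & forall N j, (j <= N.+1)%N ->
  `|U N j - v (grid N j)| <= A * total_gap N.
Proof.
have [A A0 hA] := euler_error.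
exists (expR (2 * X) * A) => [|N j jN]; first by rewrite mulr_ge0// expR_ge0.
have ss := grid_itv jN.
rewrite (sol_clip ss) /euler_val /grid_path -mulrBr normrM (ger0_norm (expR_ge0 _)).
rewrite -mulrA; apply: ler_pM => //; first exact: path_expR_le.
by apply: le_trans (hA N j jN); exact: clip_lip.
Qed.

Lemma euler_val_last : (fun N => U N N.+1) @ \oo --> v r0.
Proof.
have [A A0 hA] := euler_val_error.
have gl N : grid N N.+1 = r0 by exact: grid_last.
have c0 : (fun N => A * total_gap N) @ \oo --> (0 : R).
  by rewrite -(mulr0 A); apply: cvgM; [exact: cvg_cst|exact: total_gap_cvg0].
apply/cvgrPdist_le => e e0; move/cvgrPdist_le : c0 => /(_ e e0).
apply: filterS => N; rewrite sub0r normrN => hN.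
rewrite distrC -(gl N); apply: (le_trans (hA N N.+1 (leqnn _))).
exact: le_trans (ler_norm _) hN.
Qed.

Lemma grid_index_le N s : r0 <= s <= t -> (idx N s <= N.+1)%N.
Proof.
move=> /andP[r0s st]; have /andP[h _] := grid_idx_bounds N st.
have d0 := mesh_gt0 N; have e := grid_last N.
rewrite -(ler_nat R) -(ler_pM2r d0); rewrite /grid in h; lra.
Qed.

Lemma euler_val_step_cvg s : r0 <= s <= t ->
  (fun N => U N (idx N s)) @ \oo --> v s.
Proof.
move=> ss; have [A A0 hA] := euler_val_error.
have c0 : (fun N => A * total_gap N) @ \oo --> (0 : R).
  by rewrite -(mulr0 A); apply: cvgM; [exact: cvg_cst|exact: total_gap_cvg0].
have c1 : (fun N => U N (idx N s) - v (grid N (idx N s))) @ \oo --> (0 : R).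
  apply/cvgrPdist_le => e e0; move/cvgrPdist_le : c0 => /(_ e e0).
  apply: filterS => N; rewrite !sub0r !normrN => hN.
  apply: (le_trans (hA N _ (grid_index_le N ss))).
  exact: le_trans (ler_norm _) hN.
have -> : (fun N => U N (idx N s)) =
    (fun N => (U N (idx N s) - v (grid N (idx N s))) + v (grid N (idx N s))).
  by apply/funext => N; rewrite subrK.
by rewrite -[v s]add0r; exact: (cvgD c1 (sol_grid_cvg ss)).
Qed.

Lemma euler_val_bound N j : (j <= N.+1)%N -> 0 <= U N j <= K.
Proof. by move=> jN; exact: clip_bound (grid_itv jN). Qed.

Lemma cost_integral_cvg :
  leb.-integrable `[r0, t] (EFin \o (p \o v)) /\
  (fun N => mesh N * \sum_(j < N.+1) p (U N j)) @ \oo -->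
  \int[leb]_(s in `[r0, t]) p (v s).
Proof.
have [] := @Rdominated_cvg _ _ _ leb `[r0, t] (measurable_itv _)
  (fun N s => p (U N (idx N s))) (p \o v) (cst (p K)).
- by move=> N; exact: (measurable_step _ (fun j => p (U N j)) (mesh_gt0 N)).
- move=> s /=; rewrite in_itv/= => ss.
  apply: p_cvg; last exact: euler_val_step_cvg.
  by move=> N; have /andP[] := euler_val_bound (grid_index_le N ss).
- apply: measurable_bounded_integrable => //=; last exact: bounded_cst.
  by rewrite lebesgue_measure_itv/=; case: ifP => _; rewrite ?ltry// -EFinB ltry.
- move=> N s /=; rewrite in_itv/= => ss.
  have /andP[u0 uK] := euler_val_bound (grid_index_le N ss).
  by rewrite ger0_norm; [exact: p_le|exact: p_ge0].
move=> ip cv; split => //.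
have -> : (fun N => mesh N * \sum_(j < N.+1) p (U N j)) =
    (fun N => \int[leb]_(s in `[r0, t]) p (U N (idx N s))); last exact: cv.
apply/funext => N.
rewrite -(step_integral t (fun j => p (U N j)) N.+1 (mesh_gt0 N)) grid_last.
rewrite Rintegral_itv_obnd_cbnd//.
have := step_integrable t (fun j => p (U N j)) N.+1 (mesh_gt0 N).
by rewrite grid_last.
Qed.

Lemma euler_cost_cvg (x0 : R) :
  (fun N => euler_cost f p l C x0 (mesh N) (grid_path N) N.+1) @ \oo -->
  x0 * v r0 + \int[leb]_(s in `[r0, t]) p (v s).
Proof.
apply: cvgD; last by case: cost_integral_cvg.
by apply: cvgM; [exact: cvg_cst|exact: euler_val_last].
Qed.

End Euler_convergence.

(** * Càdlàg paths and the two-sided path *)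

Section Cadlag_paths.
Context {R : realType}.
Implicit Type f : R -> R.

(** Compactness of the interval, through the supremum of the points up to which
[f] is bounded. *)
Lemma locally_bounded_itv f (a b : R) :
  (forall s, a <= s <= b -> exists2 e, 0 < e & exists M, forall q, a <= q <= b ->
     `|q - s| < e -> `|f q| <= M) ->
  exists M, forall q, a <= q <= b -> `|f q| <= M.
Proof.
move=> hloc; have [ab|ba] := leP a b; last first.
  by exists 0 => q /andP[aq qb]; move: (le_lt_trans (le_trans aq qb) ba); rewrite ltxx.
pose S := [set s | a <= s <= b /\ exists M, forall q, a <= q <= s -> `|f q| <= M].
have Sa : S a.
  split; first by rewrite lexx.
  by exists `|f a| => q; rewrite -eq_le => /eqP ->.
have ubS : ubound S b by move=> s [/andP[]].
have hS : has_sup S by split; [exists a|exists b].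
pose s0 := sup S.
have as0 : a <= s0 by apply: (ub_le_sup _ Sa); exists b.
have s0b : s0 <= b by apply: ge_sup => //; exists a.
have [|e e0 [M1 hM1]] := hloc s0; first by rewrite as0.
have [s [/andP[as_ sb] [M0 hM0]] ss0] := sup_adherent e0 hS.
pose q1 := Num.min b (s0 + e / 2).
have q1b : q1 <= b by rewrite ge_min lexx.
have q1e : q1 <= s0 + e / 2 by rewrite ge_min lexx orbT.
have aq1 : a <= q1 by rewrite le_min ab; apply: (le_trans as0); lra.
have Sq1 : S q1.
  split; first by rewrite aq1.
  exists (Num.max M0 M1) => q /andP[aq qq1]; rewrite le_max.
  have [qs|sq] := leP q s; first by rewrite hM0 ?aq.
  apply/orP; right; apply: hM1; first by rewrite aq (le_trans qq1).
  by rewrite ltr_norml -/s0 in ss0 *; apply/andP; split; lra.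
have q1s0 : q1 <= s0 by apply: (ub_le_sup _ Sq1); exists b.
have bE : q1 = b.
  rewrite /q1; apply/min_idPl; rewrite leNgt; apply/negP => h.
  by move: q1s0; rewrite /q1 min_r ?(ltW h)//; lra.
by case: Sq1; rewrite bE.
Qed.

(** The values of the two-sided path at negative times are left limits, so that
the whole path is right-continuous. *)
Definition left_limit f (t : R) : R := lim (f s @[s --> t^'-]).

Lemma cadlag_bounded f (t : R) : cadlag f ->
  exists M, forall q, 0 <= q <= t -> `|f q| <= M.
Proof.
move=> [frc fll]; apply: locally_bounded_itv => s /andP[s0 st].
have /cvgrPdist_lt/(_ 1 ltr01) [e1 /= e10 h1] := frc s s0.
have hr q : s <= q < s + e1 -> `|f q| <= `|f s| + 1.
  move=> /andP[]; rewrite le_eqVlt => /predU1P[<- _|sq qe]; first by rewrite lerDl.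
  have : `|f s - f q| < 1 by apply: h1 => //=; rewrite ltr_norml; apply/andP; split; lra.
  have := ler_normD (f s) (f q - f s); rewrite (distrC (f q)) addrC subrK; lra.
move: s0; rewrite le_eqVlt => /predU1P[s0|s0].
  exists e1 => //; exists (`|f s| + 1) => q /andP[q0 _] qe; apply: hr.
  by move: qe; rewrite -s0 in q0 *; rewrite subr0 add0r ltr_norml q0 => /andP[].
have /cvgrPdist_lt/(_ 1 ltr01) [e2 /= e20 h2] := fll s s0.
exists (Num.min e1 e2); first by rewrite lt_min e10.
exists (Num.max (`|f s| + 1) (`|left_limit f s| + 1)) => q _.
rewrite lt_min => /andP[qe1 qe2]; rewrite le_max.
have [sq|qs] := leP s q.
  by rewrite hr// sq /=; move: qe1; rewrite ltr_norml; lra.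
apply/orP; right.
have : `|left_limit f s - f q| < 1 by apply: h2 => //=; rewrite distrC.
have := ler_normD (left_limit f s) (f q - left_limit f s).
rewrite (distrC (f q)) addrC subrK; lra.
Qed.

Lemma left_limit_cvg f (t : R) : cadlag f -> 0 < t ->
  f s @[s --> t^'-] --> left_limit f t.
Proof. by move=> [_ +]; exact. Qed.

Lemma left_limit_closed_ball f (t a e : R) (dl : R) : cadlag f -> 0 < t ->
  0 < dl -> (forall s, t - dl < s < t -> `|a - f s| <= e) ->
  `|a - left_limit f t| <= e.
Proof.
move=> cf t0 dl0 h.
have cl := left_limit_cvg cf t0.
have c2 : `|a - f s| @[s --> t^'-] --> `|a - left_limit f t|.
  by apply: cvg_norm; apply: cvgB => //; exact: cvg_cst.
rewrite -(cvg_lim _ c2)//; apply: limr_le; first by apply/cvg_ex; eexists; exact: c2.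
exists dl => // s /=; rewrite ltr_norml => /andP[h1 h2] st; apply: h.
by rewrite st andbT; lra.
Qed.

Lemma left_limit_bounded f (t : R) : cadlag f ->
  exists M, forall q, 0 < q <= t -> `|left_limit f q| <= M.
Proof.
move=> cf; have [M hM] := cadlag_bounded t cf; exists M => q /andP[q0 qt].
rewrite -normrN -[X in `|X|]add0r; apply: (@left_limit_closed_ball _ _ _ _ q) => //.
move=> s; rewrite subrr => /andP[s0 sq]; rewrite sub0r normrN; apply: hM.
by rewrite (ltW s0) (ltW (lt_le_trans sq qt)).
Qed.

(** The time change [s -> - s] turns this into right continuity of the two-sided
path at negative times. *)
Lemma left_limit_left_cts f (t : R) : cadlag f -> 0 < t ->
  left_limit f q @[q --> t^'-] --> left_limit f t.
Proof.
move=> cf t0; apply/cvgrPdist_le => e e0.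
have /cvgrPdist_le/(_ e e0) [dl /= dl0 hdl] := left_limit_cvg cf t0.
exists (Num.min dl t); first by rewrite /= lt_min dl0.
move=> q /=; rewrite lt_min => /andP[qd qt'] qt.
have q0 : 0 < q by move: qt'; rewrite gtr0_norm; lra.
rewrite gtr0_norm in qd; last by lra.
apply: (@left_limit_closed_ball _ _ _ _ (q - (t - dl))) => //; first lra.
move=> s /andP[h1 h2]; apply: hdl => /=; last by lra.
by rewrite gtr0_norm; lra.
Qed.

Lemma two_sided_neg d (T : measurableType d) (X Y : R -> T -> measurableTypeR R) (s : R) w :
  X 0 w = 0 -> s < 0 -> two_sided X Y s w = - left_limit (Y ^~ w) (- s).
Proof. by move=> X0 s0; rewrite /two_sided leNgt s0 /= X0 sub0r. Qed.

Lemma two_sided_nneg d (T : measurableType d) (X Y : R -> T -> measurableTypeR R) (s : R) w :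
  0 <= s -> two_sided X Y s w = X s w.
Proof. by move=> s0; rewrite /two_sided s0. Qed.

Lemma two_sided_right_cts d (T : measurableType d)
    (X Y : R -> T -> measurableTypeR R) (s : R) w :
  X 0 w = 0 -> cadlag (X ^~ w) -> cadlag (Y ^~ w) ->
  two_sided X Y q w @[q --> s^'+] --> two_sided X Y s w.
Proof.
move=> X0 cX cY; have [s0|s0] := leP 0 s.
  rewrite two_sided_nneg//; apply: cvg_trans (cX.1 s s0).
  apply: near_eq_cvg; exists 1 => /=; first exact: ltr01.
  move=> q _ /= sq.
  by rewrite two_sided_nneg// (le_trans s0)// ltW.
rewrite two_sided_neg//.
have h : left_limit (Y ^~ w) q @[q --> (- s)^'-] --> left_limit (Y ^~ w) (- s).
  by apply: left_limit_left_cts => //; lra.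
have h2 : - left_limit (Y ^~ w) (- q) @[q --> s^'+] --> - left_limit (Y ^~ w) (- s).
  apply: cvgN; apply/cvg_at_rightNP.
  rewrite (_ : _ \o _ = left_limit (Y ^~ w))//.
  by apply/funext => q /=; rewrite opprK.
apply: cvg_trans h2.
apply: near_eq_cvg; exists (- s) => /=; first lra.
move=> q /= qs sq; rewrite two_sided_neg//.
by move: qs; rewrite ltr0_norm; lra.
Qed.

Lemma two_sided_bounded d (T : measurableType d)
    (X Y : R -> T -> measurableTypeR R) (r t : R) w :
  X 0 w = 0 -> cadlag (X ^~ w) -> cadlag (Y ^~ w) ->
  exists M, forall s, r <= s <= t -> `|two_sided X Y s w| <= M.
Proof.
move=> X0 cX cY.
have [M1 h1] := cadlag_bounded t cX; have [M2 h2] := left_limit_bounded (- r) cY.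
exists (Num.max M1 M2) => s /andP[rs st]; rewrite le_max.
have [s0|s0] := leP 0 s; first by rewrite two_sided_nneg// h1// s0.
by rewrite two_sided_neg// normrN h2 ?orbT//; apply/andP; split; lra.
Qed.

End Cadlag_paths.

(** * Finite-dimensional laws and independence *)

Section Finite_dimensional_laws.
Context {d : measure_display} {T : measurableType d} {R : realType}.
Local Notation BR := (measurableTypeR R).

Lemma measurable_superlevel (f : T -> BR) (y : R) : measurable_fun setT f ->
  measurable [set w | y < f w].
Proof.
move=> mf; rewrite -[X in measurable X]setTI.
rewrite (_ : [set w | y < f w] = f @^-1` `]y, +oo[); first exact: mf.
by apply/seteqP; split => w /=; rewrite in_itv/= andbT.
Qed.

Definition proc_tuple (n : nat) (X : nat -> T -> BR) (w : T) : n.-tuple BR :=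
  [tuple X i w | i < n].

Lemma measurable_proc_tuple (n : nat) (X : nat -> T -> BR) :
  (forall i, measurable_fun setT (X i)) -> measurable_fun setT (proc_tuple n X).
Proof.
move=> mX; apply/measurable_fun_tnthP => i.
rewrite (_ : _ \o _ = X i)//; apply/funext => w /=.
by rewrite tnth_mktuple.
Qed.

Lemma measurable_tuple_nth (n i : nat) :
  measurable_fun setT (fun u : n.-tuple BR => nth 0 u i : BR).
Proof.
have [ilt|ige] := ltnP i n; last first.
  rewrite (_ : (fun u : n.-tuple BR => nth 0 u i) = cst 0); first exact: measurable_cst.
  by apply/funext => u; rewrite nth_default// size_tuple.
rewrite (_ : (fun u : n.-tuple BR => nth 0 u i) = fun u => tnth u (Ordinal ilt)).
  exact: measurable_tnth.
by apply/funext => u; rewrite (tnth_nth 0).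
Qed.

Definition cylinders (n : nat) : set (set (n.-tuple BR)) :=
  [set E | exists C : nat -> set BR, (forall i, measurable (C i)) /\
     E = [set u | forall i : 'I_n, C i (tnth u i)]].

Lemma cylinders_setI n : setI_closed (@cylinders n).
Proof.
move=> E F [C [mC ->]] [C' [mC' ->]]; exists (fun i => C i `&` C' i); split.
  by move=> i; exact: measurableI.
apply/seteqP; split => u /=; first by move=> [h1 h2] i; split.
by move=> h; split => i; case: (h i).
Qed.

Lemma cylinders_measurable n E : @cylinders n E -> measurable E.
Proof.
move=> [C [mC ->]].
have -> : [set u : n.-tuple BR | forall i : 'I_n, C i (tnth u i)] =
    \bigcap_(i in [set: 'I_n]) ((fun u : n.-tuple BR => tnth u i) @^-1` C i).
  by apply/seteqP; split => u /= h i; [move=> _; exact: h|exact: h].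
apply: fin_bigcap_measurable; first exact: finite_finset.
by move=> i _; rewrite -[_ @^-1` _]setTI; exact: measurable_tnth.
Qed.

Lemma measurable_cylinders n : @measurable _ (n.-tuple BR) = <<s @cylinders n >>.
Proof.
apply/seteqP; split; last first.
  apply: smallest_sub; first exact: sigma_algebra_measurable.
  exact: cylinders_measurable.
apply: smallest_sub; first exact: smallest_sigma_algebra.
move=> E; rewrite -bigcup_seq => -[i /= _ [B mB <-]].
apply: sub_sigma_algebra; exists (fun k : nat => if k == i :> nat then B else setT); split.
  by move=> k; case: ifP.
rewrite setTI; apply/seteqP; split => u /=.
  by move=> Bu k; case: ifPn => // /eqP/val_inj ->.
by move=> /(_ i); rewrite eqxx.
Qed.

(** Rectangles form a pi-system generating the product sigma-algebra. Stating it
for two measures rather than two laws under one measure lets it prove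
independence as well, by comparing a restricted with a rescaled measure. *)
Lemma law_tuple_unique (n : nat) (X X' : nat -> T -> BR)
    (mu mu' : {measure set T -> \bar R}) :
  (mu setT < +oo)%E -> (mu' setT < +oo)%E ->
  (forall i, measurable_fun setT (X i)) -> (forall i, measurable_fun setT (X' i)) ->
  (forall C : nat -> set BR, (forall i, measurable (C i)) ->
     mu (\bigcap_(i < n) (X i @^-1` C i)) = mu' (\bigcap_(i < n) (X' i @^-1` C i))) ->
  forall E, measurable E ->
    mu (proc_tuple n X @^-1` E) = mu' (proc_tuple n X' @^-1` E).
Proof.
move=> muT mu'T mX mX' hC E mE.
have mT Y (mY : forall i, measurable_fun setT (Y i)) F : measurable F ->
    measurable (proc_tuple n Y @^-1` F).
  by move=> mF; rewrite -[_ @^-1` _]setTI; exact: measurable_proc_tuple.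
have totE : mu setT = mu' setT.
  have := hC (fun=> setT) (fun=> measurableT).
  have e (Y : nat -> T -> BR) : \bigcap_(i < n) (Y i @^-1` setT) = setT :> set T.
    by apply/seteqP; split.
  by rewrite !e.
have cE (nu : {measure set T -> \bar R}) G : (nu setT < +oo)%E -> measurable G ->
    nu (~` G) = (nu setT - nu G)%E.
  by move=> nuT mG; rewrite -setTD measureD// ?setTI.
apply: (@dynkin_induction _ _ (@cylinders n)
  (fun E => mu (proc_tuple n X @^-1` E) = mu' (proc_tuple n X' @^-1` E))).
- exact: measurable_cylinders.
- exact: cylinders_setI.
- by rewrite !preimage_setT.
- move=> F [C [mC ->]].
  have e (Y : nat -> T -> BR) : proc_tuple n Y @^-1` [set u | forall i : 'I_n, C i (tnth u i)] =
      \bigcap_(i < n) (Y i @^-1` C i).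
    apply/seteqP; split => w /= h i.
      by move=> ni; have := h (Ordinal ni); rewrite tnth_mktuple.
    by rewrite tnth_mktuple; exact: (h i (ltn_ord i)).
  by rewrite !e; exact: hC.
- move=> S mS hS; 
  change (mu (~` (proc_tuple n X @^-1` S)) = mu' (~` (proc_tuple n X' @^-1` S))).
  by rewrite (cE mu _ muT (mT X mX S mS)) (cE mu' _ mu'T (mT X' mX' S mS)) totE hS.
- move=> F mF tF hF; rewrite !preimage_bigcup.
  have tri (Y : nat -> T -> BR) : trivIset setT (fun k => proc_tuple n Y @^-1` F k).
    apply/trivIsetP => i j _ _ ij; rewrite -preimage_setI.
    by move/trivIsetP : tF => ->//; rewrite preimage_set0.
  rewrite !measure_bigcup//; [|by move=> k _; exact: mT..].
  by apply: eq_eseriesr => k _; exact: hF.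
- by rewrite -measurable_cylinders.
Qed.

Variable P : probability T R.

(** The restriction of [P] to [A] and the multiple [P A] of [P] give the same mass
to rectangles. *)
Lemma tuple_indep (n : nat) (X : nat -> T -> BR) (A : set T) :
  (forall i, measurable_fun setT (X i)) -> measurable A ->
  (forall C : nat -> set BR, (forall i, measurable (C i)) ->
     P (\bigcap_(i < n) (X i @^-1` C i) `&` A) =
     (P (\bigcap_(i < n) (X i @^-1` C i)) * P A)%E) ->
  forall E, measurable E ->
    P (proc_tuple n X @^-1` E `&` A) = (P (proc_tuple n X @^-1` E) * P A)%E.
Proof.
move=> mX mA rect E mE.
pose Q : {measure set T -> \bar R} := mrestr P mA.
have pA0 : 0 <= fine (P A) by rewrite fine_ge0.
pose Q' : {measure set T -> \bar R} := mscale (NngNum pA0) P.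
have PA : (fine (P A))%:E = P A by rewrite fineK// fin_num_measure.
have : Q (proc_tuple n X @^-1` E) = Q' (proc_tuple n X @^-1` E).
  apply: law_tuple_unique => //.
  - by rewrite /Q /= /mrestr -ge0_fin_numE// fin_num_measure//; exact: measurableI.
  - by rewrite /Q' /= /mscale /= PA probability_setT mule1 -ge0_fin_numE// fin_num_measure.
  - by move=> C mC; rewrite /Q /Q' /= /mrestr /mscale /= PA rect// muleC.
by rewrite /Q /Q' /= /mrestr /mscale /= PA muleC.
Qed.

Definition same_cylinder_law (n : nat) (X X' : nat -> T -> BR) : Prop :=
  forall C : nat -> set BR, (forall i, measurable (C i)) ->
     P (\bigcap_(i < n) (X i @^-1` C i)) = P (\bigcap_(i < n) (X' i @^-1` C i)).

Lemma law_tuple_expectation (n : nat) (X X' : nat -> T -> BR)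
    (F : n.-tuple BR -> \bar R) :
  (forall i, measurable_fun setT (X i)) -> (forall i, measurable_fun setT (X' i)) ->
  same_cylinder_law n X X' -> measurable_fun setT F -> (forall u, (0 <= F u)%E) ->
  (\int[P]_w F (proc_tuple n X w) = \int[P]_w F (proc_tuple n X' w))%E.
Proof.
move=> mX mX' hC mF F0.
pose V : {mfun T >-> n.-tuple BR} :=
  HB.pack (proc_tuple n X) (isMeasurableFun.Build _ _ _ _ _ (@measurable_proc_tuple n X mX)).
pose V' : {mfun T >-> n.-tuple BR} :=
  HB.pack (proc_tuple n X') (isMeasurableFun.Build _ _ _ _ _ (@measurable_proc_tuple n X' mX')).
have := @ge0_integral_distribution _ _ _ _ _ P V F mF F0.
have := @ge0_integral_distribution _ _ _ _ _ P V' F mF F0.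
rewrite /= => <- <-.
apply: eq_measure_integral => A mA _.
apply: (@law_tuple_unique n X X' P P) => //;
  by rewrite -ge0_fin_numE// fin_num_measure.
Qed.

Lemma law_expectation (Y Y' : T -> BR) (F : BR -> \bar R) :
  measurable_fun setT Y -> measurable_fun setT Y' ->
  (forall C : set BR, measurable C -> P (Y @^-1` C) = P (Y' @^-1` C)) ->
  measurable_fun setT F -> (forall y, (0 <= F y)%E) ->
  (\int[P]_w F (Y w) = \int[P]_w F (Y' w))%E.
Proof.
move=> mY mY' hC mF F0.
pose V : {mfun T >-> BR} := HB.pack Y (isMeasurableFun.Build _ _ _ _ _ mY).
pose V' : {mfun T >-> BR} := HB.pack Y' (isMeasurableFun.Build _ _ _ _ _ mY').
have := @ge0_integral_distribution _ _ _ _ _ P V F mF F0.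
have := @ge0_integral_distribution _ _ _ _ _ P V' F mF F0.
rewrite /= => <- <-.
by apply: eq_measure_integral => A mA _; exact: hC.
Qed.

(** Under the restriction of [P] to [A] the variable [Z] has its own law multiplied
by [P A]. *)
Lemma ge0_indep_integral (Z : T -> BR) (A : set T) (f : BR -> \bar R) :
  measurable_fun setT Z -> measurable A -> measurable_fun setT f ->
  (forall y, (0 <= f y)%E) ->
  (forall C : set BR, measurable C -> P (Z @^-1` C `&` A) = (P (Z @^-1` C) * P A)%E) ->
  (\int[P]_(w in A) f (Z w) = P A * \int[P]_w f (Z w))%E.
Proof.
move=> mZ mA mf f0 hZ.
pose V : {mfun T >-> BR} := HB.pack Z (isMeasurableFun.Build _ _ _ _ _ mZ).
pose Q : {measure set T -> \bar R} := mrestr P mA.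
have mfZ : measurable_fun setT (f \o Z) by exact: measurableT_comp.
have e1 : (\int[P]_(w in A) f (Z w) = \int[Q]_(w in A) f (Z w))%E.
  by apply: eq_measure_integral => B mB BA; rewrite /Q/= /mrestr setIidl.
have e2 : (\int[Q]_(w in A) f (Z w) = \int[Q]_w f (Z w))%E.
  have mC : measurable (~` A) by exact: measurableC.
  rewrite (@ge0_negligible_integral _ _ _ Q setT (~` A) (f \o Z))//=.
    by rewrite setTD setCK.
  by rewrite /mrestr setICl measure0.
have r0 : 0 <= fine (P A) by rewrite fine_ge0.
have e3 := @ge0_integral_pushforward _ _ _ _ _ Z mZ Q setT f measurableT mf (fun y _ => f0 y).
have e4 := @ge0_integral_distribution _ _ _ _ _ P V f mf f0.
rewrite e1 e2; rewrite preimage_setT in e3; rewrite -[LHS]e3.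
have PA : P A = (fine (P A))%:E by rewrite fineK// fin_num_measure.
have e5 := @ge0_integral_mscale _ _ _ (distribution P V) setT measurableT (NngNum r0) f mf (fun y _ => f0 y).
rewrite /= in e5 e4; rewrite [in RHS]PA -e4 -e5.
apply: (@eq_measure_integral _ _ _ setT (mscale (NngNum r0) (distribution P V)) (pushforward Q V)).
move=> C mC _; rewrite /= /mscale/= -PA /pushforward /mrestr/= muleC.
exact: hZ.
Qed.

Lemma indep_integral (Z : T -> R) (A : set T) :
  measurable_fun setT (Z : T -> BR) -> measurable A ->
  P.-integrable setT (EFin \o Z) ->
  (forall C : set BR, measurable C -> P (Z @^-1` C `&` A) = (P (Z @^-1` C) * P A)%E) ->
  (\int[P]_(w in A) (Z w)%:E = P A * \int[P]_w (Z w)%:E)%E.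
Proof.
move=> mZ mA iZ hZ.
have mE : measurable_fun setT (@EFin R : BR -> \bar R) by exact: EFin_measurable.
rewrite integralE [in RHS]integralE muleBr ?fin_num_measure//; last first.
  apply: fin_num_adde_defr; exact: (integrable_pos_fin_num measurableT iZ).
have ep := ge0_indep_integral mZ mA (measurable_funepos mE) (fun y => funepos_ge0 _ y) hZ.
have en := ge0_indep_integral mZ mA (measurable_funeneg mE) (fun y => funeneg_ge0 _ y) hZ.
have hp : ((fun w => (Z w)%:E)^\+ = (@EFin R)^\+ \o Z)%E by rewrite -funepos_comp.
have hm : ((fun w => (Z w)%:E)^\- = (@EFin R)^\- \o Z)%E by rewrite -funeneg_comp.
by rewrite hp hm; congr (_ - _)%E; [exact: ep|exact: en].
Qed.

End Finite_dimensional_laws.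

(** * Maxima of random walks with negative drift *)

Section Walk_maximum.
Context {R : realType}.
Implicit Type x : nat -> R.

(** Maximum of the partial sums [0, x 0, x 0 + x 1, ...] with at most [n] terms, in
Lindley's recursive form: the maximum of the walk is obtained from that of the
walk started one step later. *)
Fixpoint walk_max x (n : nat) : R :=
  if n is m.+1 then Num.max 0 (x 0%N + walk_max (fun i => x i.+1) m) else 0.

Lemma walk_max_ge0 x n : 0 <= walk_max x n.
Proof. by case: n => [|n] //=; rewrite le_max lexx. Qed.

Lemma eq_walk_max x x' n : (forall i, (i < n)%N -> x i = x' i) ->
  walk_max x n = walk_max x' n.
Proof.
elim: n x x' => [//|n ih] x x' h /=.
by rewrite (h 0%N)// (ih _ (fun i => x' i.+1))// => i ilt; exact: h.
Qed.

Lemma walk_max_ge x n k : (k <= n)%N -> \sum_(i < k) x i <= walk_max x n.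
Proof.
elim: n x k => [|n ih] x [|k] //= kn; rewrite ?big_ord0//.
  by rewrite le_max lexx.
by rewrite big_ord_recl/= le_max; apply/orP; right; rewrite lerD2l ih.
Qed.

Lemma walk_max_nd x : {homo walk_max x : n m / (n <= m)%N >-> n <= m}.
Proof.
move=> n; elim: n x => [|n ih] x [|m]//= nm; first by rewrite le_max lexx.
by rewrite ge_max !le_max lexx /=; apply/orP; right; rewrite lerD2l ih.
Qed.

Lemma measurable_walk_max d (T : measurableType d) (X : nat -> T -> measurableTypeR R) n :
  (forall i, measurable_fun setT (X i)) ->
  measurable_fun setT (fun w => walk_max (X ^~ w) n).
Proof.
elim: n X => [|n ih] X mX /=; first exact: measurable_cst.
apply: measurable_maxr; first exact: measurable_cst.
apply: measurable_funD; first exact: mX.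
exact: (ih (fun i => X i.+1)).
Qed.

Lemma integrable_walk_max d (T : measurableType d) (P : {measure set T -> \bar R})
    (X : nat -> T -> measurableTypeR R) n :
  (forall i, P.-integrable setT (EFin \o X i)) ->
  P.-integrable setT (EFin \o (fun w => walk_max (X ^~ w) n)).
Proof.
elim: n X => [|n ih] X iX /=.
  exact: (integrable0 P setT).
have mX i : measurable_fun setT (X i) by apply/measurable_EFinP/(measurable_int P).
have i1 := integrable_norm (iX 0%N).
have i2 := integrable_norm (ih (fun i => X i.+1) (fun i => iX i.+1)).
apply: (Rintegrable_le measurableT _ (RintegrableD measurableT i1 i2)).
  exact: (@measurable_walk_max _ _ _ n.+1).
move=> w _ /=; rewrite ger0_norm ?le_max ?lexx// ge_max addr_ge0//=.
exact: lerD (ler_norm _) (ler_norm _).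
Qed.

End Walk_maximum.

Section Random_walk.
Context {d : measure_display} {T : measurableType d} {R : realType}.
Local Notation BR := (measurableTypeR R).
Variables (P : probability T R) (X : nat -> T -> BR).
Hypothesis mX : forall i, measurable_fun setT (X i).
Hypothesis iidX : forall (n : nat) (C : nat -> set BR), (forall i, measurable (C i)) ->
  P (\bigcap_(i < n) (X i @^-1` C i)) = (\prod_(i < n) P (X 0%N @^-1` C i))%E.
Hypothesis intX : P.-integrable setT (EFin \o (X 0%N : T -> R)).
Hypothesis meanX : (\int[P]_w (X 0%N w)%:E < 0)%E.

Let S (i : nat) := X i.+1.
Let mS i : measurable_fun setT (S i). Proof. exact: mX. Qed.

Let mpre i (C : set BR) : measurable C -> measurable (X i @^-1` C).
Proof. by move=> mC; rewrite -[_ @^-1` _]setTI; exact: mX. Qed.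

Lemma shift_law n (C0 : set BR) (C : nat -> set BR) : measurable C0 ->
  (forall i, measurable (C i)) ->
  P (X 0%N @^-1` C0 `&` \bigcap_(i < n) (S i @^-1` C i)) =
  (P (X 0%N @^-1` C0) * \prod_(i < n) P (X 0%N @^-1` C i))%E.
Proof.
move=> mC0 mC; pose C' i := if i is j.+1 then C j else C0.
have := iidX n.+1 (C := C'); rewrite big_ord_recl /= => <-; last by case.
congr (P _); apply/seteqP; split => w /=.
  by move=> [h0 h] [|i] //= ilt; exact: h.
by move=> h; split => [|i ilt]; [exact: (h 0%N)|exact: (h i.+1)].
Qed.

Lemma same_law_shift n : same_cylinder_law P n X S.
Proof.
move=> C mC; have := shift_law n (C0 := setT) measurableT mC.
by rewrite preimage_setT setTI probability_setT mul1e => ->; exact: iidX.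
Qed.

Lemma integrable_steps i : P.-integrable setT (EFin \o (X i : T -> R)).
Proof.
apply/integrableP; split; first by apply/measurable_EFinP; exact: mX.
have /integrableP[_] := intX; apply: le_lt_trans.
rewrite (@law_expectation _ _ _ P (X i) (X 0%N) (fun y => `|y%:E|%E))//.
- move=> C mC; have := iidX i.+1 (C := fun k => if k == i then C else setT).
  rewrite (bigD1 ord_max)//= eqxx big1; last first.
    move=> k ki; rewrite ifF ?preimage_setT ?probability_setT//.
    by apply/negbTE; move: ki; apply: contra => /eqP ki; apply/eqP/val_inj.
  rewrite mule1 => <-; last by move=> k; case: ifP.
  congr (P _); apply/seteqP; split => w /=.
    by move=> h' k _; case: eqP => // ->.
  by move=> /(_ i); rewrite eqxx; apply; exact: ltnSn.
- by apply: measurableT_comp => //; exact: EFin_measurable.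
Qed.

Let Y n w := walk_max (X ^~ w) n.
Let Y' n w := walk_max (S ^~ w) n.
Let mY n : measurable_fun setT (Y n). Proof. exact: measurable_walk_max. Qed.
Let mY' n : measurable_fun setT (Y' n). Proof. exact: measurable_walk_max. Qed.

Lemma measurable_tuple_walk n :
  measurable_fun setT (fun u : n.-tuple BR => walk_max (nth 0 u) n).
Proof.
apply: (@measurable_walk_max _ _ _ (fun i (u : n.-tuple BR) => nth 0 u i)) => i.
exact: measurable_tuple_nth.
Qed.

Lemma tuple_walk n (Z : nat -> T -> BR) w :
  walk_max (nth 0 (proc_tuple n Z w)) n = walk_max (Z ^~ w) n.
Proof.
apply: eq_walk_max => i ilt.
by rewrite -(tnth_nth 0 _ (Ordinal ilt)) tnth_mktuple.
Qed.

Let tuple_level (K : R) n : set (n.-tuple BR) :=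
  [set u | K < walk_max (nth 0 u) n].

Let measurable_tuple_level K n : measurable (@tuple_level K n).
Proof. by apply: measurable_superlevel; exact: measurable_tuple_walk. Qed.

Let tuple_levelE K n (Z : nat -> T -> BR) :
  proc_tuple n Z @^-1` (@tuple_level K n) = [set w | K < walk_max (Z ^~ w) n].
Proof. by apply/seteqP; split => w; rewrite /tuple_level /preimage /mkset tuple_walk. Qed.

(** Excess over a level [K]. It is 1-Lipschitz, so that differences of excesses of the
walk maxima are dominated by the first step uniformly in [n], and it vanishes in the
limit of large [K] where the maxima are bounded. *)
Let hinge (K m : R) : R := Num.max 0 (m - K).

Lemma hinge_ge0 K m : 0 <= hinge K m. Proof. by rewrite le_max lexx. Qed.

Lemma hinge_le K m m' : m <= m' -> hinge K m <= hinge K m'.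
Proof. by move=> mm'; rewrite /hinge ge_max hinge_ge0 le_max lerD2r mm' orbT. Qed.

Lemma hinge_lip K m m' : `|hinge K m - hinge K m'| <= `|m - m'|.
Proof.
rewrite /hinge /Num.max; do ! case: ifPn; rewrite -?leNgt => *;
  rewrite ler_norml; apply/andP; split; case: (ler0P (m - m')); lra.
Qed.

Lemma measurable_hinge K : measurable_fun setT (hinge K).
Proof. by apply: measurable_maxr => //; apply: measurable_funB. Qed.

Lemma integrable_hinge K n (Z : nat -> T -> BR) : 0 <= K ->
  (forall i, P.-integrable setT (EFin \o (Z i : T -> R))) ->
  P.-integrable setT (EFin \o (fun w => hinge K (walk_max (Z ^~ w) n))).
Proof.
move=> K0 iZ.
have mZ i : measurable_fun setT (Z i) by apply/measurable_EFinP/(measurable_int P).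
apply: (Rintegrable_le measurableT _ (integrable_walk_max n iZ)).
  by apply: (measurableT_comp (measurable_hinge K)); exact: measurable_walk_max.
move=> w _; have := walk_max_ge0 (Z ^~ w) n; rewrite ger0_norm ?hinge_ge0//.
by rewrite /hinge ge_max => -> /=; rewrite gerBl.
Qed.

Let gap K n w := hinge K (Y n.+1 w) - hinge K (Y' n w).

(** The maxima of the walk and of the shifted walk over [n] steps have the same
law, and one more step can only increase the maximum. *)
Lemma gap_ge0 K n : 0 <= K -> 0 <= \int[P]_w gap K n w.
Proof.
move=> K0.
have iS i : P.-integrable setT (EFin \o (S i : T -> R)) by exact: integrable_steps.
have i1 := integrable_hinge n.+1 K0 integrable_steps.
have i2 := integrable_hinge n K0 iS.
have i3 := integrable_hinge n K0 integrable_steps.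
rewrite /gap RintegralB// subr_ge0.
apply: (@le_trans _ _ (\int[P]_w hinge K (Y n w))); last first.
  apply: le_Rintegral => // w _; apply: hinge_le; apply: walk_max_nd; exact: leqnSn.
pose F (u : n.-tuple BR) : \bar R := (hinge K (walk_max (nth 0 u) n))%:E.
have e := @law_tuple_expectation _ _ _ P n X S F mX mS (@same_law_shift n).
have mF : measurable_fun setT F.
  apply/measurable_EFinP; apply: (measurableT_comp (measurable_hinge K)).
  exact: measurable_tuple_walk.
have {}e := e mF (fun u => hinge_ge0 _ _).
have q (Z : nat -> T -> BR) : (\int[P]_w (hinge K (walk_max (Z ^~ w) n))%:E =
    \int[P]_w F (proc_tuple n Z w))%E.
  by apply: eq_integral => w _; rewrite /F tuple_walk.
rewrite le_eqVlt; apply/orP; left; apply/eqP; congr fine.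
exact: etrans (q S) (etrans (esym e) (esym (q X))).
Qed.

Lemma gap_le K n w : `|gap K n w| <= `|X 0%N w|.
Proof.
apply: (le_trans (hinge_lip _ _ _)); rewrite /Y /= -/(S) -/(Y' n w).
have := walk_max_ge0 (S ^~ w) n; rewrite -/(Y' n w) => y0.
rewrite /Num.max; case: ifPn; rewrite -?leNgt => h.
  by rewrite addrK.
rewrite sub0r normrN ger0_norm//; have := ler_norm (- X 0%N w); rewrite normrN; lra.
Qed.

Let unbounded := \bigcap_(K : nat) \bigcup_n [set w | K%:R < Y' n w].

Lemma measurable_level K n : measurable [set w | K < Y' n w].
Proof. by apply: measurable_superlevel; exact: mY'. Qed.

Lemma measurable_unbounded : measurable unbounded.
Proof.
by apply: bigcapT_measurable => K; apply: bigcupT_measurable => n; exact: measurable_level.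
Qed.

Let bounded_gap_lim K w : R := let m := limn (fun n => Y' n w) in
  hinge K (Num.max 0 (X 0%N w + m)) - hinge K m.

Let gap_lim K w : R := if w \in unbounded then X 0%N w else bounded_gap_lim K w.

Lemma Y'_cvg w : ~ unbounded w -> cvgn (fun n => Y' n w).
Proof.
move=> Aw; have [K hK] : exists K : nat, forall n, Y' n w <= K%:R.
  apply: contrapT => hno; apply: Aw => K _; apply: contrapT => hn.
  apply: hno; exists K => n; rewrite leNgt; apply/negP => hh.
  by apply: hn; exists n.
apply: nondecreasing_is_cvgn; first by move=> n m; exact: walk_max_nd.
by exists K%:R => _ [n _ <-].
Qed.

Lemma continuous_hinge K : continuous (hinge K).
Proof.
move=> m; apply/cvgrPdist_le => e e0; near=> m'.
apply: (le_trans (hinge_lip _ _ _)); near: m'.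
by have /cvgrPdist_le := @cvg_id _ (nbhs m); exact.
Unshelve. all: by end_near. Qed.

(** Where the maxima of the shifted walk are unbounded, both excesses are
eventually affine and their difference is the first step [X 0]. *)
Lemma gap_cvg K w : 0 <= K -> gap K ^~ w @ \oo --> gap_lim K w.
Proof.
move=> K0; rewrite /gap_lim; case: ifPn => [|]; rewrite ?inE ?notin_setE => Aw.
  have [k hk] : exists k : nat, K + `|X 0%N w| <= k%:R.
    exists (Num.truncn (K + `|X 0%N w|)).+1; exact/ltW/truncnS_gt.
  have [n0 _ hn0] := Aw k I.
  apply: cvg_near_cst; exists n0 => // n /= n0n.
  have yn : K + `|X 0%N w| <= Y' n w.
    by apply: (le_trans hk); apply: (le_trans (ltW hn0)); exact: walk_max_nd.
  rewrite /gap /hinge /Y /= -/S -/(Y' n w).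
  have := ler_norm (- X 0%N w); rewrite normrN => h1; have h2 := normr_ge0 (X 0%N w).
  by rewrite (@max_r _ _ 0 (X 0%N w + _)) ?max_r; lra.
have cy : (fun n => Y' n w) @ \oo --> limn (fun n => Y' n w) := Y'_cvg Aw.
rewrite /bounded_gap_lim /=.
have e m : Num.max 0 (X 0%N w + m) = hinge (- X 0%N w) m by rewrite /hinge opprK addrC.
have c1 := cvg_comp _ _ cy (@continuous_hinge (- X 0%N w) _).
have c2 := cvg_comp _ _ c1 (@continuous_hinge K _).
have c3 := cvg_comp _ _ cy (@continuous_hinge K _).
rewrite e; have -> : gap K ^~ w = (fun n => (hinge K \o hinge (- X 0%N w)) (Y' n w) -
    hinge K (Y' n w)).
  by apply/funext => n; rewrite /gap /Y /= -/S e.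
exact: (cvgB c2 c3).
Qed.

(** As the level [K] grows, only paths with unbounded maxima contribute. *)
Lemma gap_lim_cvg w : (fun K : nat => gap_lim K%:R w) @ \oo -->
  X 0%N w * \1_unbounded w.
Proof.
rewrite indicE /gap_lim; case: (boolP (w \in unbounded)) => Aw.
  by rewrite mulr1; exact: cvg_cst.
rewrite mulr0 /bounded_gap_lim /=; set m := limn _.
apply: cvg_near_cst.
exists (Num.truncn (`|m| + `|X 0%N w|)).+1 => // K /= hK.
have kK : `|m| + `|X 0%N w| <= K%:R.
  apply: (le_trans (ltW (truncnS_gt _))); by rewrite ler_nat.
have h1 := ler_norm (X 0%N w); have h2 := ler_norm m.
have h3 := normr_ge0 (X 0%N w); have h4 := normr_ge0 m.
have hinge0 y : y <= K%:R -> hinge K%:R y = 0.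
  by move=> yK; rewrite /hinge max_l// subr_le0.
rewrite !hinge0 ?subrr//; first lra.
by rewrite ge_max; apply/andP; split; lra.
Qed.

(** Two dominated limits of the nonnegative integrals of the gaps: first in the
number of steps, then in the level. The dominating function is [`|X 0|]. *)
Lemma integral_unbounded_ge0 : (0 <= \int[P]_(w in unbounded) (X 0%N w)%:E)%E.
Proof.
have inX := integrable_norm intX.
have mgap K n : measurable_fun setT (gap K n).
  apply: measurable_funB; apply: (measurableT_comp (measurable_hinge K));
    [exact: mY|exact: mY'].
have lim1 K : 0 <= K -> P.-integrable setT (EFin \o gap_lim K) /\
    0 <= \int[P]_w gap_lim K w.
  move=> K0.
  have [i1 c1] := @Rdominated_cvg _ _ _ P setT measurableT (gap K) (gap_lim K)
    (fun w => `|X 0%N w|) (mgap K) (fun w _ => @gap_cvg K w K0) inX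
    (fun n w _ => gap_le K n w).
  split => //; rewrite -(cvg_lim _ c1)//.
  by apply: limr_ge; [apply/cvg_ex; eexists; exact: c1|apply: nearW => n; exact: gap_ge0].
have bnd (K : nat) w : `|gap_lim K%:R w| <= `|X 0%N w|.
  have c := @gap_cvg K%:R w (ler0n R K).
  have c2 : (fun n => `|gap K%:R n w|) @ \oo --> `|gap_lim K%:R w| by exact: cvg_norm.
  rewrite -(cvg_lim _ c2)//; apply: limr_le; first by apply/cvg_ex; eexists; exact: c2.
  by apply: nearW => n; exact: gap_le.
have mlim (K : nat) : measurable_fun setT (gap_lim K%:R).
  by apply/measurable_EFinP/(measurable_int P); have [] := lim1 K%:R (ler0n R K).
have [i2 c2] := @Rdominated_cvg _ _ _ P setT measurableT (fun K : nat => gap_lim K%:R)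
  (fun w => X 0%N w * \1_unbounded w) (fun w => `|X 0%N w|)
  mlim
  (fun w _ => @gap_lim_cvg w) inX (fun K w _ => bnd K w).
have : 0 <= \int[P]_w (X 0%N w * \1_unbounded w).
  rewrite -(cvg_lim _ c2)//.
  apply: limr_ge; first by apply/cvg_ex; eexists; exact: c2.
  by apply: nearW => K; have [] := lim1 K%:R (ler0n R K).
rewrite -lee_fin /Rintegral fineK; last exact: integrable_fin_num i2.
move=> h; rewrite integral_mkcond; apply: le_trans h _.
rewrite le_eqVlt; apply/orP; left; apply/eqP; apply: eq_integral => w _.
by rewrite epatch_indic /= EFinM.
Qed.

(** Unboundedness of the shifted walk does not involve the first step. *)
Lemma indep_unbounded (C : set BR) : measurable C ->
  P (X 0%N @^-1` C `&` unbounded) = (P (X 0%N @^-1` C) * P unbounded)%E.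
Proof.
move=> mC; pose G := X 0%N @^-1` C.
have mG : measurable G by exact: mpre.
have fG : P G \is a fin_num by exact: fin_num_measure.
pose E K n := [set w | K%:R < Y' n w].
have mE K n : measurable (E K n) by exact: measurable_level.
have E_nd K : nondecreasing_seq (E K).
  move=> n m nm; apply/subsetPset => w /= h; apply: (lt_le_trans h).
  exact: walk_max_nd.
have step1 K n : P (G `&` E K n) = (P G * P (E K n))%E.
  rewrite (_ : E K n = proc_tuple n S @^-1` (@tuple_level K%:R n)); last by rewrite tuple_levelE.
  rewrite setIC muleC; apply: tuple_indep => // D mD.
  rewrite setIC muleC shift_law//.
  by have := shift_law n (C0 := setT) measurableT mD;
    rewrite preimage_setT setTI probability_setT mul1e => ->.
have step2 K : P (G `&` \bigcup_n E K n) = (P G * P (\bigcup_n E K n))%E.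
  have c1 : P (G `&` E K n) @[n --> \oo] --> P (G `&` \bigcup_n E K n).
    rewrite setI_bigcupr; apply: nondecreasing_cvg_mu.
    - by move=> n; exact: measurableI.
    - by apply: bigcupT_measurable => n; exact: measurableI.
    - by move=> n m nm; apply/subsetPset; apply: setIS; exact/subsetPset/E_nd.
  have c2 : P (E K n) @[n --> \oo] --> P (\bigcup_n E K n).
    by apply: nondecreasing_cvg_mu => //; exact: bigcupT_measurable.
  have c3 : (P G * P (E K n))%E @[n --> \oo] --> (P G * P (\bigcup_n E K n))%E.
    exact: cvgeZl.
  rewrite -(cvg_lim _ c1)// -(cvg_lim _ c3)//; congr (lim (_ @ \oo)).
  by apply/funext => n; exact: step1.
pose F K := \bigcup_n E K n.
have mF K : measurable (F K) by exact: bigcupT_measurable.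
have F_ni : nonincreasing_seq F.
  move=> K L KL; apply/subsetPset => w [n _ hn]; exists n => //=.
  by apply: le_lt_trans hn; rewrite ler_nat.
have c1 : P (G `&` F K) @[K --> \oo] --> P (G `&` \bigcap_K F K).
  have -> : G `&` \bigcap_K F K = \bigcap_K (G `&` F K).
    apply/seteqP; split => w /=; first by move=> [g f] K _; split; [|exact: f].
    by move=> gf; split; [have [] := gf 0%N I|move=> K _; have [] := gf K I].
  apply: nonincreasing_cvg_mu.
  - by rewrite -ge0_fin_numE// fin_num_measure//; exact: measurableI.
  - by move=> n; exact: measurableI.
  - by apply: bigcapT_measurable => n; exact: measurableI.
  - by move=> n m nm; apply/subsetPset; apply: setIS; exact/subsetPset/F_ni.
have c2 : P (F K) @[K --> \oo] --> P (\bigcap_K F K).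
  apply: nonincreasing_cvg_mu => //; last exact: bigcapT_measurable.
  by rewrite -ge0_fin_numE// fin_num_measure.
have c3 : (P G * P (F K))%E @[K --> \oo] --> (P G * P (\bigcap_K F K))%E.
  exact: cvgeZl.
rewrite -/G -(cvg_lim _ c1)// -(cvg_lim _ c3)//; congr (lim (_ @ \oo)).
by apply/funext => n; exact: step2.
Qed.

(** By independence the integral of [X 0] over the event is its probability times
the mean, which is negative; the integral being nonnegative, the probability is 0.
This replaces the law of large numbers. *)
Lemma unbounded_null : P unbounded = 0%E.
Proof.
have := integral_unbounded_ge0.
rewrite (indep_integral (mX 0) measurable_unbounded intX indep_unbounded).
have [//|p0] := eqVneq (P unbounded) 0%E.
have pp : (0 < P unbounded)%E by rewrite lt_neqAle eq_sym p0/=.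
by move=> h; have := lt_le_trans (mule_gt0_lt0 pp meanX) h; rewrite ltxx.
Qed.

(** The maxima are almost surely bounded, so their supremum has a tail that tends
to 0; the walk and its shift have the same law. *)
Lemma walk_tail (e : R) : 0 < e -> exists K : nat,
  (P (\bigcup_k [set w | (K%:R < \sum_(i < k) X i w)%R]) < e%:E)%E.
Proof.
move=> e0.
pose F (K : nat) := \bigcup_n [set w | K%:R < Y' n w].
have mF K : measurable (F K) by apply: bigcupT_measurable => n; exact: measurable_level.
have c2 : P (F K) @[K --> \oo] --> P unbounded.
  apply: nonincreasing_cvg_mu => //.
  - by rewrite -ge0_fin_numE// fin_num_measure.
  - exact: measurable_unbounded.
  move=> K L KL; apply/subsetPset => w [n _ hn]; exists n => //=.
  by apply: le_lt_trans hn; rewrite ler_nat.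
rewrite unbounded_null in c2.
have [K hK] : exists K, (P (F K) < e%:E)%E.
  apply: contrapT => /forallNP hno.
  have : (e%:E <= 0 :> \bar R)%E.
    rewrite -(cvg_lim _ c2)//; apply: lime_ge; first by apply/cvg_ex; eexists; exact: c2.
    by apply: nearW => K; rewrite leNgt; apply/negP; exact: hno.
  by rewrite lee_fin leNgt e0.
exists K; apply: le_lt_trans hK.
pose G n := [set w | K%:R < Y n w].
have mG n : measurable (G n) by apply: measurable_superlevel; exact: mY.
have GE n : P (G n) = P [set w | K%:R < Y' n w].
  rewrite /G /Y /Y' -!tuple_levelE.
  have PT : (P setT < +oo)%E by rewrite probability_setT ltry.
  exact: (@law_tuple_unique _ _ _ n X S P P PT PT mX mS (@same_law_shift n)).
have cG : P (G n) @[n --> \oo] --> P (\bigcup_n G n).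
  apply: nondecreasing_cvg_mu => //; first exact: bigcupT_measurable.
  by move=> n m nm; apply/subsetPset => w /= h; apply: (lt_le_trans h); exact: walk_max_nd.
have cF : P [set w | K%:R < Y' n w] @[n --> \oo] --> P (F K).
  apply: nondecreasing_cvg_mu; [by move=> n; exact: measurable_level|exact: mF|].
  by move=> n m nm; apply/subsetPset => w /= h; apply: (lt_le_trans h); exact: walk_max_nd.
have -> : P (F K) = P (\bigcup_n G n).
  rewrite -(cvg_lim _ cG)// -(cvg_lim _ cF)//; congr (lim (_ @ \oo)).
  by apply/funext => n; exact/esym/GE.
apply: le_measure; rewrite ?inE.
- apply: bigcupT_measurable => k; apply: measurable_superlevel.
  by apply: (@measurable_sum _ _ _ _ _ _ (fun i : 'I_k => X i)) => i; exact: mX.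
- by apply: bigcupT_measurable => n; exact: mG.
- by move=> w [k _ /= hk]; exists k => //=; apply: (lt_le_trans hk); exact: walk_max_ge.
Qed.

End Random_walk.

(** * Suprema of Lévy processes with negative drift *)

Section Levy_supremum.
Context {d : measure_display} {T : measurableType d} {R : realType}.
Local Notation BR := (measurableTypeR R).
Variable P : probability T R.

Lemma levy_affine (X : R -> T -> BR) (a C : R) : levy_process P X ->
  levy_process P (fun s w => a * X s w - C * s : BR).
Proof.
move=> [mX X0 cX iX sX]; split.
- move=> t t0; apply: measurable_funB; last exact: measurable_cst.
  by apply: (measurableT_comp (@mulrl_measurable _ _ a)); exact: mX.
- by move=> w; rewrite X0 !mulr0 subrr.
- move=> w; case: (cX w) => c1 c2; split => t t0.
    apply: cvgB; first by apply: cvgM; [exact: cvg_cst|exact: c1].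
    apply: cvgM; first exact: cvg_cst.
    by apply: cvg_within_filter; exact: cvg_id.
  apply: is_cvgB; first by apply: is_cvgM; [exact: is_cvg_cst|exact: c2].
  apply: is_cvgM; first exact: is_cvg_cst.
  by apply/cvg_ex; exists t; apply: cvg_within_filter; exact: cvg_id.
- move=> n t t0 tnd C0 mC0.
  pose h i (y : R) : R := a * y - C * (t i.+1 - t i).
  have mh i : measurable_fun setT (h i : BR -> BR).
    by apply: measurable_funB => //; exact: mulrl_measurable.
  have e i : (fun w => a * X (t i.+1) w - C * t i.+1 - (a * X (t i) w - C * t i)) @^-1` C0 i =
      (fun w => X (t i.+1) w - X (t i) w) @^-1` (h i @^-1` C0 i).
    apply/seteqP; split => w /=; rewrite /h;
      by rewrite (_ : a * X (t i.+1) w - C * t i.+1 - (a * X (t i) w - C * t i) =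
        a * (X (t i.+1) w - X (t i) w) - C * (t i.+1 - t i))//; ring.
  have := iX n t t0 tnd (fun i => h i @^-1` C0 i) _.
  under [X in _ -> _ = X]eq_bigr do rewrite e.
  move=> <-; last by move=> i; rewrite -[_ @^-1` _]setTI; exact: mh.
  by congr (P _); apply: eq_bigcapr => i _; rewrite e.
- move=> s t A s0 t0 mA.
  pose h (y : R) : R := a * y - C * t.
  have mh : measurable_fun setT (h : BR -> BR).
    by apply: measurable_funB => //; exact: mulrl_measurable.
  have mhA : measurable (h @^-1` A) by rewrite -[_ @^-1` _]setTI; exact: mh.
  have := sX s t (h @^-1` A) s0 t0 mhA.
  rewrite /= => <-; congr (P _); apply/seteqP; split => w /=; rewrite /h;
    by rewrite (_ : a * X (s + t) w - C * (s + t) - (a * X s w - C * s) =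
      a * (X (s + t) w - X s w) - C * t)//; ring.
Qed.

Section Negative_drift.
Variable Z : R -> T -> BR.
Hypothesis levyZ : levy_process P Z.
Hypothesis intZ : P.-integrable setT (EFin \o (Z 1 : T -> R)).
Hypothesis meanZ : (\int[P]_w (Z 1 w)%:E < 0)%E.

Let mZ t : 0 <= t -> measurable_fun setT (Z t). Proof. by case: levyZ => + _ _ _ _; apply. Qed.
Let Z0 w : Z 0 w = 0. Proof. by case: levyZ => _ + _ _ _; apply. Qed.
Let cZ w : cadlag (Z ^~ w). Proof. by case: levyZ => _ _ + _ _; apply. Qed.

Definition dyadic (j k : nat) : R := k%:R / (2 ^ j)%:R.

Lemma two_pow_gt0 j : 0 < (2 ^ j)%:R :> R.
Proof. by rewrite ltr0n expn_gt0. Qed.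

Lemma dyadic_ge0 j k : 0 <= dyadic j k.
Proof. by rewrite divr_ge0. Qed.

Lemma dyadicS j k : dyadic j.+1 (2 * k) = dyadic j k.
Proof.
rewrite /dyadic expnS !natrM invfM mulrACA mulfV ?mul1r//.
Qed.

Lemma dyadicD j k l : dyadic j (k + l) = dyadic j k + dyadic j l.
Proof. by rewrite /dyadic natrD mulrDl. Qed.

Lemma dyadic_int j i : dyadic j (i * 2 ^ j) = i%:R.
Proof. by rewrite /dyadic natrM mulfK// gt_eqF// two_pow_gt0. Qed.

Lemma incr_measurable s t : 0 <= s -> 0 <= t ->
  measurable_fun setT (fun w => Z s w - Z t w : BR).
Proof. by move=> s0 t0; apply: measurable_funB; exact: mZ. Qed.

(** At integer times the process is a random walk with negative mean steps. *)
Lemma levy_walk_tail (e : R) : 0 < e -> exists K : nat,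
  (P (\bigcup_k [set w | (K%:R < Z k%:R w)%R]) < e%:E)%E.
Proof.
move=> e0; case: (levyZ) => _ _ _ iZ sZ.
pose X i w : BR := Z i.+1%:R w - Z i%:R w.
have mX i : measurable_fun setT (X i) by exact: incr_measurable.
have X0E : X 0%N = Z 1 by apply/funext => w; rewrite /X Z0 subr0.
have hX i (C : set BR) : measurable C -> P (X i @^-1` C) = P (X 0%N @^-1` C).
  move=> mC; have := sZ i%:R 1 C (ler0n R i) ler01 mC.
  by rewrite X0E natr1.
have iid n (C : nat -> set BR) : (forall i, measurable (C i)) ->
    P (\bigcap_(i < n) (X i @^-1` C i)) = (\prod_(i < n) P (X 0%N @^-1` C i))%E.
  move=> mC; have := iZ n (fun i => i%:R) (lexx 0) _ C mC.
  move=> -> //; first by apply: eq_bigr => i _; exact: hX.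
  by move=> i; rewrite ler_nat.
have [||K hK] := @walk_tail _ _ _ P X mX iid _ _ e e0; [by rewrite X0E..|].
exists K; rewrite (_ : \bigcup_k _ = \bigcup_k [set w | K%:R < \sum_(i < k) X i w])//.
apply: eq_bigcupr => k _; apply/seteqP; split => w /=;
  by rewrite (_ : \sum_(i < k) X i w = Z k%:R w)// /X -(big_mkord xpredT
     (fun i => Z i.+1%:R w - Z i%:R w)) telescope_sumr// Z0 subr0.
Qed.

Let low (c : nat) : set T := \bigcup_j \bigcup_(k in [set k | (k <= 2 ^ j)%N])
  [set w | Z (dyadic j k) w < - c%:R].

Lemma measurable_lt s (y : R) : 0 <= s -> measurable [set w | Z s w < y].
Proof.
move=> s0; rewrite -[X in measurable X]setTI.
rewrite (_ : [set w | Z s w < y] = Z s @^-1` `]-oo, y[); first exact: (mZ s0).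
by apply/seteqP; split => w /=; rewrite in_itv.
Qed.

Lemma measurable_gt s (y : R) : 0 <= s -> measurable [set w | y < Z s w].
Proof. by move=> s0; apply: measurable_superlevel; exact: mZ. Qed.

Lemma measurable_low c : measurable (low c).
Proof.
apply: bigcupT_measurable => j; apply: bigcup_measurable => k _.
exact: measurable_lt (dyadic_ge0 j k).
Qed.

(** The path over the unit interval is bounded, so a level [c] exists below which it
falls with probability at most one half. *)
Lemma unit_time_lower : exists c : nat, (P (low c) <= (2^-1)%:E)%E.
Proof.
have c2 : P (low c) @[c --> \oo] --> P (\bigcap_c low c).
  apply: nonincreasing_cvg_mu.
  - by rewrite -ge0_fin_numE// fin_num_measure//; exact: measurable_low.
  - by move=> c; exact: measurable_low.
  - by apply: bigcapT_measurable => c; exact: measurable_low.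
  move=> c c' cc'; apply/subsetPset => w [j _ [k hk h]]; exists j => //; exists k => //=.
  by apply: (lt_le_trans h); rewrite lerN2 ler_nat.
have e0 : \bigcap_c low c = set0.
  apply/seteqP; split => w //= hw.
  have [M hM] := cadlag_bounded 1 (cZ w).
  have [j _ [k hk /= h]] := hw (Num.truncn M).+1 I.
  have := hM (dyadic j k).
  rewrite dyadic_ge0 ler_pdivrMr ?two_pow_gt0// mul1r ler_nat => /(_ hk).
  by rewrite ler_norml => /andP[h1 _]; have := truncnS_gt M; lra.
rewrite e0 measure0 in c2.
apply: contrapT => /forallNP hno.
have : ((2^-1 : R)%:E <= 0 :> \bar R)%E.
  rewrite -(cvg_lim _ c2)//; apply: lime_ge; first by apply/cvg_ex; eexists; exact: c2.
  by apply: nearW => c; have := hno c => /negP; rewrite -ltNge => /ltW.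
by rewrite lee_fin; lra.
Qed.

Section Maximal_inequality.
Variables (c : nat) (hc : (P (low c) <= (2^-1)%:E)%E) (x : R) (j : nat).
Let dl k := dyadic j k.
Let B k := [set w | x + c%:R < Z (dl k) w].
Let next k := (((k %/ 2 ^ j).+1) * 2 ^ j)%N.
Let A k := [set w | - c%:R <= Z (dl (next k)) w - Z (dl k) w].

Let next_ge k : (k <= next k)%N.
Proof. by rewrite /next; apply: ltnW; rewrite ltn_ceil// expn_gt0. Qed.

Let next_le k : (next k - k <= 2 ^ j)%N.
Proof. by rewrite /next mulSn leq_subLR addnC leq_add2r; exact: leq_trunc_div. Qed.

Let mB k : measurable (B k). Proof. exact: measurable_gt (dyadic_ge0 j k). Qed.

Let mA k : measurable (A k).
Proof.
rewrite -[X in measurable X]setTI.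
rewrite (_ : A k = (fun w => Z (dl (next k)) w - Z (dl k) w) @^-1` `[- c%:R, +oo[).
  exact: (incr_measurable (dyadic_ge0 j _) (dyadic_ge0 j _)).
by apply/seteqP; split => w /=; rewrite /A /= in_itv/= andbT.
Qed.

Lemma prob_A_ge k : ((2^-1)%:E <= P (A k))%E.
Proof.
case: levyZ => _ _ _ _ sZ.
pose r := dl (next k - k).
have := sZ (dl k) r `[- c%:R, +oo[%classic (dyadic_ge0 j _) (dyadic_ge0 j _) (measurable_itv _).
rewrite /r -dyadicD subnKC ?next_ge// => eA.
have -> : P (A k) = P [set w | - c%:R <= Z r w].
  rewrite (_ : A k = [set w | `[- c%:R, +oo[%classic (Z (dl (next k)) w - Z (dl k) w)]).
    rewrite eA; congr (P _); apply/seteqP; split => w /=; by rewrite in_itv/= andbT.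
  by apply/seteqP; split => w /=; rewrite /A /= in_itv/= andbT.
have -> : [set w | - c%:R <= Z r w] = ~` [set w | Z r w < - c%:R].
  by apply/seteqP; split => w /= ; rewrite leNgt => /negP.
rewrite probability_setC; last exact: measurable_lt (dyadic_ge0 j _).
have : (P [set w | (Z r w < - c%:R)%R] <= (2^-1)%:E)%E.
  apply: le_trans hc; apply: le_measure; rewrite ?inE.
  - exact: measurable_lt (dyadic_ge0 j _).
  - exact: measurable_low.
  - by move=> w /= h; exists j => //; exists (next k - k)%N => //=; exact: next_le.
set p := P _; have pf : p \is a fin_num.
  by rewrite fin_num_measure//; exact: measurable_lt (dyadic_ge0 j _).
by rewrite -(fineK pf) -EFinB !lee_fin; lra.
Qed.

Let E := seqDU B.

(** The first passage time [k] above the level depends on increments before [k],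
and the event [A k] on the increment between [k] and the next integer. *)
Lemma first_passage_indep k : P (E k `&` A k) = (P (E k) * P (A k))%E.
Proof.
case: levyZ => _ _ _ iZ _.
pose D i w : BR := Z (dl i.+1) w - Z (dl i) w.
have mD i : measurable_fun setT (D i).
  exact: (incr_measurable (dyadic_ge0 j _) (dyadic_ge0 j _)).
pose t i : R := if (i <= k)%N then dl i else dl (next k).
have t0 : 0 <= t 0%N by exact: dyadic_ge0.
have dlle i i' : (i <= i')%N -> dl i <= dl i'.
  by move=> ii'; rewrite /dl /dyadic ler_pM2r ?invr_gt0 ?two_pow_gt0// ler_nat.
have tnd i : t i <= t i.+1.
  rewrite /t; case: ifPn => ik; case: ifPn => ik' //.
  - exact: dlle.
  - by apply: dlle; exact: leq_trans ik (next_ge k).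
  - by move: ik; rewrite (leq_trans (leqnSn i) ik').
have iD n (C : nat -> set BR) : (n <= k)%N -> (forall i, measurable (C i)) ->
    P (\bigcap_(i < n) (D i @^-1` C i)) = (\prod_(i < n) P (D i @^-1` C i))%E.
  by move=> _ mC; apply: (iZ n dl) => // i; exact: dlle.
have AE : A k = (fun w => Z (dl (next k)) w - Z (dl k) w) @^-1` `[- c%:R, +oo[.
  by apply/seteqP; split => w /=; rewrite /A /= in_itv/= andbT.
have rect (C : nat -> set BR) : (forall i, measurable (C i)) ->
    P (\bigcap_(i < k) (D i @^-1` C i) `&` A k) =
    (P (\bigcap_(i < k) (D i @^-1` C i)) * P (A k))%E.
  move=> mC; pose C' i : set BR := if (i < k)%N then C i else `[- c%:R, +oo[%classic.
  have mC' i : measurable (C' i) by rewrite /C'; case: ifP => // _; exact: measurable_itv.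
  have := iZ k.+1 t t0 tnd C' mC'; rewrite big_ord_recr/=.
  have -> : (\prod_(i < k) P ((fun w => (Z (t i.+1) w - Z (t i) w)%R) @^-1` C' i))%E =
      P (\bigcap_(i < k) (D i @^-1` C i)).
    rewrite iD//; apply: eq_bigr => i _.
    by rewrite /C' ltn_ord /t ltn_ord (ltnW (ltn_ord i)).
  have -> : P ((fun w => Z (t k.+1) w - Z (t k) w) @^-1` C' k) = P (A k).
    by rewrite /C' ltnn /t leqnn ltnn AE.
  move=> <-; congr (P _); apply/seteqP; split => w /=.
    move=> [h1 h2] i /=; rewrite ltnS leq_eqVlt => /predU1P[->|ik].
      by rewrite /C' ltnn /t leqnn ltnn; rewrite AE in h2.
    by rewrite /C' ik /t ik (ltnW ik); exact: h1.
  move=> h; split => [i ik|].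
    by have := h i (ltnW ik); rewrite /C' ik /t ik (ltnW ik).
  by have := h k (ltnSn k); rewrite AE /C' ltnn /t leqnn ltnn.
pose B' := [set u : k.-tuple BR | x + c%:R < \sum_(l < k) nth 0 u l] `\`
  \bigcup_(i < k) [set u : k.-tuple BR | x + c%:R < \sum_(l < i) nth 0 u l].
have msum i : measurable [set u : k.-tuple BR | x + c%:R < \sum_(l < i) nth 0 u l].
  apply: measurable_superlevel.
  apply: (@measurable_sum _ _ _ _ _ _ (fun (l : 'I_i) (u : k.-tuple BR) => nth 0 u l : R)) => l.
  exact: measurable_tuple_nth.
have mB' : measurable B'.
  by apply: measurableD; [exact: msum|apply: bigcup_measurable => i _; exact: msum].
have sumE i w : (i <= k)%N -> \sum_(l < i) nth 0 (proc_tuple k D w) l = Z (dl i) w.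
  move=> ik; under eq_bigr => l _.
    rewrite -(tnth_nth 0 _ (Ordinal (leq_trans (ltn_ord l) ik))) tnth_mktuple /=.
    over.
  rewrite /D -(big_mkord xpredT (fun i => Z (dl i.+1) w - Z (dl i) w)).
  by rewrite telescope_sumr// /dl /dyadic mul0r Z0 subr0.
have EE : E k = proc_tuple k D @^-1` B'.
  rewrite /E /seqDU; apply/seteqP; split => w /=.
    move=> [h1 h2]; split; first by rewrite /= sumE.
    move=> [i ik /=]; rewrite sumE ?(ltnW ik)// => h; apply: h2.
    by rewrite -bigcup_mkord; exists i.
  move=> [/= h1 h2]; split; first by rewrite sumE in h1.
  rewrite -bigcup_mkord => -[i ik h]; apply: h2; exists i => //=.
  by rewrite sumE// ltnW.
by rewrite EE; exact: (tuple_indep mD (mA k) rect mB').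
Qed.

(** After passing above [x + c] at a dyadic time, the process loses at most [c]
until the next integer with probability at least one half; it is then above [x] at
an integer time. Fluctuations between integers are thus controlled by the
random walk. *)
Lemma ottaviani : (P (\bigcup_k B k) <= 2%:E * P (\bigcup_i [set w | (x < Z i%:R w)%R]))%E.
Proof.
have mE k : measurable (E k).
  by apply: measurableD => //; apply: bigsetU_measurable.
have tE : trivIset setT E by exact: trivIset_seqDU.
have -> : P (\bigcup_k B k) = (\sum_(k <oo) P (E k))%E.
  rewrite seqDU_bigcup_eq measure_semi_bigcup//.
  by apply: bigcupT_measurable => k; exact: mE.
have mEA k : measurable (E k `&` A k) by exact: measurableI.
have tEA : trivIset setT (fun k => E k `&` A k).
  by apply/trivIsetP => i i' _ _ ii'; rewrite setIACA; move/trivIsetP : tE => ->//; rewrite set0I.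
apply: (@le_trans _ _ (\sum_(k <oo) (2%:E * P (E k `&` A k)))%E).
  apply: lee_nneseries => // k _.
  rewrite first_passage_indep.
  have fE : P (E k) \is a fin_num by exact: fin_num_measure.
  have fA : P (A k) \is a fin_num by exact: fin_num_measure.
  have := prob_A_ge k; have : (0 <= P (E k))%E by [].
  rewrite -(fineK fE) -(fineK fA) -!EFinM !lee_fin => h1 h2; nra.
rewrite nneseriesZl//; apply: lee_wpmul2l; first by rewrite lee_fin.
have <- : P (\bigcup_k (E k `&` A k)) = (\sum_(k <oo) P (E k `&` A k))%E.
  rewrite measure_semi_bigcup//; apply: bigcupT_measurable => k; exact: mEA.
apply: le_measure; rewrite ?inE.
- exact: bigcupT_measurable.
- by apply: bigcupT_measurable => i; exact: measurable_gt.
move=> w [k _ [[h1 _] h2]]; exists (k %/ 2 ^ j).+1 => //=.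
move: h1 h2; rewrite /B /A /= /next /dl dyadic_int; lra.
Qed.

End Maximal_inequality.

(** The maximal inequality is uniform in the dyadic level, and right continuity
extends the bound from dyadic to all times. *)
Lemma levy_sup_bounded (e : R) : 0 < e -> exists K (A : set T),
  [/\ measurable A, (P (~` A) <= e%:E)%E &
    forall w, A w -> forall s, 0 <= s -> Z s w <= K].
Proof.
move=> e0; have [c hc] := unit_time_lower.
have [K0 hK0] := levy_walk_tail (divr_gt0 e0 (ltr0n R 2)).
pose K : R := K0%:R + c%:R.
pose B j := \bigcup_k [set w | K < Z (dyadic j k) w].
have mB j : measurable (B j).
  by apply: bigcupT_measurable => k; exact: measurable_gt (dyadic_ge0 j k).
have hB j : (P (B j) <= e%:E)%E.
  apply: (le_trans (ottaviani hc K0%:R j)).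
  apply: (@le_trans _ _ (2%:E * (e / 2)%:E)%E).
    by apply: lee_pmul => //; exact: ltW.
  by rewrite -EFinM lee_fin mulrC divfK.
have B_nd : nondecreasing_seq B.
  apply/nondecreasing_seqP => j; apply/subsetPset => w [k _ /= h].
  by exists (2 * k)%N => //=; rewrite dyadicS.
have mU : measurable (\bigcup_j B j) by exact: bigcupT_measurable.
exists K, (~` \bigcup_j B j); split.
- exact: measurableC.
- rewrite setCK.
  have cB : P (B j) @[j --> \oo] --> P (\bigcup_j B j) by exact: nondecreasing_cvg_mu.
  rewrite -(cvg_lim _ cB)//; apply: lime_le; first by apply/cvg_ex; eexists; exact: cB.
  exact: nearW.
move=> w hw s s0.
pose u j : R := dyadic j (Num.truncn (s * (2 ^ j)%:R)).+1.
have u1 j : s < u j by rewrite /u /dyadic ltr_pdivlMr ?two_pow_gt0// truncnS_gt.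
have u2 j : u j <= s + (2 ^ j)%:R^-1.
  rewrite /u /dyadic ler_pdivrMr ?two_pow_gt0// mulrDl mulVf ?gt_eqF ?two_pow_gt0//.
  rewrite -natr1 lerD2r truncn_le mulr_ge0//.
have cu : u @ \oo --> s.
  apply: (@squeeze_cvgr _ _ _ _ (fun=> s) (fun j => s + (2 ^ j)%:R^-1)).
  - by apply: nearW => j; rewrite (ltW (u1 j)) u2.
  - exact: cvg_cst.
  - rewrite -[X in _ --> X]addr0; apply: cvgD; first exact: cvg_cst.
    have := @cvg_expr R (2^-1) _; rewrite ger0_norm ?invr_ge0// => h.
    have -> : (fun j => (2 ^ j)%:R^-1 : R) = (fun j => 2^-1 ^+ j).
      by apply/funext => j; rewrite natrX exprVn.
    by apply: h; lra.
have cZu : (fun j => Z (u j) w) @ \oo --> Z s w.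
  have /cvg_at_rightP := (cZ w).1 s s0; apply; split => //.
rewrite -(cvg_lim _ cZu)//; apply: limr_le; first by apply/cvg_ex; eexists; exact: cZu.
apply: nearW => j; rewrite leNgt; apply/negP => h; apply: hw; exists j => //.
by exists (Num.truncn (s * (2 ^ j)%:R)).+1.
Qed.

End Negative_drift.
End Levy_supremum.

(** * Lévy increments on a grid *)

Section Levy_grid_laws.
Context {d : measure_display} {T : measurableType d} {R : realType}.
Local Notation BR := (measurableTypeR R).
Variable P : probability T R.

Lemma levy_increments_law (X : R -> T -> BR) (dl : R) (n : nat) (C : nat -> set BR) :
  levy_process P X -> 0 <= dl -> (forall i, measurable (C i)) ->
  P (\bigcap_(i < n) ((fun w => X (i.+1%:R * dl) w - X (i%:R * dl) w) @^-1` C i)) =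
  (\prod_(i < n) P (X dl @^-1` C i))%E.
Proof.
move=> [_ _ _ iX sX] dl0 mC.
have := iX n (fun i => i%:R * dl) _ _ C mC.
rewrite mul0r lexx => /(_ isT) -> => [|i].
  apply: eq_bigr => i _; have := sX (i%:R * dl) dl (C i) (mulr_ge0 (ler0n R i) dl0) dl0 (mC i).
  have -> : i.+1%:R * dl = i%:R * dl + dl by rewrite -natr1 mulrDl mul1r.
  exact.
by rewrite ler_wpM2r// ler_nat.
Qed.

(** The increments are independent and identically distributed, so reading them in
reverse order does not change their joint law. *)
Lemma levy_increments_rev_law (X : R -> T -> BR) (dl : R) (N : nat) (C : nat -> set BR) :
  levy_process P X -> 0 <= dl -> (forall i, measurable (C i)) ->
  P (\bigcap_(i < N.+1) ((fun w => X ((N.+1 - i)%:R * dl) w - X ((N - i)%:R * dl) w)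
       @^-1` C i)) =
  (\prod_(i < N.+1) P (X dl @^-1` C i))%E.
Proof.
move=> lX dl0 mC.
have h := levy_increments_law N.+1 (C := fun i => C (N - i)%N) lX dl0 (fun i => mC _).
rewrite [RHS](reindex_inj rev_ord_inj)/=.
rewrite (eq_bigr (fun i : 'I_N.+1 => P (X dl @^-1` C (N - i)%N))); last first.
  by move=> i _; rewrite subSS.
rewrite -h; congr (P _); apply/seteqP; split => w /= hw i /= iN.
  have := hw (N - i)%N; rewrite /= ltnS leq_subr => /(_ isT).
  by rewrite subKn// subSn ?leq_subr// subKn.
have := hw (N - i)%N; rewrite /= ltnS leq_subr => /(_ isT).
by rewrite subKn// -subSn.
Qed.

Lemma cvg_harmonicS : (fun k : nat => k.+2%:R^-1 : R) @ \oo --> (0 : R).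
Proof.
by rewrite (cvg_shiftS (fun n : nat => n.+1%:R^-1 : R)); exact: cvg_harmonic.
Qed.

Lemma left_limit_measurable (X : R -> T -> BR) (s : R) :
  levy_process P X -> 0 < s ->
  measurable_fun setT (fun w => left_limit (X ^~ w) s : BR).
Proof.
move=> [mX _ cX _ _] s0.
apply: (@measurable_fun_cvg _ _ _ _ (fun k w => X (s - s / k.+2%:R) w)).
  move=> k; apply: mX; rewrite subr_ge0 ler_pdivrMr// ler_peMr ?(ltW s0)//.
  by rewrite ler1n.
move=> w _; have /cvg_at_leftP := left_limit_cvg (cX w) s0; apply; split.
  by move=> k; rewrite gtrBl divr_gt0.
rewrite -[X in _ --> X]subr0; apply: cvgB; first exact: cvg_cst.
rewrite -[X in _ --> X](mulr0 s); apply: cvgM; first exact: cvg_cst.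
exact: cvg_harmonicS.
Qed.

(** The increments over [[s - h, s]] and over [[0, h]] have the same law; the first
tends to the jump at [s] and the second to 0. Compare the expectations of the
bounded function [Num.min 1 `|y|]. *)
Lemma no_fixed_jump (X : R -> T -> BR) (s : R) : levy_process P X -> 0 < s ->
  {ae P, forall w, left_limit (X ^~ w) s = X s w}.
Proof.
move=> lX s0; have [mX X0 cX _ sX] := lX.
pose h k : R := s / k.+2%:R.
have h0 k : 0 < h k by rewrite divr_gt0.
have hs k : 0 <= s - h k.
  by rewrite subr_ge0 ler_pdivrMr// ler_peMr ?(ltW s0)// ler1n.
have ch : h @ \oo --> (0 : R).
  rewrite -(mulr0 s); apply: cvgM; first exact: cvg_cst.
  exact: cvg_harmonicS.
pose g (y : R) : R := clip 1 `|y|.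
have gE y : g y = Num.min 1 `|y| by rewrite /g /clip max_r.
have mg : measurable_fun setT (g : BR -> R).
  rewrite (_ : g = fun y => Num.min 1 `|y|); last exact/funext.
  by apply: measurable_minr => //; exact: measurableT_comp.
have g0 y : 0 <= g y by have /andP[] := clip_itv `|y| (@ler01 R).
have g1 y : `|g y| <= 1 by rewrite ger0_norm//; have /andP[] := clip_itv `|y| (@ler01 R).
have cg (u : nat -> R) y : u @ \oo --> y -> g \o u @ \oo --> g y.
  move=> /cvgrPdist_le cu; apply/cvgrPdist_le => e e0.
  apply: filterS (cu e e0) => n; apply: le_trans.
  by apply: (le_trans (clip_lip _ _ _)); exact: ler_dist_dist.
pose J w : R := X s w - left_limit (X ^~ w) s.
have mJ : measurable_fun setT J.
  by apply: measurable_funB; [exact/mX/ltW|exact: left_limit_measurable].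
have i1 : P.-integrable setT (EFin \o cst (1 : R)) by exact: finite_measure_integrable_cst.
have cl w : (fun k => X (s - h k) w) @ \oo --> left_limit (X ^~ w) s.
  have /cvg_at_leftP := left_limit_cvg (cX w) s0; apply; split.
    by move=> k; rewrite gtrBl.
  by rewrite -[X in _ --> X]subr0; apply: cvgB => //; exact: cvg_cst.
have cr w : (fun k => X (h k) w) @ \oo --> (0 : R).
  by have /cvg_at_rightP := (cX w).1 0 (lexx 0); rewrite X0; apply.
have [i2 c2] := @Rdominated_cvg _ _ _ P setT measurableT
  (fun k w => g (X s w - X (s - h k) w)) (fun w => g (J w)) (cst 1)
  (fun k => measurableT_comp mg (measurable_funB (mX s (ltW s0)) (mX _ (hs k))))
  (fun w _ => cg _ _ (cvgB (cvg_cst _) (cl w))) i1 (fun k w _ => g1 _).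
have [i3 c3] := @Rdominated_cvg _ _ _ P setT measurableT
  (fun k w => g (X (h k) w)) (cst (g 0)) (cst 1)
  (fun k => measurableT_comp mg (mX _ (ltW (h0 k))))
  (fun w _ => cg _ _ (cr w)) i1 (fun k w _ => g1 _).
have e k : \int[P]_w g (X s w - X (s - h k) w) = \int[P]_w g (X (h k) w).
  congr fine; apply: (@law_expectation _ _ _ P (fun w => X s w - X (s - h k) w)
    (X (h k)) (EFin \o g)).
  - exact: measurable_funB (mX s (ltW s0)) (mX _ (hs k)).
  - exact: mX _ (ltW (h0 k)).
  - move=> C mC; have := sX (s - h k) (h k) C (hs k) (ltW (h0 k)) mC.
    by rewrite subrK.
  - exact/measurable_EFinP.
  - by move=> y; rewrite lee_fin.
have gJ0 : \int[P]_w g (J w) = 0.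
  rewrite -(cvg_lim _ c2)//; under eq_fun do rewrite e.
  rewrite (cvg_lim _ c3)// Rintegral_cst//= gE normr0 (min_r ler01) mul0r//.
have gJ0' : (\int[P]_w `|(g (J w))%:E| = 0)%E.
  under eq_integral do rewrite abse_EFin ger0_norm//.
  rewrite -[LHS]fineK; last exact: (integrable_fin_num measurableT i2).
  by congr EFin; exact: gJ0.
have mgJ : measurable_fun setT (EFin \o (g \o J)).
  by apply/measurable_EFinP; exact: measurableT_comp.
have [N [mN PN0 hN]] := (ae_eq_integral_abs P measurableT mgJ).1 gJ0'.
exists N; split => // w hw; apply: hN => /= hJ; apply: hw.
have [] := hJ I; rewrite gE /J => hm.
apply/esym/eqP; rewrite -subr_eq0 -normr_eq0; apply/eqP.
by move: hm; rewrite minEle; case: ifP => // _ /eqP; rewrite oner_eq0.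
Qed.

End Levy_grid_laws.

(** * Time reversal of the cost *)

Section Euler_functional.
Context {R : realType}.
Local Notation BR := (measurableTypeR R).

Lemma eq_euler_cost (f p : R -> R) (l C x0 dl : R) (y y' : nat -> R) (n : nat) :
  (forall j, (j <= n)%N -> y j = y' j) ->
  euler_cost f p l C x0 dl y n = euler_cost f p l C x0 dl y' n.
Proof.
move=> yy'.
have eW j : (j <= n)%N -> euler f l C dl y j = euler f l C dl y' j.
  by elim: j => [//|j ih jn] /=; rewrite ih ?(ltnW jn)// yy'// ltnW.
have eU j : (j <= n)%N -> euler_val f l C dl y j = euler_val f l C dl y' j.
  by move=> jn; rewrite /euler_val eW// yy'.
rewrite /euler_cost eU//; congr (_ + _ * _).
by apply: eq_bigr => j _; rewrite eU// ltnW.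
Qed.

Section Measurability.
Variables (f p : R -> R) (l C x0 dl : R).
Hypothesis C0 : 0 <= C.
Hypothesis mf : measurable_fun setT (fun z : BR => f (Num.max 0 z)).
Hypothesis mp : measurable_fun setT (fun z : BR => p (Num.max 0 z)).
Context {d : measure_display} {T : measurableType d}.
Variable Y : nat -> T -> BR.
Hypothesis mY : forall j, measurable_fun setT (Y j).

Lemma measurable_clip (W : T -> BR) : measurable_fun setT W ->
  measurable_fun setT (fun w => clip C (W w)).
Proof.
by move=> mW; apply: measurable_minr => //; exact: measurable_maxr.
Qed.

Lemma measurable_euler_arg j (W : T -> BR) : measurable_fun setT W ->
  measurable_fun setT (fun w => expR (Y j w) * clip C (W w)).
Proof.
move=> mW; apply: measurable_funM; first exact: measurableT_comp.
exact: measurable_clip.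
Qed.

Let clip_max y W : expR y * clip C W = Num.max 0 (expR y * clip C W).
Proof.
by have /andP[c0 _] := clip_itv W C0; rewrite max_r// mulr_ge0// expR_ge0.
Qed.

Lemma measurable_euler j : measurable_fun setT (fun w => euler f l C dl (Y ^~ w) j).
Proof.
elim: j => [|j ih] /=; first exact: measurable_cst.
apply: measurable_funB => //; apply: measurable_funM => //.
apply: measurable_funM; first by do 2 apply: measurableT_comp => //.
have := measurableT_comp mf (measurable_euler_arg j ih).
rewrite (_ : _ \o _ = (fun w => f (expR (Y j w) * clip C (euler f l C dl (Y ^~ w) j))))//.
by apply/funext => w /=; rewrite -clip_max.
Qed.

Lemma measurable_euler_cost n :
  measurable_fun setT (fun w => euler_cost f p l C x0 dl (Y ^~ w) n).
Proof.
have mU j : measurable_fun setT (fun w => euler_val f l C dl (Y ^~ w) j).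
  exact: (measurable_euler_arg j (measurable_euler j)).
apply: measurable_funD; first exact: measurable_funM.
apply: measurable_funM => //; apply: measurable_sum => j.
have := measurableT_comp mp (mU j).
rewrite (_ : _ \o _ = (fun w => p (euler_val f l C dl (Y ^~ w) j)))//.
by apply/funext => w /=; rewrite /euler_val -clip_max.
Qed.

End Measurability.

Lemma euler_cost_ge0 (f p : R -> R) (l C x0 dl : R) (y : nat -> R) n :
  0 <= C -> 0 <= x0 -> 0 <= dl -> (forall z, 0 <= z -> 0 <= p z) ->
  0 <= euler_cost f p l C x0 dl y n.
Proof.
move=> C0 x00 dl0 p0.
have U0 j : 0 <= euler_val f l C dl y j.
  by rewrite mulr_ge0 ?expR_ge0//; have /andP[] := clip_itv (euler f l C dl y j) C0.
apply: addr_ge0; apply: mulr_ge0 => //.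
by apply: sumr_ge0 => j _; exact: p0.
Qed.

End Euler_functional.

Section Time_reversal.
Context {d : measure_display} {T : measurableType d} {R : realType}.
Local Notation BR := (measurableTypeR R).
Local Notation leb := (@lebesgue_measure R).
Variables (P : probability T R) (xi xi' : R -> T -> BR).
Hypothesis hxi : levy_process P xi.
Hypothesis hxi' : independent_copy P xi xi'.
Variables (f p : R -> R) (b : R).
Hypothesis fge : forall z, 0 <= z -> b * z <= f z.
Hypothesis f0 : f 0 = 0.
Hypothesis flip : forall K, 1 <= K -> exists2 L, 0 <= L &
  forall z z', 0 <= z <= K -> 0 <= z' <= K -> `|f z - f z'| <= L * `|z - z'|.
Hypothesis mf : measurable_fun setT (fun z : BR => f (Num.max 0 z)).
Hypothesis p_ge0 : forall z, 0 <= z -> 0 <= p z.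
Hypothesis p_le : forall z z', 0 <= z -> z <= z' -> p z <= p z'.
Hypothesis p_cvg : forall (z_ : nat -> R) z, (forall k, 0 <= z_ k) ->
  z_ @ \oo --> z -> p \o z_ @ \oo --> p z.
Hypothesis mp : measurable_fun setT (fun z : BR => p (Num.max 0 z)).
Variable v : T -> R -> R -> R -> R.
Hypothesis hv : forall w t l, 0 <= l ->
  positive_solution f (two_sided xi xi' ^~ w) t l (fun r => v w r t l).

Let levy' : levy_process P xi'. Proof. by case: hxi'. Qed.
Let xi0 w : xi 0 w = 0. Proof. by case: hxi => _ + _ _ _; apply. Qed.
Let cxi w : cadlag (xi ^~ w). Proof. by case: hxi => _ _ + _ _; apply. Qed.
Let cxi' w : cadlag (xi' ^~ w). Proof. by case: levy' => _ _ + _ _; apply. Qed.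
Let mxi s : 0 <= s -> measurable_fun setT (xi s). Proof. by case: hxi => + _ _ _ _; apply. Qed.
Let mxi' s : 0 <= s -> measurable_fun setT (xi' s). Proof. by case: levy' => + _ _ _ _; apply. Qed.

Lemma path_right_cts w s : two_sided xi xi' q w @[q --> s^'+] --> two_sided xi xi' s w.
Proof. exact: two_sided_right_cts. Qed.

Lemma path_bounded w r t : exists M, forall s, r <= s <= t -> `|two_sided xi xi' s w| <= M.
Proof. exact: two_sided_bounded. Qed.

(** Exponent of the transition semigroup, over an arbitrary time interval. *)
Definition backward_cost (r t l x0 : R) (w : T) : R :=
  x0 * v w r t l + \int[leb]_(s in `[r, t]) p (v w s t l).

Definition pushed_cost (r t l x0 : R) (N : nat) (w : T) : R :=
  euler_cost f p l (clip_level r t l b) x0 (mesh r t N)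
    (grid_path (two_sided xi xi' ^~ w) r t N) N.+1.

Lemma pushed_cost_cvg r t l x0 w : r < t -> 0 <= l ->
  (fun N => pushed_cost r t l x0 N w) @ \oo --> backward_cost r t l x0 w.
Proof.
move=> rt l0; have [M hM] := path_bounded w r t.
apply: (@euler_cost_cvg _ f p (two_sided xi xi' ^~ w) (fun s => v w s t l) r t l b M) => //.
- exact: hv.
- by move=> s _; exact: path_right_cts.
Qed.

Lemma measurable_two_sided s : measurable_fun setT (two_sided xi xi' s : T -> BR).
Proof.
have [s0|s0] := leP 0 s.
  rewrite (_ : two_sided xi xi' s = xi s); first exact: mxi.
  by apply/funext => w; rewrite two_sided_nneg.
rewrite (_ : two_sided xi xi' s = fun w => - left_limit (xi' ^~ w) (- s)).
  by apply: measurableT_comp => //; apply: left_limit_measurable levy' _; lra.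
by apply/funext => w; rewrite two_sided_neg.
Qed.

Lemma measurable_pushed_cost r t l x0 N : r < t -> 0 <= l ->
  measurable_fun setT (pushed_cost r t l x0 N : T -> BR).
Proof.
move=> rt l0; apply: measurable_euler_cost => //; first exact: clip_level_ge0.
by move=> j; apply: measurable_funB; exact: measurable_two_sided.
Qed.

Lemma measurable_backward_cost r t l x0 : r < t -> 0 <= l ->
  measurable_fun setT (backward_cost r t l x0 : T -> BR).
Proof.
move=> rt l0.
apply: (@measurable_fun_cvg _ _ _ _ (fun N w => pushed_cost r t l x0 N w)).
  by move=> N; exact: measurable_pushed_cost.
by move=> w _; exact: pushed_cost_cvg.
Qed.

Lemma cost_integrable_itv (r t l : R) w : r < t -> 0 <= l ->
  leb.-integrable `[r, t] (EFin \o (fun s => p (v w s t l))).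
Proof.
move=> rt l0; have [M hM] := path_bounded w r t.
have [] // := @cost_integral_cvg _ f p (two_sided xi xi' ^~ w) (fun s => v w s t l) r t l b M rt l0 _
  fge f0 flip p_ge0 p_le p_cvg _ hM.
- exact: hv.
- by move=> s _; exact: path_right_cts.
Qed.

Variables (t l x0 : R).
Hypotheses (t0 : 0 < t) (l0 : 0 <= l) (x00 : 0 <= x0).

Let dl N := mesh 0 t N.
Let C := clip_level 0 t l b.
Let C_ge0 : 0 <= C. Proof. exact: clip_level_ge0. Qed.
Let dl_gt0 N : 0 < dl N. Proof. exact: mesh_gt0. Qed.

Let meshE N : mesh (- t) 0 N = dl N.
Proof. by rewrite /dl /mesh; congr (_ / _); ring. Qed.

Let tE N : N.+1%:R * dl N = t.
Proof. by have := grid_last 0 t N; rewrite -/(dl N); lra. Qed.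

Let y1 N j w : R := grid_path (two_sided xi xi' ^~ w) 0 t N j.
Let y2 N j w : R := grid_path (two_sided xi xi' ^~ w) (- t) 0 N j.

Let D1 N i w : BR := xi ((N.+1 - i)%:R * dl N) w - xi ((N - i)%:R * dl N) w.
Let Lv N i w : R := if i is 0 then 0 else left_limit (xi' ^~ w) (i%:R * dl N).
Let D2 N i w : BR := Lv N i.+1 w - Lv N i w.
Let D3 N i w : BR := xi' (i.+1%:R * dl N) w - xi' (i%:R * dl N) w.

Let gt0 N i : 0 <= i%:R * dl N. Proof. by rewrite mulr_ge0// ltW. Qed.

Let mD1 N i : measurable_fun setT (D1 N i).
Proof. by apply: measurable_funB; exact: mxi. Qed.

Let mL N i : measurable_fun setT (Lv N i : T -> BR).
Proof.
case: i => [|i]; first exact: measurable_cst.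
by apply: left_limit_measurable levy' _; rewrite mulr_gt0.
Qed.

Let mD2 N i : measurable_fun setT (D2 N i).
Proof. exact: measurable_funB (mL N i.+1) (mL N i). Qed.

Let mD3 N i : measurable_fun setT (D3 N i).
Proof. by apply: measurable_funB; exact: mxi'. Qed.

Lemma y1_increments N j w : (j <= N.+1)%N -> y1 N j w = \sum_(i < j) D1 N i w.
Proof.
move=> jN; rewrite /y1 /grid_path /grid -/(dl N).
have -> : t - j%:R * dl N = (N.+1 - j)%:R * dl N.
  by rewrite natrB// mulrBl tE.
rewrite !two_sided_nneg//; last exact: ltW.
rewrite -{1}(tE N); elim: j jN => [_|j ih jN]; first by rewrite big_ord0 subn0 subrr.
rewrite big_ord_recr/= -ih ?(ltnW jN)// /D1 subSS; ring.
Qed.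

Lemma y2_increments N j w : y2 N j w = \sum_(i < j) D2 N i w.
Proof.
have -> : \sum_(i < j) D2 N i w = Lv N j w.
  rewrite -(big_mkord xpredT (fun i => D2 N i w)) telescope_sumr//.
  by rewrite /Lv subr0.
rewrite /y2 /grid_path /grid meshE (two_sided_nneg _ _ _ (lexx 0)) xi0 !sub0r.
case: j => [|j] /=; first by rewrite mul0r oppr0 two_sided_nneg// xi0 oppr0.
by rewrite two_sided_neg ?opprK// oppr_lt0 mulr_gt0.
Qed.

Let Phi N (u : N.+1.-tuple BR) : R :=
  expR (- euler_cost f p l C x0 (dl N) (fun j => \sum_(i < j) nth 0 u i) N.+1).

Lemma measurable_Phi N : measurable_fun setT (@Phi N : _ -> BR).
Proof.
do 2 apply: measurableT_comp => //.
apply: (measurable_euler_cost l x0 (dl N) C_ge0 mf mp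
  (Y := fun j (u : N.+1.-tuple BR) => \sum_(i < j) nth 0 u i)) => j.
apply: (@measurable_sum _ _ _ _ _ _ (fun (i : 'I_j) (u : N.+1.-tuple BR) => nth 0 u i : R)) => i.
exact: measurable_tuple_nth.
Qed.

Lemma Phi_tuple N (D : nat -> T -> BR) (y : nat -> R) w :
  (forall j, (j <= N.+1)%N -> y j = \sum_(i < j) D i w) ->
  expR (- euler_cost f p l C x0 (dl N) y N.+1) = Phi (proc_tuple N.+1 D w).
Proof.
move=> hy; congr (expR (- _)); apply: eq_euler_cost => j jN.
rewrite hy//; apply: eq_bigr => i _.
by rewrite -(tnth_nth 0 _ (Ordinal (leq_trans (ltn_ord i) jN))) tnth_mktuple.
Qed.

(** Both sides are the same function of [N + 1] independent increments: those of
[xi] read backwards from [t], and those of [xi'] read forwards from 0. The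
two-sided path involves left limits of [xi'], which agree almost surely with its
values on the grid. *)
Lemma pushed_cost_reversal N :
  \int[P]_w expR (- pushed_cost 0 t l x0 N w) =
  \int[P]_w expR (- pushed_cost (- t) 0 l x0 N w).
Proof.
have e1 w : expR (- pushed_cost 0 t l x0 N w) = Phi (proc_tuple N.+1 (D1 N) w).
  by apply: Phi_tuple => j jN; exact: y1_increments.
have clipE : clip_level (- t) 0 l b = C.
  by rewrite /C /clip_level; congr (_ * expR (_ * _)); ring.
have e2 w : expR (- pushed_cost (- t) 0 l x0 N w) = Phi (proc_tuple N.+1 (D2 N) w).
  rewrite /pushed_cost meshE clipE; apply: Phi_tuple => j jN; exact: y2_increments.
pose F (u : N.+1.-tuple BR) : \bar R := (Phi u)%:E.
have mF : measurable_fun setT F by apply/measurable_EFinP; exact: measurable_Phi.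
have F0 u : (0 <= F u)%E by rewrite lee_fin expR_ge0.
have same13 : same_cylinder_law P N.+1 (D1 N) (D3 N).
  move=> B mB; rewrite (levy_increments_rev_law N hxi (ltW (dl_gt0 N)) mB).
  rewrite (levy_increments_law N.+1 levy' (ltW (dl_gt0 N)) mB).
  apply: eq_bigr => i _; case: hxi' => _ hs _.
  have := hs 1%N (fun=> dl N) (fun=> B i) (fun=> ltW (dl_gt0 N)) (fun=> mB i).
  have e (Y : T -> BR) : \bigcap_(k < 1) (Y @^-1` B i) = Y @^-1` B i.
    by apply/seteqP; split => w /=; [move=> /(_ 0%N); apply|move=> h' [|k]].
  by rewrite !e.
have i1 : (\int[P]_w (expR (- pushed_cost 0 t l x0 N w))%:E =
    \int[P]_w F (proc_tuple N.+1 (D1 N) w))%E.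
  by apply: eq_integral => w _; rewrite e1.
have i2 : (\int[P]_w (expR (- pushed_cost (- t) 0 l x0 N w))%:E =
    \int[P]_w F (proc_tuple N.+1 (D2 N) w))%E.
  by apply: eq_integral => w _; rewrite e2.
have i3 := law_tuple_expectation (mD1 N) (mD3 N) same13 mF F0.
have aeL : {ae P, forall w, forall i, Lv N i w = xi' (i%:R * dl N) w}.
  apply: ae_foralln => -[|i].
    by apply: aeW => w /=; rewrite mul0r; case: levy' => _ + _ _ _; move=> ->.
  by apply: no_fixed_jump levy' _; rewrite mulr_gt0.
have i4 : (\int[P]_w F (proc_tuple N.+1 (D2 N) w) =
    \int[P]_w F (proc_tuple N.+1 (D3 N) w))%E.
  have m2 := measurableT_comp mF (measurable_proc_tuple (n := N.+1) (mD2 N)).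
  have m3 := measurableT_comp mF (measurable_proc_tuple (n := N.+1) (mD3 N)).
  apply: (ge0_ae_eq_integral measurableT m2 m3 (fun w _ => F0 _) (fun w _ => F0 _)).
  apply: filterS aeL => w hw _.
  have e : proc_tuple N.+1 (D2 N) w = proc_tuple N.+1 (D3 N) w.
    by apply: eq_from_tnth => i; rewrite !tnth_mktuple /D2 /D3 !hw.
  exact: (congr1 F e).
exact: (congr1 fine (etrans i1 (etrans i3 (etrans (esym i4) (esym i2))))).
Qed.

(** The cost over [[0, t]] and the cost over [[- t, 0]] are limits of their
discretisations, which have the same law. Fixing the final time at 0 makes the
cost converge pathwise as [t] grows, whereas the cost over [[0, t]] only converges
in law. *)
Lemma expectation_reversal :
  \int[P]_w expR (- backward_cost 0 t l x0 w) =
  \int[P]_w expR (- backward_cost (- t) 0 l x0 w).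
Proof.
have i1 : P.-integrable setT (EFin \o cst (1 : R)) by exact: finite_measure_integrable_cst.
have nt0 : - t < 0 by rewrite oppr_lt0.
have cv r s : r < s ->
    (fun N => \int[P]_w expR (- pushed_cost r s l x0 N w)) @ \oo -->
    \int[P]_w expR (- backward_cost r s l x0 w).
  move=> rs.
  have [] // := @Rdominated_cvg _ _ _ P setT measurableT
    (fun N w => expR (- pushed_cost r s l x0 N w))
    (fun w => expR (- backward_cost r s l x0 w)) (cst 1) _ _ i1 _.
  - by move=> N; do 2 apply: measurableT_comp => //; exact: measurable_pushed_cost.
  - move=> w _; apply: (continuous_cvg _ (@continuous_expR _ _)).
    by apply: cvgN; exact: pushed_cost_cvg.
  - move=> N w _; rewrite ger0_norm ?expR_ge0// expR_le1 oppr_le0.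
    apply: euler_cost_ge0 => //; first exact: clip_level_ge0.
    by apply: ltW; exact: mesh_gt0.
have c1 := cv 0 t t0; have c2 := cv (- t) 0 nt0.
have E := funext pushed_cost_reversal.
have c3 : (fun N => \int[P]_w expR (- pushed_cost 0 t l x0 N w)) @ \oo -->
    \int[P]_w expR (- backward_cost (- t) 0 l x0 w).
  by rewrite [X in X @ \oo]E; exact: c2.
exact: (cvg_unique _ c1 c3).
Qed.

End Time_reversal.

(** * Quantile functions *)

Section Restricted_pushforward.
Context {R : realType}.
Local Notation BR := (measurableTypeR R).
Local Notation leb := (@lebesgue_measure R).
Local Notation Rge0 := (`[0%R, +oo[%classic : set BR).

Lemma Rintegral_pushforward_restr (D : set BR) (mD : measurable D) (q : BR -> BR)
    (mq : measurable_fun setT q) (f : BR -> R) (M : R) (nu : {measure set BR -> \bar R}) :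
  (leb D < +oo)%E ->
  (forall A, measurable A -> nu A = leb (q @^-1` A `&` D)) ->
  (forall u, D u -> 0 <= q u) ->
  measurable_fun setT f -> (forall y, `|f y| <= M) ->
  (nu.-integrable Rge0 (EFin \o f)) /\
  \int[nu]_(y in `[0, +oo[) f y = \int[leb]_(u in D) f (q u).
Proof.
move=> lebD nuE q0 mf fM.
have mR : measurable Rge0 by exact: measurable_itv.
pose U : {measure set BR -> \bar R} := mrestr leb mD.
have mfq : measurable_fun setT (f \o q) by exact: measurableT_comp.
have UT : (U setT < +oo)%E by rewrite /U /= /mrestr setTI.
have bfq : [bounded (f \o q) u | u in [set: BR]].
  exists M; split; first exact: num_real.
  by move=> K MK u _ /=; exact: le_trans (fM _) (ltW MK).
have iU : U.-integrable setT (EFin \o (f \o q)).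
  by apply: measurable_bounded_integrable => //.
have iUR : U.-integrable (q @^-1` Rge0) (EFin \o f \o q).
  apply: (@integrableS _ _ _ U setT) => //.
  by rewrite -[_ @^-1` _]setTI; exact: mq.
have mfE : measurable_fun setT (EFin \o f) by exact/measurable_EFinP.
have ip := @integrable_pushforward _ _ _ _ _ q mq U Rge0 (EFin \o f) mfE iUR mR.
have e0 := @integral_pushforward _ _ _ _ _ q mq U Rge0 (EFin \o f) mfE iUR mR.
have mqR : measurable (q @^-1` Rge0) by rewrite -[_ @^-1` _]setTI; exact: mq.
have U0 : U (~` D) = 0%E by rewrite /U /= /mrestr setICl measure0.
have e1 : (\int[U]_(x in q @^-1` Rge0) (EFin \o f \o q) x =
    \int[U]_(x in D) (EFin \o f \o q) x)%E.
  rewrite (negligible_integral (measurableC mD) mqR iUR U0).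
  congr (integral _ _ _); apply/seteqP; split => u /=.
    by move=> [_ /contrapT].
  by move=> Du; split; [rewrite in_itv/= q0|move=> /(_ Du)].
have e2 : (\int[U]_(x in D) (EFin \o f \o q) x = \int[leb]_(x in D) (EFin \o f \o q) x)%E.
  by apply: eq_measure_integral => B mB BD; rewrite /U/= /mrestr setIidl.
have e3 : (\int[nu]_(y in Rge0) (EFin \o f) y = \int[pushforward U q]_(y in Rge0) (EFin \o f) y)%E.
  by apply: (eq_measure_integral (pushforward U q)) => A mA _; exact: nuE.
split.
  apply: measurable_bounded_integrable => //.
  - rewrite nuE//; apply: le_lt_trans lebD; apply: le_measure; rewrite ?inE//.
    exact: measurableI.
  - exact: measurable_funTS.
  - exists M; split; first exact: num_real.
    by move=> K MK u _ /=; exact: le_trans (fM _) (ltW MK).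
by rewrite /Rintegral e3 e0 e1 e2.
Qed.

End Restricted_pushforward.

Section Quantile.
Context {R : realType}.
Local Notation BR := (measurableTypeR R).
Local Notation leb := (@lebesgue_measure R).
Local Notation Rge0 := (`[0%R, +oo[%classic : set BR).
Local Notation I01 := (`]0%R, 1%R[%classic : set BR).
Variable nu : {measure set BR -> \bar R}.
Hypothesis nu1 : nu setT = 1%E.
Hypothesis nu0 : nu Rge0 = 1%E.

Definition dist_fun (y : R) : R := fine (nu `]-oo, y]%classic).
Local Notation F := dist_fun.

Let mray (y : R) : measurable (`]-oo, y]%classic : set BR).
Proof. exact: measurable_itv. Qed.

Let nu_fin (A : set BR) : measurable A -> nu A \is a fin_num.
Proof.
move=> mA; rewrite ge0_fin_numE//; apply: (@le_lt_trans _ _ (nu setT)).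
  by apply: le_measure; rewrite ?inE.
by rewrite nu1 ltry.
Qed.

Lemma dist_funE y : (F y)%:E = nu `]-oo, y]%classic.
Proof. by rewrite /F fineK// nu_fin. Qed.

Lemma dist_fun_nd : {homo F : x y / x <= y}.
Proof.
move=> x y xy; rewrite -lee_fin !dist_funE; apply: le_measure; rewrite ?inE//.
by move=> z /=; rewrite !in_itv/= => /le_trans; apply.
Qed.

Lemma dist_fun_le1 y : F y <= 1.
Proof.
by rewrite -lee_fin dist_funE -nu1; apply: le_measure; rewrite ?inE.
Qed.

Lemma dist_fun_rc (y u : R) : (forall e, 0 < e -> u <= F (y + e)) -> u <= F y.
Proof.
move=> h; pose A k := `]-oo, y + k.+1%:R^-1]%classic : set BR.
have mA k : measurable (A k) by exact: mray.
have cA : nu (A k) @[k --> \oo] --> nu (\bigcap_k A k).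
  apply: nonincreasing_cvg_mu.
  - by rewrite -ge0_fin_numE// nu_fin.
  - exact: mA.
  - exact: bigcapT_measurable.
  move=> k l kl; apply/subsetPset => z; rewrite /A /= !in_itv/= => /le_trans; apply.
  by rewrite lerD2l lef_pV2 ?posrE// ler_nat.
have AE : \bigcap_k A k = `]-oo, y]%classic.
  apply/seteqP; split => z.
    move=> hz; rewrite /= in_itv/=; apply/ler_addgt0Pr => e e0.
    have := hz (Num.truncn e^-1) I; rewrite /A /= in_itv/= => /le_trans; apply.
    rewrite lerD2l -[leRHS]invrK lef_pV2 ?posrE ?invr_gt0//.
    by rewrite ltW// truncnS_gt.
  by rewrite /= in_itv/= => zy k _; rewrite /A /= in_itv/= ler_wpDr.
rewrite -lee_fin dist_funE -AE -(cvg_lim _ cA)//.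
apply: lime_ge; first by apply/cvg_ex; eexists; exact: cA.
by apply: nearW => k; rewrite -dist_funE lee_fin; apply: h.
Qed.

Lemma dist_fun_lim (u : R) : u < 1 -> exists2 K, 0 <= K & u <= F K.
Proof.
move=> u1; pose A (k : nat) := `]-oo, k%:R]%classic : set BR.
have mA k : measurable (A k) by exact: mray.
have cA : nu (A k) @[k --> \oo] --> nu (\bigcup_k A k).
  apply: nondecreasing_cvg_mu; [exact: mA|exact: bigcupT_measurable|].
  move=> k l kl; apply/subsetPset => z; rewrite /A /= !in_itv/= => /le_trans; apply.
  by rewrite ler_nat.
have AE : \bigcup_k A k = setT.
  apply/seteqP; split => z // _; exists (Num.truncn z).+1 => //.
  by rewrite /A /= in_itv/= ltW// truncnS_gt.
rewrite AE nu1 in cA.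
apply: contrapT => hno.
have : (1 <= u%:E :> \bar R)%E.
  rewrite -(cvg_lim _ cA)//; apply: lime_le; first by apply/cvg_ex; eexists; exact: cA.
  apply: nearW => k; rewrite -dist_funE lee_fin leNgt; apply/negP => h.
  by apply: hno; exists k%:R => //; exact: ltW.
by rewrite lee_fin leNgt u1.
Qed.

(** Restricting to nonnegative [y] and giving the value 0 outside of the unit interval
keeps the quantile function nonnegative everywhere. *)
Definition quantile (u : R) : R :=
  if (0 < u) && (u < 1) then inf [set y | 0 <= y /\ u <= F y] else 0.

Lemma quantile_ge0 u : 0 <= quantile u.
Proof.
rewrite /quantile; case: ifP => // /andP[u0 u1].
by apply: lb_le_inf; [have [K K0 hK] := dist_fun_lim u1; exists K|move=> y []].
Qed.

Lemma quantile_le u y : 0 < u < 1 -> 0 <= y -> (quantile u <= y) = (u <= F y).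
Proof.
move=> u01 y0; rewrite /quantile u01; have /andP[u0 u1] := u01.
have hlb : has_lbound [set y | 0 <= y /\ u <= F y] by exists 0 => z [].
apply/idP/idP => [h|h]; last by apply: ge_inf.
apply: dist_fun_rc => e e0.
have hinf : has_inf [set y | 0 <= y /\ u <= F y].
  by split => //; have [K K0 hK] := dist_fun_lim u1; exists K.
have [z [z0 uz] ze] := inf_adherent e0 hinf.
by apply: (le_trans uz); apply: dist_fun_nd; rewrite ltW// (lt_le_trans ze)// lerD2r.
Qed.

Lemma quantile_nd u u' : 0 < u -> u <= u' -> u' < 1 -> quantile u <= quantile u'.
Proof.
move=> u0 uu' u'1; rewrite quantile_le ?u0 ?(le_lt_trans uu')// ?quantile_ge0//.
by apply: (le_trans uu'); rewrite -quantile_le ?quantile_ge0// u'1 andbT (lt_le_trans u0).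
Qed.

Lemma measurable_quantile : measurable_fun setT (quantile : BR -> BR).
Proof.
apply: (measurability _ (RGenOInfty.measurableE R)) => //.
move=> /= _ [_ [y ->] <-]; rewrite setTI.
have [y0|y0] := leP 0 y; last first.
  rewrite (_ : _ @^-1` _ = setT)//; apply/seteqP; split => u //= _.
  by rewrite in_itv/= andbT (lt_le_trans y0)// quantile_ge0.
rewrite (_ : _ @^-1` _ = I01 `&` `]F y, +oo[).
  by apply: measurableI; exact: measurable_itv.
apply/seteqP; split => u /=; rewrite !in_itv/= !andbT.
  move=> h; have u01 : 0 < u < 1.
    by move: h; rewrite /quantile; case: ifP => // _; rewrite ltNge y0.
  by split => //; rewrite ltNge -quantile_le// -ltNge.
by move=> [u01]; rewrite ltNge -quantile_le// -ltNge.
Qed.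

(** The quantile function transports Lebesgue measure on the unit interval to
[nu]; the half-lines [(y, +oo)] determine the measure. *)
Lemma quantile_law (A : set BR) : measurable A ->
  nu A = leb (quantile @^-1` A `&` I01).
Proof.
move=> mA; have mI : measurable I01 by exact: measurable_itv.
pose U : {measure set BR -> \bar R} := mrestr leb mI.
pose W : {measure set BR -> \bar R} :=
  measure_function_pushforward__canonical__measure_function_Measure U measurable_quantile.
suff : nu A = W A by [].
apply: (@measure_unique _ R BR (@RGenOInfty.G R) (fun k : nat => `](- k%:R : R), +oo[%classic) _ _ _ _ nu W) => //.
- exact: (RGenOInfty.measurableE R).
- move=> B C [x ->] [y ->]; exists (Num.max x y).
  by apply/seteqP; split => z /=; rewrite !in_itv/= !andbT gt_max => /andP.
- by move=> k; exists (- k%:R).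
- apply/seteqP; split => z // _; exists (Num.truncn (- z)).+1 => //=.
  by rewrite in_itv/= andbT ltrNl truncnS_gt.
- move=> B [y ->]; rewrite /W /= /pushforward /U /mrestr.
  have [y0|y0] := leP 0 y; last first.
    rewrite (_ : _ @^-1` _ = setT); last first.
      apply/seteqP; split => u //= _.
      by rewrite in_itv/= andbT (lt_le_trans y0)// quantile_ge0.
    rewrite setTI lebesgue_measure_itv/= lte_fin ltr01 -EFinB subr0.
    apply/eqP; rewrite eq_le; apply/andP; split.
      by rewrite -nu1; apply: le_measure; rewrite ?inE//; exact: measurable_itv.
    rewrite -nu0; apply: le_measure; rewrite ?inE//; [exact: measurable_itv..|].
    by move=> z /=; rewrite !in_itv/= !andbT; exact: lt_le_trans.
  have F0 : 0 <= F y by rewrite -lee_fin dist_funE.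
  rewrite (_ : _ `&` _ = `]F y, 1[%classic); last first.
    apply/seteqP; split => u /=; rewrite !in_itv/= !andbT.
      by move=> [h u01]; have /andP[_ ->] := u01; rewrite andbT ltNge -quantile_le// -ltNge.
    move=> /andP[h u1]; have u01 : 0 < u < 1 by rewrite u1 andbT (le_lt_trans F0).
    by rewrite u01; split => //; rewrite ltNge quantile_le// -ltNge.
  have -> : leb `]F y, 1[%classic = (1 - F y)%:E.
    rewrite lebesgue_measure_itv/= lte_fin; case: ifPn => // h.
    by rewrite (@le_anti _ _ (F y) 1) ?subrr// dist_fun_le1 leNgt.
  have e1 := @measureD _ BR R nu setT `]-oo, y]%classic measurableT (mray y).
  have nufin : (nu setT < +oo)%E by rewrite nu1 ltry.
  by rewrite -setCitvl -setTD (e1 nufin) setTI EFinB dist_funE; congr (_ - _)%E.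
- move=> k; rewrite -ge0_fin_numE// nu_fin//; exact: measurable_itv.
Qed.

Lemma integral_quantile (f : BR -> R) (M : R) :
  measurable_fun setT f -> (forall y, `|f y| <= M) ->
  nu.-integrable Rge0 (EFin \o f) /\
  \int[nu]_(y in `[0, +oo[) f y = \int[leb]_(u in I01) f (quantile u).
Proof.
move=> mf fM; apply: (Rintegral_pushforward_restr _ measurable_quantile) => //.
- by rewrite lebesgue_measure_itv/= lte_fin ltr01 -EFinB ltry.
- exact: quantile_law.
- by move=> u _; exact: quantile_ge0.
Qed.

End Quantile.

(** * Convergence of Laplace transforms *)

Section Laplace_continuity.
Context {R : realType}.
Local Notation BR := (measurableTypeR R).
Local Notation leb := (@lebesgue_measure R).
Local Notation Rge0 := (`[0%R, +oo[%classic : set BR).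
Local Notation I01 := (`]0%R, 1%R[%classic : set BR).

Let mI01 : measurable I01. Proof. exact: measurable_itv. Qed.

Let leb01 : leb I01 = 1%E.
Proof. by rewrite lebesgue_measure_itv/= lte_fin ltr01 -EFinB subr0. Qed.

Let int_bounded (D : set BR) (f : BR -> R) (M : R) : measurable D -> D `<=` I01 ->
  measurable_fun D f -> (forall u, D u -> `|f u| <= M) -> leb.-integrable D (EFin \o f).
Proof.
move=> mD DI mf fM; apply: measurable_bounded_integrable => //.
  apply: (@le_lt_trans _ _ (leb I01)); last by rewrite leb01 ltry.
  by apply: le_measure; rewrite ?inE.
exists M; split; first exact: num_real.
by move=> K MK u Du /=; exact: le_trans (fM _ Du) (ltW MK).
Qed.

Let tailI (x : R) : set BR := `[x, 1%R[%classic.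

Let mtail (x : R) : measurable_fun I01 (\1_(tailI x) : BR -> R).
Proof. by apply: measurable_funTS; apply: measurable_indic; exact: measurable_itv. Qed.

Let tail_le1 x u : `|\1_(tailI x) u : R| <= 1.
Proof. by rewrite indicE; case: (_ \in _); rewrite ?normr1 ?normr0. Qed.

Let int_tail (x : R) : 0 < x < 1 -> \int[leb]_(u in I01) (\1_(tailI x) u : R) = 1 - x.
Proof.
move=> /andP[x0 x1]; have e : leb (tailI x `&` I01) = (1 - x)%:E.
  have -> : tailI x `&` I01 = `[x, 1[%classic.
    apply/seteqP; split => u; rewrite /tailI /= !in_itv/=; first by case.
    by move=> /andP[xu u1]; rewrite xu u1 (lt_le_trans x0).
  by rewrite lebesgue_measure_itv/= lte_fin x1 -EFinB.
rewrite /Rintegral integral_indic//; last exact: measurable_itv.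
exact: (congr1 fine e).
Qed.

Let int_affine (p r x : R) : 0 < x < 1 ->
  leb.-integrable I01 (EFin \o (fun u => p + r * (\1_(tailI x) u : R))) /\
  \int[leb]_(u in I01) (p + r * (\1_(tailI x) u : R)) = p + r * (1 - x).
Proof.
move=> x01.
have i1 : leb.-integrable I01 (EFin \o (fun u => (\1_(tailI x) u : R))).
  by apply: (int_bounded (M := 1)) => // u _; exact: tail_le1.
have i2 : leb.-integrable I01 (EFin \o (fun=> p)).
  by apply: (int_bounded (M := `|p|)) => // u _.
have i3 := RintegrableZ mI01 r i1; split; first exact: RintegrableD.
rewrite RintegralD// RintegralZl// int_tail//; congr (_ + _).
transitivity (p * fine (leb I01)); first exact: Rintegral_cst.
by rewrite leb01 mulr1.
Qed.

(** The functions [y |-> (1 - expR (- (k * y))) ^+ M], finite combinations of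
exponentials, approximate the indicator of [(s, +oo)] when [M] is about
[expR (k * s)]: at [y] they are about [expR (- expR (k * (s - y)))]. Here [s] is the
midpoint of [a] and [b]. *)
Lemma cutoff_separates (a b e : R) : 0 <= a < b -> 0 < e ->
  exists k M, [/\ 0 <= k, 1 - e <= (1 - expR (- (k * b))) ^+ M &
    (1 - expR (- (k * a))) ^+ M <= e].
Proof.
move=> /andP[a0 ab] e0; pose k := 4 / (e * (b - a)).
have ba : 0 < b - a by rewrite subr_gt0.
have k0 : 0 < k by rewrite /k divr_gt0// mulr_gt0.
pose M := (Num.truncn (expR (k * ((a + b) / 2)))).+1.
have kE : k * ((b - a) / 2) = 2 / e.
  by rewrite /k; field; rewrite !gt_eqF.
have E1 : 1 + 2 / e <= expR (2 / e) by exact: expR_ge1Dx.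
have e2 : 0 < 2 / e by rewrite divr_gt0.
exists k, M; split; first exact: ltW.
- have y1 : expR (- (k * b)) <= 1 by rewrite expR_le1 oppr_le0 mulr_ge0 ?(ltW k0)// (le_trans a0)// ltW.
  (* Bernoulli's inequality. *)
  have bern (y : R) j : 0 <= y <= 1 -> 1 - j%:R * y <= (1 - y) ^+ j.
    move=> /andP[y0 yy]; elim: j => [|j IH]; first by rewrite mul0r subr0 expr0.
    rewrite exprS; apply: (@le_trans _ _ ((1 - y) * (1 - j%:R * y))).
      rewrite -natr1 -subr_ge0.
      rewrite (_ : _ - _ = j%:R * y ^+ 2); last by ring.
      by rewrite mulr_ge0// sqr_ge0.
    by rewrite ler_wpM2l// subr_ge0.
  apply: le_trans (bern _ _ _); last by rewrite expR_ge0.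
  rewrite lerD2l lerN2.
  have Mle : M%:R <= 2 * expR (k * ((a + b) / 2)).
    rewrite /M -natr1 (_ : 2 * _ = expR (k * ((a + b) / 2)) + expR (k * ((a + b) / 2))); last by ring.
    apply: lerD; first by rewrite truncn_le expR_ge0.
    by rewrite -expR0 ler_expR mulr_ge0 ?(ltW k0)// divr_ge0// addr_ge0// (le_trans a0)// ltW.
  apply: (@le_trans _ _ (2 * expR (- (2 / e)))).
    rewrite (_ : - (2 / e) = k * ((a + b) / 2) + - (k * b)); last by rewrite -kE; field.
    by rewrite expRD mulrA ler_wpM2r// expR_ge0.
  rewrite expRN -ler_pdivlMl// -[leRHS]invrK.
  rewrite lef_pV2 ?posrE ?expR_gt0 ?invr_gt0 ?mulr_gt0 ?invr_gt0//.
  apply: le_trans E1; rewrite invfM invrK mulrC.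
  by rewrite mulrC ler_wpDl.
- apply: (@le_trans _ _ (expR (- expR (- (k * a))) ^+ M)).
    have y1 : expR (- (k * a)) <= 1 by rewrite expR_le1 oppr_le0 mulr_ge0 ?(ltW k0).
    rewrite lerXn2r ?nnegrE ?subr_ge0 ?expR_ge0//.
    exact: expR_ge1Dx.
  rewrite -expRM_natl mulrN expRN -[leRHS]invrK lef_pV2 ?posrE ?expR_gt0 ?invr_gt0//.
  apply: (@le_trans _ _ (M%:R * expR (- (k * a)))); last first.
    by apply: le_trans (expR_ge1Dx _); rewrite lerDr.
  apply: (@le_trans _ _ (expR (k * ((a + b) / 2)) * expR (- (k * a)))); last first.
    by rewrite ler_wpM2r ?expR_ge0// ltW// truncnS_gt.
  rewrite -expRD (_ : _ + _ = 2 / e); last by rewrite -kE; field.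
  apply: le_trans E1; rewrite mulrDl; lra.
Qed.


Lemma clamped_continuous (f : R -> R) : {within `[0, +oo[, continuous f} ->
  continuous (fun y : R => f (Num.max 0 y)).
Proof.
move=> /subspace_continuousP cf x; apply/cvgrPdist_lt => e e0.
have := cf (Num.max 0 x); rewrite /= in_itv/= andbT le_max lexx => /(_ isT).
move=> /cvgrPdist_lt /(_ e e0); rewrite near_withinE => -[dl /= dl0 hdl].
near=> y; apply: hdl; last by rewrite /= in_itv/= andbT le_max lexx.
have : `|x - y| < dl by near: y; apply: cvgr_dist_lt.
apply: le_lt_trans; have := ler_norm (x - y); have := ler_norm (- (x - y)).
rewrite normrN => h1 h2; rewrite ler_norml.
by case: (leP 0 x) => ?; case: (leP 0 y) => ?; apply/andP; split; lra.
Unshelve. all: by end_near. Qed.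

Variable nu_ : nat -> {measure set BR -> \bar R}.
Hypothesis nu1 : forall n, nu_ n setT = 1%E.
Hypothesis nu0 : forall n, nu_ n Rge0 = 1%E.
Variable L : R -> R.
Hypothesis hL : forall l, 0 <= l -> laplace (nu_ n) l @[n --> \oo] --> (L l)%:E.

Local Notation q n := (quantile (nu_ n)).

Let q_ge0 n u : 0 <= q n u. Proof. exact: quantile_ge0. Qed.

Let mq n : measurable_fun setT (q n : BR -> BR).
Proof. exact: measurable_quantile. Qed.

Let int_q (D : set BR) (f : BR -> R) (M : R) n : measurable D -> D `<=` I01 ->
  measurable_fun setT f ->
  (forall y, 0 <= y -> `|f y| <= M) -> leb.-integrable D (EFin \o (f \o q n)).
Proof.
move=> mD DI mf fM; apply: (int_bounded (M := M)) => //.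
  by apply: measurable_funTS; exact: measurableT_comp.
by move=> u _; apply: fM.
Qed.

Let mexp (l : R) : measurable_fun setT (fun y : BR => expR (- (l * y))).
Proof.
by apply: measurableT_comp => //; apply: measurableT_comp => //; exact: measurable_funM.
Qed.

Let exp_le1 (l y : R) : 0 <= l -> 0 <= y -> `|expR (- (l * y))| <= 1.
Proof. by move=> l0 y0; rewrite ger0_norm ?expR_ge0// expR_le1 oppr_le0 mulr_ge0. Qed.

Let mmax : measurable_fun setT (Num.max 0 : BR -> BR).
Proof. by apply: (@measurable_maxr _ _ _ setT (cst 0) id). Qed.

Let laplace_quantile l n : 0 <= l ->
  laplace (nu_ n) l = (\int[leb]_(u in I01) expR (- (l * q n u)))%:E.
Proof.
move=> l0; pose f (y : BR) := expR (- (l * Num.max 0 y)).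
have [i e] : (nu_ n).-integrable Rge0 (EFin \o f) /\
    \int[nu_ n]_(y in `[0, +oo[) f y = \int[leb]_(u in I01) f (q n u).
  apply: (integral_quantile (nu1 n) (nu0 n) (M := 1)).
    exact: (measurableT_comp (mexp l) mmax).
  by move=> y; apply: exp_le1 => //; rewrite le_max lexx.
have e1 : laplace (nu_ n) l = (\int[nu_ n]_(y in Rge0) (f y)%:E)%E.
  apply: eq_integral => y; rewrite inE /= in_itv/= andbT => y0.
  by rewrite /f (max_idPr y0).
have e2 : \int[leb]_(u in I01) f (q n u) = \int[leb]_(u in I01) expR (- (l * q n u)).
  by apply: eq_Rintegral => u _; rewrite /f (max_idPr (q_ge0 n u)).
rewrite e1 -e2 -e /Rintegral fineK//.
exact: integrable_fin_num.
Qed.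

Let cvg_exp l : 0 <= l ->
  \int[leb]_(u in I01) expR (- (l * q n u)) @[n --> \oo] --> L l.
Proof.
move=> l0; apply: cvg_trans (fine_cvg (hL l0)); apply: near_eq_cvg; apply: nearW => n /=.
by rewrite laplace_quantile.
Qed.

Let cut (k : R) (M : nat) (y : R) : R := (1 - expR (- (k * y))) ^+ M.

Let cut_itv k M y : 0 <= k -> 0 <= y -> 0 <= cut k M y <= 1.
Proof.
move=> k0 y0; have y1 : expR (- (k * y)) <= 1 by rewrite expR_le1 oppr_le0 mulr_ge0.
rewrite exprn_ge0 ?subr_ge0//= exprn_ile1 ?subr_ge0//.
Qed.

Let cut_nd k M y z : 0 <= k -> 0 <= y -> y <= z -> cut k M y <= cut k M z.
Proof.
move=> k0 y0 yz; rewrite lerXn2r ?nnegrE ?subr_ge0 ?expR_le1 ?oppr_le0 ?mulr_ge0//.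
  exact: le_trans yz.
by rewrite lerD2l lerN2 ler_expR lerN2 ler_wpM2l.
Qed.

Let mcut k M : measurable_fun setT (cut k M : BR -> R).
Proof. by apply: measurable_funX; apply: measurable_funB => //; exact: mexp. Qed.

Let cut_abs k M y : 0 <= k -> 0 <= y -> `|cut k M y| <= 1.
Proof. by move=> k0 y0; have /andP[h h'] := cut_itv M k0 y0; rewrite ger0_norm. Qed.

Let cvg_cut_exp k M l : 0 <= k -> 0 <= l -> exists c : R,
  \int[leb]_(u in I01) (expR (- (l * q n u)) * cut k M (q n u)) @[n --> \oo] --> c.
Proof.
move=> k0; elim: M l => [|M IH] l l0.
  exists (L l); apply: cvg_trans (cvg_exp l0); apply: near_eq_cvg; apply: nearW => n.
  by apply: eq_Rintegral => u _; rewrite /cut expr0 mulr1.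
have [c1 h1] := IH l l0; have [c2 h2] := IH (l + k) (addr_ge0 l0 k0).
exists (c1 - c2); apply: cvg_trans (cvgB h1 h2); apply: near_eq_cvg; apply: nearW => n.
have i j : 0 <= j ->
    leb.-integrable I01 (EFin \o ((fun y => expR (- (j * y)) * cut k M y) \o q n)).
  move=> j0; apply: (@int_q I01 _ 1) => //.
    by apply: measurable_funM; [exact: mexp|exact: mcut].
  by move=> y y0; rewrite normrM mulr_ile1 ?exp_le1 ?cut_abs.
have e := RintegralB mI01 (i _ l0) (i _ (addr_ge0 l0 k0)).
apply: (etrans (esym e)); apply: eq_Rintegral => u _ /=.
have e2 : expR (- ((l + k) * q n u)) = expR (- (l * q n u)) * expR (- (k * q n u)).
  by rewrite -expRD; congr expR; ring.
by rewrite e2 /cut exprS; ring.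
Qed.

Let cvg_cut k M : 0 <= k -> exists c : R,
  \int[leb]_(u in I01) cut k M (q n u) @[n --> \oo] --> c.
Proof.
move=> k0; have [c hc] := cvg_cut_exp M k0 (lexx 0); exists c.
apply: cvg_trans hc; apply: near_eq_cvg; apply: nearW => n.
by apply: eq_Rintegral => u _; rewrite mul0r oppr0 expR0 mul1r.
Qed.

Let freq (p : nat -> Prop) := forall N, exists2 n, (N <= n)%N & p n.

Let not_freq p : ~ freq p -> \forall n \near \oo, ~ p n.
Proof.
move=> /existsNP[N hN]; exists N => // n /= Nn pn.
by apply: hN; exists n.
Qed.

Let freq_le (f : nat -> R) (c y : R) : f @ \oo --> c -> freq (fun n => f n <= y) -> c <= y.
Proof.
move=> fc hf; rewrite leNgt; apply/negP => yc.
have [N _ hN] : \forall n \near \oo, y < f n by exact: (cvgr_gt _ fc _ yc).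
by have [n Nn] := hf N; rewrite leNgt hN.
Qed.

Let freq_ge (f : nat -> R) (c y : R) : f @ \oo --> c -> freq (fun n => y <= f n) -> y <= c.
Proof.
move=> fc hf; rewrite leNgt; apply/negP => yc.
have [N _ hN] : \forall n \near \oo, f n < y by exact: (cvgr_lt _ fc _ yc).
by have [n Nn] := hf N; rewrite leNgt hN.
Qed.

Let oscil (a b : R) : set BR :=
  [set u | [/\ I01 u, freq (fun n => q n u < a) & freq (fun n => b < q n u)]].

(** At a point [u2] where the quantiles are infinitely often below [a], monotonicity
puts all of [(0, u2]] below [a]; at [u1 < u2] with quantiles infinitely often above
[b], all of [[u1, 1)] is above [b]. The integrals of the cutoff separating [a] from
[b] would be at most about [1 - u2] for some indices and at least about [1 - u1] for
others, but they converge. *)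
Lemma oscillation_unique a b u1 u2 : a < b -> oscil a b u1 -> oscil a b u2 -> ~ u1 < u2.
Proof.
move=> ab [u1I _ hb] [u2I ha _] u12.
have u1I' : 0 < u1 < 1 by move: u1I; rewrite /= in_itv.
have u2I' : 0 < u2 < 1 by move: u2I; rewrite /= in_itv.
have /andP[u10 _] := u1I'; have /andP[_ u21] := u2I'.
have a0 : 0 <= a by have [n _ h] := ha 0%N; exact: (le_trans (q_ge0 n u2) (ltW h)).
pose e := (u2 - u1) / 4.
have e0 : 0 < e by rewrite /e divr_gt0// subr_gt0.
have [k [M [k0 gb ga]]] : exists k M, [/\ 0 <= k, 1 - e <= cut k M b & cut k M a <= e].
  by apply: cutoff_separates => //; rewrite a0.
have [c hc] := cvg_cut M k0.
have ic n : leb.-integrable I01 (EFin \o (cut k M \o q n)).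
  by apply: (@int_q I01 _ 1) => // y y0; exact: cut_abs.
have c1 : c <= e + 1 * (1 - u2).
  apply: (freq_le hc) => N; have [n Nn qa] := ha N; exists n => //.
  have [i2 <-] := int_affine e 1 u2I'.
  apply: le_Rintegral => //; first exact: (ic n).
  move=> u; rewrite /= in_itv/= => /andP[uu0 uu1].
  have /andP[_ g1] := cut_itv M k0 (q_ge0 n u).
  rewrite indicE mul1r; have [h|h] := leP u2 u.
    rewrite mem_set; last by rewrite /tailI /= in_itv/= h.
    by apply: (le_trans g1); rewrite lerDr ltW.
  rewrite memNset; last by rewrite /tailI /= in_itv/= leNgt h.
  rewrite addr0; apply: le_trans ga; apply: cut_nd => //.
  by apply: le_trans (ltW qa); apply: quantile_nd => //; exact: ltW.
have c2 : 0 + (1 - e) * (1 - u1) <= c.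
  apply: (freq_ge hc) => N; have [n Nn qb] := hb N; exists n => //.
  have [i2 <-] := int_affine 0 (1 - e) u1I'.
  apply: le_Rintegral => //; first exact: (ic n).
  move=> u; rewrite /= in_itv/= => /andP[uu0 uu1].
  have /andP[g0 _] := cut_itv M k0 (q_ge0 n u).
  rewrite indicE add0r; have [h|h] := leP u1 u; last first.
    by rewrite memNset ?mulr0//; rewrite /tailI /= in_itv/= leNgt h.
  rewrite mem_set ?mulr1; last by rewrite /tailI /= in_itv/= h.
  apply: (le_trans gb); apply: cut_nd => //; first by rewrite (le_trans a0)// ltW.
  by apply: (le_trans (ltW qb)); apply: quantile_nd.
have := le_trans c2 c1; rewrite leNgt => /negP; apply.
have : e * u1 > 0 by rewrite mulr_gt0.
have : u2 - u1 = 4 * e by rewrite /e; field.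
nra.
Qed.

Let oscil_countable a b : a < b -> countable (oscil a b).
Proof.
move=> ab; have [[u hu]|no] := pselect (exists u, oscil a b u); last first.
  rewrite (_ : oscil a b = set0)//; apply/seteqP; split => // u hu.
  by apply: no; exists u.
rewrite (_ : oscil a b = [set u])//; apply/seteqP; split => [u' hu' /=|_ ->//].
by have [h|h|->//] := ltgtP u u'; [have := oscillation_unique ab hu hu'|
  have := oscillation_unique ab hu' hu].
Qed.

Variable lam : nat -> R.
Hypothesis lam_gt0 : forall k, 0 < lam k.
Hypothesis L_lam : L (lam k) @[k --> \oo] --> (1 : R).

(** If the quantile at [u] exceeds a large [K], the transform at a small argument is at
most about [u], while its limit is close to 1. *)
Lemma quantile_tight u : 0 < u < 1 -> exists K, \forall n \near \oo, q n u <= K.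
Proof.
move=> u01; have /andP[u0 u1] := u01.
have [k _ hk] : \forall k \near \oo, (1 + u) / 2 < L (lam k).
  by apply: (cvgr_gt _ L_lam); lra.
pose l := lam k; have l0 : 0 < l := lam_gt0 k.
have Ll : (1 + u) / 2 < L l by exact: (hk k (leqnn k)).
(* Chosen so that expR (- (l * K)) is at most 1/4. *)
exists (3 / l).
have : \forall n \near \oo, (1 + u) / 2 < \int[leb]_(v in I01) expR (- (l * q n v)).
  exact: (cvgr_gt _ (cvg_exp (ltW l0)) _ Ll).
apply: filterS => n; apply: contraTT; rewrite -ltNge => qK; rewrite -leNgt.
have [i2 e2] := int_affine 1 (- (3 / 4)) u01.
apply: (@le_trans _ _ (1 + - (3 / 4) * (1 - u))); last lra.
rewrite -e2; apply: le_Rintegral => //.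
  apply: (@int_q I01 (fun y => expR (- (l * y))) 1) => //.
  by move=> y y0; apply: exp_le1 => //; exact: ltW.
move=> v; rewrite /= in_itv/= => /andP[v0 v1]; rewrite indicE; have [h|h] := leP u v; last first.
  rewrite memNset; last by rewrite /tailI /= in_itv/= leNgt h.
  rewrite mulr0 addr0; have := exp_le1 (ltW l0) (q_ge0 n v).
  by rewrite ger0_norm ?expR_ge0.
rewrite mem_set ?mulr1; last by rewrite /tailI /= in_itv/= h.
have h3 : 3 <= l * q n v.
  rewrite -ler_pdivrMl// mulrC; apply: (le_trans (ltW qK)).
  by apply: quantile_nd.
apply: (@le_trans _ _ (expR 3)^-1).
  by rewrite -expRN ler_expR lerN2.
rewrite (_ : 1 + _ = 4^-1); last by field.
by rewrite lef_pV2 ?posrE ?expR_gt0//; apply: le_trans (expR_ge1Dx 3); lra.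
Qed.

(** Points where the quantiles oscillate across a rational cell. Outside of this
countable set a bounded sequence of quantiles is eventually confined to two
neighbouring cells of any given mesh. *)
Let badset : set BR := \bigcup_m \bigcup_i oscil (i%:R / m.+1%:R) (i.+1%:R / m.+1%:R).

Let bad_countable : countable badset.
Proof.
apply: bigcup_countable => // m _; apply: bigcup_countable => // i _.
by apply: oscil_countable; rewrite ltr_pM2r ?invr_gt0// ltr_nat.
Qed.

Let good : set BR := I01 `\` badset.

Let quantile_cvg u : good u -> cvg (q n u @[n --> \oo]).
Proof.
move=> [uI ub]; have u01 : 0 < u < 1 by move: uI; rewrite /= in_itv.
have [K hK] := quantile_tight u01.
apply: cauchy_cvg; apply: cauchy_exP => e e0.
pose m := Num.truncn (2 / e); pose D : R := m.+1%:R^-1.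
have D0 : 0 < D by rewrite invr_gt0.
have De : 2 * D < e.
  rewrite /D ltr_pdivrMr// mulrC -ltr_pdivrMr//; exact: truncnS_gt.
pose A i := \forall n \near \oo, i%:R * D <= q n u.
have [i Ai nAi] : exists2 i, A i & ~ A i.+1.
  apply: contrapT => h.
  have hA i : A i.
    elim: i => [|i Ai]; first by apply: nearW => n; rewrite mul0r.
    by apply: contrapT => hi; apply: h; exists i.
  have [i hi] : exists i : nat, K < i%:R * D.
    exists (Num.truncn (K * m.+1%:R)).+1.
    by rewrite -ltr_pdivrMr// /D invrK; exact: truncnS_gt.
  have [N _ hN] : \forall n \near \oo, q n u <= K /\ i%:R * D <= q n u.
    near=> n; split; near: n; [exact: hK|exact: hA].
  have [h1 h2] := hN N (leqnn N).
  by have := lt_le_trans hi (le_trans h2 h1); rewrite ltxx.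
have fr : freq (fun n => q n u < i.+1%:R * D).
  move=> N; apply: contrapT => h; apply: nAi; exists N => // n /= Nn.
  by rewrite leNgt; apply/negP => h'; apply: h; exists n.
have nfr : ~ freq (fun n => i.+2%:R * D < q n u).
  by move=> h; apply: ub; exists m => //; exists i.+1 => //; split.
exists (i%:R * D).
have h2 := not_freq nfr.
suff : \forall n \near \oo, ball (i%:R * D) e (q n u) by [].
near=> n; rewrite /ball /= distrC ger0_norm ?subr_ge0; last by near: n.
have : ~ i.+2%:R * D < q n u by near: n.
move=> /negP; rewrite -leNgt => h3.
apply: le_lt_trans De; rewrite lerBlDl; apply: (le_trans h3).
by rewrite le_eqVlt -!natr1; apply/orP; left; apply/eqP; ring.
Unshelve. all: by end_near. Qed.

Let mgood : measurable good.
Proof. by apply: measurableD => //; exact: countable_measurable. Qed.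

Let good01 : good `<=` I01. Proof. by move=> u []. Qed.

Let leb_good (A : set BR) : measurable A -> leb (A `&` I01) = leb (A `&` good).
Proof.
move=> mA; have mAI : measurable (A `&` I01) by exact: measurableI.
have e := @measureDI _ BR R leb _ _ mAI mgood.
rewrite e [X in (X + _)%E](_ : _ = 0%E) ?add0e.
  by rewrite -setIA (setIidr good01).
apply: countable_lebesgue_measure0; apply: sub_countable bad_countable.
apply: subset_card_le => u [[_ uI] ng]; apply: contrapT => nb; apply: ng; split => //.
Qed.

(** The quantile functions converge almost everywhere on the unit interval, so
integrals of bounded continuous functions converge by dominated convergence; the
limit measure is the image of Lebesgue measure under the limit quantile function.
The behaviour of [L] at 0 is required only along one sequence. *)
Theorem laplace_continuity : exists mu : probability BR R, mu Rge0 = 1%E /\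
  forall f : R -> R, {within `[0, +oo[, continuous f} ->
    (exists M, forall y, 0 <= y -> `|f y| <= M) ->
    \int[nu_ n]_(y in `[0, +oo[) f y @[n --> \oo] --> \int[mu]_(y in `[0, +oo[) f y.
Proof.
(* The value 0 off the good set makes the limit measurable everywhere. *)
pose ql : BR -> BR := (fun u => limn (fun n => q n u) : R) \_ good.
have qlE u : good u -> q n u @[n --> \oo] --> (ql u : R).
  by move=> gu; rewrite /ql patchE mem_set//; exact: quantile_cvg.
have ql0 u : 0 <= ql u.
  rewrite /ql patchE; case: ifPn => // /[!inE] gu.
  by apply: limr_ge; [exact: quantile_cvg|exact: nearW].
have mql : measurable_fun setT ql.
  apply/(measurable_restrictT _ mgood).
  apply: (@measurable_fun_cvg _ BR R good (fun n => q n)) => //.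
  by move=> n; apply: measurable_funTS; exact: mq.
pose U : {measure set BR -> \bar R} := mrestr leb mgood.
pose W : {measure set BR -> \bar R} :=
  measure_function_pushforward__canonical__measure_function_Measure U mql.
have WT : W setT = 1%E.
  by rewrite /W /= /pushforward /= /mrestr preimage_setT -leb_good// setTI leb01.
pose mu : probability BR R := HB.pack (W : set BR -> \bar R) W
  (Measure_isProbability.Build _ _ _ W WT).
have muE A : measurable A -> mu A = leb (ql @^-1` A `&` good) by [].
have leb_fin : (leb good < +oo)%E.
  apply: (@le_lt_trans _ _ (leb I01)); last by rewrite leb01 ltry.
  by apply: le_measure; rewrite ?inE.
exists mu; split.
  rewrite muE; last exact: measurable_itv.
  rewrite (_ : _ @^-1` _ = setT).
    by rewrite -leb_good// setTI leb01.
  by apply/seteqP; split => u //= _; rewrite in_itv/= andbT.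
move=> f cf [M fM]; pose g (y : BR) : R := f (Num.max 0 y).
have cg : continuous (g : R -> R) by exact: clamped_continuous.
have mg : measurable_fun setT g by exact: continuous_measurable_fun.
have gM y : `|g y| <= M by apply: fM; rewrite le_max lexx.
have fg (m : {measure set BR -> \bar R}) :
    \int[m]_(y in `[0, +oo[) f y = \int[m]_(y in `[0, +oo[) g y.
  apply: eq_Rintegral => y; rewrite inE /= in_itv/= andbT => y0.
  by rewrite /g (max_idPr y0).
have e1 n : \int[nu_ n]_(y in `[0, +oo[) f y = \int[leb]_(u in good) g (q n u).
  rewrite fg; have [] := @Rintegral_pushforward_restr R good mgood _ (mq n) g M (nu_ n) => //.
  by move=> A mA; rewrite (quantile_law (nu1 n) (nu0 n) mA) leb_good// -[_ @^-1` _]setTI; exact: mq.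
have [_ e2] := @Rintegral_pushforward_restr R good mgood _ mql g M mu leb_fin muE
  (fun u _ => ql0 u) mg gM.
rewrite (fg mu) e2 (eq_fun e1).
have [||||_ hc] := @Rdominated_cvg _ BR R leb good mgood (fun n => g \o q n) (g \o ql) (cst M).
- by move=> n; apply: measurable_funTS; exact: measurableT_comp.
- by move=> u gu; apply: (cvg_comp _ _ (qlE u gu)); exact: cg.
- by apply: (int_bounded (M := `|M|)).
- by move=> n u _; exact: gM.
- exact: hc.
Qed.

End Laplace_continuity.

(** * Integrals over the negative half-line *)

Section Half_line.
Context {R : realType}.
Local Notation leb := (@lebesgue_measure R).
Variable g : R -> R.
Hypothesis g0 : forall s, s <= 0 -> 0 <= g s.
Hypothesis ig : forall t, 0 < t -> leb.-integrable `[- t, 0] (EFin \o g).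

Let D := `]-oo, 0%R]%classic : set R.

Let mD : measurable D. Proof. exact: measurable_itv. Qed.

Lemma measurable_half_line : measurable_fun D (EFin \o g).
Proof.
have -> : D = \bigcup_k `[- k.+1%:R, 0]%classic.
  apply/seteqP; split => s; rewrite /D /= in_itv/=.
    move=> s0; exists (Num.truncn (- s)) => //=; rewrite in_itv/= s0 andbT.
    by rewrite lerNl ltW// truncnS_gt.
  by move=> [k _]; rewrite /= in_itv/= => /andP[].
apply/measurable_fun_bigcup => // k.
by have /integrableP[] := ig (ltr0Sn R k).
Qed.

Let EE t : 0 < t -> (\int[leb]_(s in `[- t, 0]) g s)%:E =
  (\int[leb]_(s in `[(- t)%R, 0%R]) (g s)%:E)%E.
Proof. by move=> t0; rewrite fineK//; apply: integrable_fin_num => //; exact: ig. Qed.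

Lemma half_line_integral_le (t : R) : 0 < t ->
  ((\int[leb]_(s in `[- t, 0]) g s)%:E <= \int[leb]_(s in `]-oo, 0%R]) (g s)%:E)%E.
Proof.
move=> t0; rewrite EE//; have mg := measurable_half_line; apply: ge0_subset_integral => //.
by move=> s; rewrite /= !in_itv/= => /andP[].
Qed.

Lemma half_line_integral_cvg (u_ : nat -> R) : u_ @ \oo --> +oo ->
  (\int[leb]_(s in `[- u_ k, 0]) g s)%:E @[k --> \oo] -->
  (\int[leb]_(s in `]-oo, 0%R]) (g s)%:E)%E.
Proof.
move=> uoo.
pose E (t : R) := (\int[leb]_(s in `[(- t)%R, 0%R]) (g s)%:E)%E.
have mI (t : R) : measurable (`[- t, 0]%classic : set R) by exact: measurable_itv.
have mg := measurable_half_line.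
have E_le (t t' : R) : t <= t' -> (E t <= E t')%E.
  move=> tt'; apply: ge0_subset_integral => //.
  - by apply: measurable_funS mg => // s /=; rewrite /D /= !in_itv/= => /andP[].
  - by move=> s; rewrite /= in_itv/= => /andP[_ s0]; rewrite lee_fin g0.
  - by move=> s; rewrite /= !in_itv/= => /andP[h ->]; rewrite andbT (le_trans _ h)// lerN2.
have EI : E k.+1%:R @[k --> \oo] --> (\int[leb]_(s in D) (g s)%:E)%E.
  pose G k := (EFin \o g) \_ `[- k.+1%:R, 0].
  have GE k : E k.+1%:R = (\int[leb]_(s in D) G k s)%E.
    rewrite -integral_mkcondr; congr (integral _ _ _).
    by apply/seteqP; split => s; rewrite /D /= !in_itv/=; [move=> /andP[? ->]; rewrite andbT|case].
  have G1 s : D s -> G k s @[k --> \oo] --> (g s)%:E.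
    rewrite /D /= in_itv/= => s0; apply: cvg_near_cst.
    exists (Num.truncn (- s)) => // k /= hk; rewrite /G patchE mem_set//= in_itv/= s0 andbT.
    rewrite lerNl ltW//; apply: (lt_le_trans (truncnS_gt _)).
    by rewrite ler_nat ltnS.
  rewrite (eq_fun GE).
  have -> : (\int[leb]_(s in D) (g s)%:E = \int[leb]_(s in D) limn (G ^~ s))%E.
    by apply: eq_integral => s; rewrite inE => Ds; apply/esym/cvg_lim => //; exact: G1.
  apply: cvg_monotone_convergence => //.
  - move=> k; apply: measurable_funS (measurableT) _ _ => //.
    apply/(measurable_restrictT _ (mI _)).
    by have /integrableP[] := ig (ltr0Sn R k).
  - move=> k s; rewrite /D /= in_itv/= => s0; rewrite /G patchE.
    by case: ifP => // _; rewrite lee_fin g0.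
  - move=> s; rewrite /D /= in_itv/= => s0 k k' kk'; rewrite /G !patchE.
    case: ifPn => [|_]; last by case: ifP => // _; rewrite lee_fin g0.
    rewrite inE /= in_itv/= => /andP[h _]; rewrite mem_set//= in_itv/= s0 andbT.
    by apply: le_trans h; rewrite lerN2 ler_nat ltnS.
pose m_ n := Num.truncn (u_ n - 1).
have moo : m_ @ \oo --> \oo.
  apply/cvgnyPge => A; move/cvgryPge : uoo => /(_ (A%:R + 1)); apply: filterS => n hn.
  have h1 : 0 <= u_ n - 1 by rewrite subr_ge0 (le_trans _ hn)// lerDr.
  by rewrite /m_ truncn_ge_nat// lerBrDr.
have u1 : \forall n \near \oo, 1 <= u_ n by move/cvgryPge : uoo; exact.
apply: (@squeeze_cvge _ _ _ _ (fun n => E (m_ n).+1%:R) _ (fun=> \int[leb]_(s in D) (g s)%:E)%E).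
- apply: filterS u1 => n un; rewrite half_line_integral_le ?(lt_le_trans _ un)// andbT EE ?(lt_le_trans _ un)//.
  apply: E_le; rewrite -natr1 -lerBrDr truncn_le subr_ge0//.
- exact: (cvg_comp _ _ moo EI).
- exact: cvg_cst.
Qed.

Lemma unit_interval_split N : \int[leb]_(s in `[- N%:R, 0]) g s =
  \sum_(k < N) \int[leb]_(s in `[- k.+1%:R, - k%:R]) g s.
Proof.
elim: N => [|N IH]; first by rewrite big_ord0 oppr0 set_itv1 Rintegral_set1.
rewrite big_ord_recr/= -IH addrC.
have h1 : - N.+1%:R <= - N%:R :> R by rewrite lerN2 ler_nat.
have h2 : - N%:R <= 0 :> R by rewrite oppr_le0.
exact: (integral_split (ig (ltr0Sn R N)) (lexx _) h1 h2 (lexx _)).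
Qed.

Let iunit k : leb.-integrable `[- k.+1%:R, - k%:R] (EFin \o g).
Proof. by apply: (igS (ig (ltr0Sn R k)) (lexx _)); rewrite oppr_le0. Qed.

Let icst k (y : R) : leb.-integrable `[- k.+1%:R, - k%:R] (EFin \o cst y) /\
  \int[leb]_(s in `[- k.+1%:R, - k%:R]) cst y s = y.
Proof.
have e : leb (`[- k.+1%:R, - k%:R]%classic : set R) = 1%E.
  rewrite lebesgue_measure_itv/= lte_fin ltrN2 ltr_nat ltnSn -EFinB.
  by congr (_%:E); rewrite -natr1; ring.
split.
  apply: measurable_bounded_integrable => //.
  - by rewrite [X in (X < _)%E]e ltry.
  - by exists `|y|; split; [exact: num_real|move=> z yz s _; exact: ltW].
apply: (etrans (@Rintegral_cst _ _ _ leb (`[- k.+1%:R, - k%:R]%classic : set R) (measurable_itv _) y)).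
by apply: (etrans (congr1 (fun z => y * fine z) e)); exact: mulr1.
Qed.

Lemma half_line_sum_le (B : nat -> R) N :
  (forall k s, - k.+1%:R <= s <= - k%:R -> g s <= B k) ->
  \int[leb]_(s in `[- N%:R, 0]) g s <= \sum_(k < N) B k.
Proof.
move=> gB; rewrite unit_interval_split; apply: ler_sum => k _.
have [i1 <-] := icst k (B k); apply: le_Rintegral => // s.
by rewrite /= in_itv/=; exact: gB.
Qed.

Lemma half_line_sum_ge (B : nat -> R) N :
  (forall k s, - k.+1%:R <= s <= - k%:R -> B k <= g s) ->
  \sum_(k < N) B k <= \int[leb]_(s in `[- N%:R, 0]) g s.
Proof.
move=> gB; rewrite unit_interval_split; apply: ler_sum => k _.
have [i1 <-] := icst k (B k); apply: le_Rintegral => // s.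
by rewrite /= in_itv/=; exact: gB.
Qed.

End Half_line.

(** The limit [I] may be infinite, in which case both sides are 0. *)
Lemma expR_neg_cvg (R : realType) (c_ : nat -> R) (I : \bar R) :
  (c_ n)%:E @[n --> \oo] --> I -> (0 <= I)%E ->
  expR (- c_ n) @[n --> \oo] --> fine (expeR (- I)).
Proof.
case: I => [r h _|h _|//].
  have h' : c_ @ \oo --> r by exact: (fine_cvg h).
  exact: (cvg_comp _ _ (cvgN h') (@continuous_expR R (- r))).
have h' : c_ @ \oo --> +oo by apply/cvgeryP.
exact: (cvg_comp _ _ h' (@cvgr_expR R)).
Qed.

(** * Bounded convergence and growth of the two-sided path *)

Section Bounded_convergence.
Context {d : measure_display} {T : measurableType d} {R : realType}.
Variable P : probability T R.

Lemma integrable_unit (f : T -> R) : measurable_fun setT f ->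
  (forall w, 0 <= f w <= 1) -> P.-integrable setT (EFin \o f).
Proof.
move=> mf f01; have i1 := finite_measure_integrable_cst P (1 : R) measurableT.
apply: (Rintegrable_le measurableT mf i1) => w _; have /andP[h0 h1] := f01 w.
by rewrite ger0_norm.
Qed.

Lemma Rintegral_unit (f : T -> R) : measurable_fun setT f ->
  (forall w, 0 <= f w <= 1) -> (\int[P]_w (f w)%:E)%E = (\int[P]_w f w)%:E.
Proof.
by move=> mf f01; rewrite fineK//; apply: integrable_fin_num => //; exact: integrable_unit.
Qed.

Lemma bounded_cvg_ae (f_ : nat -> T -> R) (f : T -> R) :
  (forall n, measurable_fun setT (f_ n)) -> measurable_fun setT f ->
  (forall n w, 0 <= f_ n w <= 1) ->
  {ae P, forall w, f_ n w @[n --> \oo] --> f w} ->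
  \int[P]_w f_ n w @[n --> \oo] --> \int[P]_w f w.
Proof.
move=> mf_ mf f01 cf; have i1 := finite_measure_integrable_cst P (1 : R) measurableT.
have [] := @dominated_convergence _ _ _ P setT measurableT (fun n => EFin \o f_ n)
  (EFin \o f) (cst 1%:E).
- by move=> n; exact/measurable_EFinP.
- exact/measurable_EFinP.
- by apply: filterS cf => w h _; apply: cvg_EFin; [exact: nearW|exact: h].
- exact: i1.
- apply: aeW => w n _ /=; have /andP[h0 h1] := f01 n w.
  by rewrite lee_fin ger0_norm.
move=> intf _ cv; rewrite /Rintegral.
by apply: fine_cvg; rewrite fineK//; exact: integrable_fin_num.
Qed.

Lemma ae_of_small (G : T -> Prop) : (forall e : R, 0 < e -> exists A : set T,
  [/\ measurable A, (P (~` A) <= e%:E)%E & forall w, A w -> G w]) -> {ae P, forall w, G w}.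
Proof.
move=> h.
have /choice[A hA] : forall k : nat, exists A : set T,
    [/\ measurable A, (P (~` A) <= (k.+1%:R^-1)%:E)%E & forall w, A w -> G w].
  by move=> k; apply: h; rewrite invr_gt0.
exists (\bigcap_k ~` A k); split.
- by apply: bigcapT_measurable => k; apply: measurableC; have [] := hA k.
- apply/eqP; rewrite eq_le measure_ge0 andbT.
  apply/lee_addgt0Pr => e e0; rewrite add0e.
  have [mA PA _] := hA (Num.truncn e^-1).
  apply: (@le_trans _ _ (P (~` A (Num.truncn e^-1)))).
    apply: le_measure; rewrite ?inE; last exact: bigcap_inf.
      by apply: bigcapT_measurable => k; apply: measurableC; have [] := hA k.
    exact: measurableC.
  apply: (le_trans PA); rewrite lee_fin -[leRHS]invrK lef_pV2 ?posrE ?invr_gt0//.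
  by rewrite ltW// truncnS_gt.
- by move=> w nG k _ Aw; apply: nG; have [_ _] := hA k; apply.
Qed.

End Bounded_convergence.

Section Two_sided_growth.
Context {d : measure_display} {T : measurableType d} {R : realType}.
Local Notation BR := (measurableTypeR R).
Variables (P : probability T R) (xi xi' : R -> T -> BR).
Hypothesis hxi : levy_process P xi.
Hypothesis hxi' : independent_copy P xi xi'.
Variable a1 : R.
Hypothesis ixi : P.-integrable setT (EFin \o (xi 1 : T -> R)).
Hypothesis Exi : (\int[P]_w (xi 1 w)%:E)%E = a1%:E.

Let levy' : levy_process P xi'. Proof. by case: hxi'. Qed.
Let xi0 w : xi 0 w = 0. Proof. by case: hxi => _ + _ _ _; apply. Qed.
Let cxi' w : cadlag (xi' ^~ w). Proof. by case: levy' => _ _ + _ _; apply. Qed.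

Lemma copy_mean : P.-integrable setT (EFin \o (xi' 1 : T -> R)) /\
  (\int[P]_w (xi' 1 w)%:E)%E = a1%:E.
Proof.
have m1 : measurable_fun setT (xi 1) by case: hxi => + _ _ _ _; apply.
have m1' : measurable_fun setT (xi' 1) by case: levy' => + _ _ _ _; apply.
have hC (C : set BR) : measurable C -> P (xi 1 @^-1` C) = P (xi' 1 @^-1` C).
  move=> mC; case: hxi' => _ sl _.
  have := sl 1%N (fun=> 1) (fun=> C) (fun=> ler01) (fun=> mC).
  by rewrite !bigcap_mkord !big_ord1.
have law (F : BR -> \bar R) : measurable_fun setT F -> (forall y, (0 <= F y)%E) ->
  (\int[P]_w F (xi 1 w) = \int[P]_w F (xi' 1 w))%E by exact: law_expectation.
split.
  apply/integrableP; split; first exact/measurable_EFinP.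
  have /integrableP[_] := ixi; rewrite (law (fun y => `|y%:E|%E))//.
  by apply: measurableT_comp => //; exact: measurable_EFinP.
rewrite -Exi integralE [RHS]integralE; congr (_ - _)%E; apply/esym.
  rewrite unlock.
  apply: (law (fun y : BR => maxe y%:E 0%E)) => [|y]; last by rewrite le_max lexx orbT.
  by apply: measurable_maxe => //; exact: measurable_EFin.
rewrite unlock.
apply: (law (fun y : BR => maxe (- y%:E)%E 0%E)) => [|y]; last by rewrite le_max lexx orbT.
apply: measurable_maxe => //; apply: measurableT_comp => //; exact: measurable_EFin.
Qed.

(** For [k = 1] this is an upper bound and for [k = -1] a lower bound on the
increments of the two-sided path up to time 0; both follow from the supremum of the
Lévy process [k * xi' s - C * s], whose drift is negative. *)
Lemma past_growth (k C e : R) : k * a1 < C -> 0 < e -> exists K (A : set T),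
  [/\ measurable A, (P (~` A) <= e%:E)%E & forall w, A w -> forall s, s <= 0 ->
    k * (two_sided xi xi' 0 w - two_sided xi xi' s w) <= K - C * s].
Proof.
move=> kC e0; have [i1 E1] := copy_mean.
have lZ := levy_affine k C levy'.
set Z := (fun s w => _ : BR) in lZ.
have iC := finite_measure_integrable_cst P C measurableT.
have ik : P.-integrable setT (EFin \o (fun w => k * (xi' 1 w : R))) by exact: RintegrableZ.
have iZ : P.-integrable setT (EFin \o (Z 1 : T -> R)).
  by rewrite /Z mulr1; exact: (RintegrableB measurableT ik iC).
have EZ : (\int[P]_w (Z 1 w)%:E < 0)%E.
  rewrite [X in (X < _)%E](_ : _ = (k * a1 - C)%:E) ?lte_fin ?subr_lt0//.
  have := @integralB _ _ _ P setT measurableT _ _ ik iC.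
  have e3 : (\int[P]_w (EFin \o cst C) w)%E = C%:E.
    apply: (etrans (@integral_cst _ _ _ P setT measurableT C%:E)).
    apply: (etrans (congr1 (fun z => C%:E * z)%E (probability_setT P))); exact: mule1.
  have e4 : (\int[P]_w (EFin \o (fun w => k * (xi' 1 w : R))%R) w)%E = (k * a1)%:E.
    have := @integralZl _ _ _ P setT measurableT _ i1 k.
    by rewrite E1 -EFinM => <-.
  rewrite e3 e4 -EFinB => <-; rewrite /Z mulr1; by [].
have [K [A [mA PA hA]]] := levy_sup_bounded lZ iZ EZ e0.
exists K, A; split => // w Aw s; rewrite le_eqVlt => /predU1P[->|s0].
  by rewrite subrr mulr0 mulr0 subr0; have := hA w Aw 0 (lexx 0); rewrite /Z mulr0 subr0;
    case: levy' => _ -> _ _ _; rewrite mulr0.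
rewrite two_sided_nneg// xi0 sub0r two_sided_neg// opprK.
have ns : 0 < - s by lra.
have cl := left_limit_cvg (cxi' w) ns.
have c2 : k * (xi' q w : R) - C * q @[q --> (- s)^'-] --> k * left_limit (xi' ^~ w) (- s) - C * (- s).
  apply: cvgB; first by apply: cvgM; [exact: cvg_cst|exact: cl].
  apply: cvgM; first exact: cvg_cst.
  by apply: cvg_at_left_filter; exact: cvg_id.
suff : k * left_limit (xi' ^~ w) (- s) - C * - s <= K by lra.
rewrite -(cvg_lim _ c2)//; apply: limr_le; first by apply/cvg_ex; eexists; exact: c2.
exists (- s) => // q /=; rewrite ltr_norml => /andP[_ h1] _.
by apply: (hA w Aw q); lra.
Qed.

End Two_sided_growth.

(** * The stationary cost *)

Section Stationary_cost.
Context {d : measure_display} {T : measurableType d} {R : realType}.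
Local Notation BR := (measurableTypeR R).
Local Notation leb := (@lebesgue_measure R).
Variable P : probability T R.
Variables (b c : R) (m : {measure set BR -> \bar R}).
Hypothesis hm : branching_mechanism c m.
Variables (h : R) (n : {measure set BR -> \bar R}).
Hypothesis hn : immigration_mechanism h n.
Variables (xi xi' : R -> T -> BR).
Hypothesis hxi : levy_process P xi.
Hypothesis hxi' : independent_copy P xi xi'.
Variable v : T -> R -> R -> R -> R.
Hypothesis hv : forall w t l, 0 <= l ->
  positive_solution (phi b c m) (two_sided xi xi' ^~ w) t l (fun r => v w r t l).
Variable a1 : R.
Hypothesis ixi : P.-integrable setT (EFin \o (xi 1 : T -> R)).
Hypothesis Exi : (\int[P]_w (xi 1 w)%:E)%E = a1%:E.
Hypothesis hab : a1 < b.

Local Notation psin := (psi h n).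
Local Notation cost := (backward_cost psin v).

Let flip K : 1 <= K -> exists2 L, 0 <= L &
  forall z z', 0 <= z <= K -> 0 <= z' <= K -> `|phi b c m z - phi b c m z'| <= L * `|z - z'|.
Proof.
move=> K1; exists (phi_lip b c m K); first by apply: phi_lip_ge0 => //; exact: le_trans K1.
by move=> z z' zK z'K; exact: phi_lipschitz.
Qed.

Let p_cvg (z_ : nat -> R) z : (forall k, 0 <= z_ k) ->
  z_ @ \oo --> z -> psin \o z_ @ \oo --> psin z.
Proof. by move=> z0 cz; exact: psi_cvg. Qed.

Lemma measurable_cost r t l x0 : r < t -> 0 <= l -> measurable_fun setT (cost r t l x0 : T -> BR).
Proof.
move=> rt l0; apply: (measurable_backward_cost hxi hxi' (phi_ge b hm) (phi0 b c m) flip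
  (measurable_phi_pos b hm) (psi_ge0 hn) (psi_le hn) p_cvg (measurable_psi_pos hn) hv) => //.
Qed.

Let icost r t l w : r < t -> 0 <= l ->
  leb.-integrable `[r, t] (EFin \o (fun s => psin (v w s t l))).
Proof.
move=> rt l0; apply: (cost_integrable_itv hxi hxi' (phi_ge b hm) (phi0 b c m) flip
  (psi_ge0 hn) (psi_le hn) p_cvg hv) => //.
Qed.

Let v_ge0 w r t l : 0 <= l -> r <= t -> 0 <= v w r t l.
Proof. by move=> l0 rt; have [] := hv w l0 rt. Qed.

Let psiv_ge0 w r t l : 0 <= l -> r <= t -> 0 <= psin (v w r t l).
Proof. by move=> l0 rt; apply: psi_ge0 => //; exact: v_ge0. Qed.

Lemma backward_cost_ge0 r t l x0 w : 0 <= l -> 0 <= x0 -> r <= t -> 0 <= cost r t l x0 w.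
Proof.
move=> l0 x00 rt; apply: addr_ge0; first by rewrite mulr_ge0// v_ge0.
by apply: Rintegral_ge0 => s /=; rewrite in_itv/= => /andP[_ st]; exact: psiv_ge0.
Qed.

Let expcost01 r t l x0 w : 0 <= l -> 0 <= x0 -> r <= t -> 0 <= expR (- cost r t l x0 w) <= 1.
Proof.
by move=> l0 x00 rt; rewrite expR_ge0 expR_le1 oppr_le0 backward_cost_ge0.
Qed.

Definition total_cost (l : R) (w : T) : \bar R :=
  (\int[leb]_(s in `]-oo, 0%R]) (psin (v w s 0%R l))%:E)%E.

Definition discount (l : R) (w : T) : R := fine (expeR (- total_cost l w)).

Lemma total_cost_ge0 l w : 0 <= l -> (0 <= total_cost l w)%E.
Proof.
move=> l0; apply: integral_ge0 => s /=; rewrite in_itv/= => s0.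
by rewrite lee_fin psiv_ge0.
Qed.

Lemma discountE l w : 0 <= l -> expeR (- total_cost l w) = (discount l w)%:E.
Proof.
move=> l0; rewrite /discount; have := total_cost_ge0 w l0.
by case: (total_cost l w) => [r _|_|].
Qed.

Lemma discount_itv l w : 0 <= l -> 0 <= discount l w <= 1.
Proof.
move=> l0; rewrite -!lee_fin -discountE// expeR_ge0 -expeR0 lee_expeR.
by rewrite oppe_le0 total_cost_ge0.
Qed.

Lemma past_cost_cvg (u_ : nat -> R) l w : 0 <= l -> u_ @ \oo --> +oo ->
  (cost (- u_ k) 0 l 0 w)%:E @[k --> \oo] --> total_cost l w.
Proof.
move=> l0 uoo.
have g0 s : s <= 0 -> 0 <= psin (v w s 0 l) by exact: psiv_ge0.
have ig t : 0 < t -> leb.-integrable `[- t, 0] (EFin \o (fun s => psin (v w s 0 l))).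
  by move=> t0; apply: icost => //; rewrite oppr_lt0.
apply: cvg_trans (half_line_integral_cvg g0 ig uoo).
apply: near_eq_cvg; apply: nearW => k.
by rewrite /backward_cost mul0r add0r.
Qed.

Lemma discount_cvg (u_ : nat -> R) l w : 0 <= l -> u_ @ \oo --> +oo ->
  expR (- cost (- u_ k) 0 l 0 w) @[k --> \oo] --> discount l w.
Proof.
by move=> l0 uoo; apply: expR_neg_cvg; [exact: past_cost_cvg|exact: total_cost_ge0].
Qed.

Let natoo : (fun k => k.+1%:R : R) @ \oo --> +oo.
Proof.
apply/cvgryPge => A; exists (Num.truncn A) => // k /= kA.
rewrite ltW//; apply: (lt_le_trans (truncnS_gt _)).
by rewrite ler_nat ltnS.
Qed.

Lemma measurable_discount l : 0 <= l -> measurable_fun setT (discount l : T -> R).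
Proof.
move=> l0; apply: (@measurable_fun_cvg _ _ _ _ (fun k w => expR (- cost (- k.+1%:R) 0 l 0 w))).
  by move=> k; do 2 apply: measurableT_comp => //; apply: measurable_cost => //; rewrite oppr_lt0.
by move=> w _; exact: discount_cvg.
Qed.

Definition limit_laplace (l : R) : R := \int[P]_w discount l w.

Let eps := (b - a1) / 2.

Let eps0 : 0 < eps. Proof. by rewrite /eps divr_gt0// subr_gt0. Qed.

(** The slack between [b] and [a1] is shared: growth of the path is controlled at rate
[b - eps], which leaves exponential decay of the solution at rate [eps]. *)
Lemma past_decay (e : R) : 0 < e -> exists K (A : set T),
  [/\ measurable A, (P (~` A) <= e%:E)%E & forall w, A w ->
    forall s l, s <= 0 -> 0 <= l -> v w s 0 l <= l * expR (K + eps * s)].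
Proof.
move=> e0; have kC : 1 * a1 < b - eps.
  have e1 : b - eps - a1 = eps by rewrite /eps; field.
  by rewrite mul1r -subr_gt0 e1; exact: eps0.
have [K [A [mA PA hA]]] := past_growth hxi hxi' ixi Exi kC e0.
exists K, A; split => // w Aw s l s0 l0.
have s00 : s <= s <= 0 by rewrite lexx.
have h1 := sol_upper s0 (hv w l0) (phi_ge b hm) s00; rewrite /= in h1.
apply: (le_trans h1).
rewrite ler_wpM2l// ler_expR.
have hs := hA w Aw s s0; rewrite mul1r in hs.
apply: (@le_trans _ _ (K - (b - eps) * s - b * (0 - s))); first by rewrite lerD2r.
by rewrite le_eqVlt; apply/orP; left; apply/eqP; ring.
Qed.

Lemma ae_decay : {ae P, forall w, exists K, forall s l, s <= 0 -> 0 <= l ->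
  v w s 0 l <= l * expR (K + eps * s)}.
Proof.
apply: ae_of_small => e e0; have [K [A [mA PA hA]]] := past_decay e0.
by exists A; split => // w Aw; exists K; exact: hA.
Qed.

(** After time reversal the integrand is a product: [expR (- (x * v))] with [v] taken at
time [- u_ k], which tends to 1 by exponential decay, times the discount over
[[- u_ k, 0]], which tends to the stationary one. *)
Lemma expectation_cvg (u_ : nat -> R) l x : (forall k, 0 < u_ k) -> u_ @ \oo --> +oo ->
  0 <= l -> 0 <= x ->
  \int[P]_w expR (- cost 0 (u_ k) l x w) @[k --> \oo] --> limit_laplace l.
Proof.
move=> u0 uoo l0 x0.
have nu0 k : - u_ k < 0 by rewrite oppr_lt0.
have rev k : \int[P]_w expR (- cost 0 (u_ k) l x w) = \int[P]_w expR (- cost (- u_ k) 0 l x w).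
  apply: (expectation_reversal hxi hxi' (phi_ge b hm) (phi0 b c m) flip
    (measurable_phi_pos b hm) (psi_ge0 hn) (psi_le hn) p_cvg (measurable_psi_pos hn) hv) => //.
rewrite [X in X @ \oo](funext rev).
apply: bounded_cvg_ae.
- by move=> k; do 2 apply: measurableT_comp => //; exact: measurable_cost.
- exact: measurable_discount.
- by move=> k w; apply: expcost01 => //; exact: ltW.
apply: filterS ae_decay => w [K hK].
have v0 : x * v w (- u_ k) 0 l @[k --> \oo] --> (0 : R).
  have e1 : x * (l * expR (K + - (eps * u_ k))) @[k --> \oo] --> (0 : R).
    have c1 : eps * u_ k @[k --> \oo] --> +oo.
      apply/cvgryPge => A; move/cvgryPge : uoo => /(_ (A / eps)); apply: filterS => k.
      by rewrite ler_pdivrMr// mulrC.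
    have c2 := cvg_comp _ _ c1 (@cvgr_expR R).
    have c3 : x * (l * (expR K * expR (- (eps * u_ k)))) @[k --> \oo] --> x * (l * (expR K * 0)).
      by do 3 (apply: cvgM; first exact: cvg_cst).
    rewrite !mulr0 in c3; apply: cvg_trans c3; apply: near_eq_cvg; apply: nearW => k.
    by rewrite (expRD K).
  apply: (squeeze_cvgr _ (cvg_cst 0) e1); apply: nearW => k.
  rewrite mulr_ge0 ?v_ge0 ?(ltW (nu0 k))//= ler_wpM2l//.
  by have := hK (- u_ k) l (ltW (nu0 k)) l0; rewrite mulrN.
have e1 k : expR (- cost (- u_ k) 0 l x w) =
    expR (- (x * v w (- u_ k) 0 l)) * expR (- cost (- u_ k) 0 l 0 w).
  by rewrite -expRD /backward_cost mul0r add0r opprD.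
rewrite [X in X @ \oo](funext e1) -[X in _ --> X]mul1r.
apply: cvgM; last exact: discount_cvg.
rewrite -[X in _ --> X](_ : expR (- 0) = 1); last by rewrite oppr0 expR0.
exact: (cvg_comp _ _ (cvgN v0) (@continuous_expR R (- 0))).
Qed.

Let q := expR (- eps).

Let q01 : 0 < q < 1.
Proof. by rewrite /q expR_gt0 expR_lt1 oppr_lt0 eps0. Qed.

(** On the unit interval [[- (k + 1), - k]] the solution is at most
[q ^+ k * (l * expR K)]. *)
Lemma past_cost_le_potential (hlog : log_moment n) :
  {ae P, forall w, exists K, forall l, 0 <= l ->
    (total_cost l w <= (psi_potential h n q (l * expR K))%:E)%E}.
Proof.
have /andP[q0 q1] := q01.
apply: filterS ae_decay => w [K hK]; exists K => l l0.
have lK0 : 0 <= l * expR K by rewrite mulr_ge0// expR_ge0.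
have cc := @past_cost_cvg _ l w l0 natoo.
rewrite -(cvg_lim _ cc)//; apply: lime_le; first by apply/cvg_ex; eexists; exact: cc.
apply: nearW => N; rewrite lee_fin /backward_cost mul0r add0r.
have ig t : 0 < t -> leb.-integrable `[- t, 0] (EFin \o (fun s => psin (v w s 0 l))).
  by move=> t0; apply: icost => //; rewrite oppr_lt0.
apply: le_trans (sum_psi_le_potential hn N.+1 hlog q01 lK0).
apply: (half_line_sum_le ig (B := fun k => psin (q ^+ k * (l * expR K)))) => k s /andP[_ sk].
have s0 : s <= 0 by apply: (le_trans sk); rewrite oppr_le0.
apply: psi_le => //; first exact: v_ge0.
apply: (le_trans (hK s l s0 l0)).
rewrite expRD /q -expRM_natl mulrA mulrC ler_wpM2r// ler_expR.
by rewrite mulrN -mulNr mulrC ler_wpM2r// ltW.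
Qed.

Lemma limit_laplace_cvg1 : log_moment n -> limit_laplace (q ^+ j) @[j --> \oo] --> (1 : R).
Proof.
move=> hlog; have /andP[q0 q1] := q01.
have qj0 j : 0 <= q ^+ j by rewrite exprn_ge0// ltW.
have e1 : \int[P]_w cst (1 : R) w = 1.
  apply: (etrans (@Rintegral_cst _ _ _ P setT measurableT 1)).
  by apply: (etrans (congr1 (fun z => 1 * fine z) (probability_setT P))); exact: mulr1.
rewrite -[X in _ --> X]e1.
apply: (@bounded_cvg_ae _ _ _ P (fun j => discount (q ^+ j)) (cst 1)) => //.
- by move=> j; exact: measurable_discount.
- by move=> j w; exact: discount_itv.
apply: filterS (past_cost_le_potential hlog) => w [K hK].
have K0 : 0 <= expR K by exact: expR_ge0.
have c1 := psi_potential_cvg0 hn hlog q01 K0.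
have c2 : expR (- psi_potential h n q (q ^+ j * expR K)) @[j --> \oo] --> (1 : R).
  rewrite -[X in _ --> X](_ : expR (- 0) = 1); last by rewrite oppr0 expR0.
  exact: (cvg_comp _ _ (cvgN c1) (@continuous_expR R (- 0))).
suff : discount (q ^+ j) w @[j --> \oo] --> (1 : R) by [].
apply: (squeeze_cvgr _ c2 (cvg_cst (1 : R))); apply: nearW => j.
have /andP[_ ->] := discount_itv w (qj0 j); rewrite andbT.
rewrite -lee_fin -discountE//.
have : (expeR (- (psi_potential h n q (q ^+ j * expR K))%:E) <= expeR (- total_cost (q ^+ j) w))%E.
  by rewrite lee_expeR leeN2; exact: hK.
by [].
Qed.

(** With probability at least 3/4 the path stays between two lines, each event failing
with probability at most 1/8. There, for small [l], the solution stays below 1 and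
above [a * q2 ^+ k] on the unit interval [[- (k + 1), - k]], so a finite total cost would
bound the geometric sums of [psi] and imply the logarithmic moment. *)
Lemma limit_laplace_small : ~ log_moment n ->
  exists2 l0, 0 < l0 & forall l, 0 < l -> l <= l0 -> limit_laplace l <= 4^-1.
Proof.
move=> nlog.
have e0 : 0 < 8^-1 :> R by rewrite invr_gt0.
have [K1 [A1 [mA1 PA1 hA1]]] := past_decay e0.
(* Any rate above - a1 will do; this one is also positive. *)
pose C := `|a1| + 1.
have aC : - 1 * a1 < C.
  by rewrite mulN1r /C; apply: (le_lt_trans (ler_norm _)); rewrite normrN ltrDl.
have [K2 [A2 [mA2 PA2 hA2]]] := past_growth hxi hxi' ixi Exi aC e0.
pose C' := phi_lip b c m 1.
have C'0 : 0 <= C' by exact: phi_lip_ge0.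
pose D := C + C'.
have D0 : 0 < D by rewrite /D ltr_wpDr// /C ltr_wpDl.
exists (expR (- K1)); first exact: expR_gt0.
move=> l l0 lK.
have infty w : A1 w -> A2 w -> total_cost l w = +oo%E.
  move=> A1w A2w.
  have v1 r : r <= 0 -> v w r 0 l <= 1.
    move=> r0; apply: (le_trans (hA1 w A1w r l r0 (ltW l0))).
    apply: (@le_trans _ _ (expR (- K1) * expR (K1 + eps * r))).
      by rewrite ler_wpM2r// expR_ge0.
    rewrite -expRD addKr expR_le1 pmulr_rle0//; exact: eps0.
  have vlow s : s <= 0 -> l * expR (- K2 + D * s) <= v w s 0 l.
    move=> s0; have s00 : s <= s <= 0 by rewrite lexx.
    have := sol_lower s0 (hv w (ltW l0)) (phi_le_lin b hm) (fun r (rr : s <= r <= 0) => v1 r (proj2 (andP rr))) s00.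
    rewrite /= -/C'; apply: le_trans; rewrite ler_wpM2l// ?(ltW l0)// ler_expR.
    have hs := hA2 w A2w s s0.
    apply: (@le_trans _ _ (- (K2 - C * s) - C' * (0 - s))).
      by rewrite le_eqVlt /D; apply/orP; left; apply/eqP; ring.
    by rewrite lerD2r lerNl -mulN1r.
  pose q2 := expR (- D).
  have q2_01 : 0 < q2 < 1 by rewrite /q2 expR_gt0 expR_lt1 oppr_lt0.
  pose a := l * expR (- K2) * q2.
  have a0 : 0 < a by rewrite /a !mulr_gt0 ?expR_gt0//; case/andP: q2_01.
  have := total_cost_ge0 w (ltW l0).
  case E : (total_cost l w) => [r| |] // _.
  exfalso; apply: nlog; apply: (log_moment_of_sum_psi hn q2_01 a0 (S := r)) => N.
  have ig t : 0 < t -> leb.-integrable `[- t, 0] (EFin \o (fun s => psin (v w s 0 l))).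
    by move=> t0; apply: icost => //; rewrite ?oppr_lt0// ltW.
  have p0 s : s <= 0 -> 0 <= psin (v w s 0 l) by exact: psiv_ge0 (ltW l0).
  have q20 k : 0 <= q2 ^+ k * a.
    by rewrite mulr_ge0// ?(ltW a0)// exprn_ge0//; case/andP: q2_01 => /ltW.
  apply: (@le_trans _ _ (\sum_(k < N.+1) psin (q2 ^+ k * a))).
    by rewrite big_ord_recr/= lerDl psi_ge0.
  rewrite -lee_fin -E.
  apply: le_trans (half_line_integral_le p0 ig (ltr0Sn R N)).
  rewrite lee_fin; apply: (half_line_sum_ge ig (B := fun k => psin (q2 ^+ k * a))) => k s /andP[ks sk].
  have s0 : s <= 0 by apply: (le_trans sk); rewrite oppr_le0.
  apply: psi_le => //; apply: le_trans (vlow s s0).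
  rewrite /a /q2 -expRM_natl (_ : expR (k%:R * - D) * (l * expR (- K2) * expR (- D)) =
    l * (expR (- K2) * (expR (k%:R * - D) * expR (- D)))); last by ring.
  rewrite ler_wpM2l ?(ltW l0)// -!expRD ler_expR lerD2l.
  rewrite (_ : k%:R * - D + - D = D * - k.+1%:R); last by rewrite -natr1; ring.
  by rewrite ler_wpM2l// ltW.
have mAA : measurable (~` A1 `|` ~` A2) by apply: measurableU; exact: measurableC.
have PAA : (P (~` A1 `|` ~` A2) <= (4^-1)%:E)%E.
  apply: (le_trans (measureU2 _ _ _)); [exact: measurableC..|].
  apply: (le_trans (leeD PA1 PA2)); rewrite -EFinD lee_fin.
  by rewrite le_eqVlt; apply/orP; left; apply/eqP; field.
rewrite /limit_laplace -lee_fin -Rintegral_unit; last 2 first.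
- exact: measurable_discount (ltW l0).
- by move=> w; exact: discount_itv (ltW l0).
apply: (@le_trans _ _ (\int[P]_w (\1_(~` A1 `|` ~` A2) w)%:E)%E); last first.
  by rewrite integral_indic// setIT.
apply: ge0_le_integral => //.
- by move=> w _; rewrite lee_fin; have /andP[] := discount_itv w (ltW l0).
- by apply/measurable_EFinP; exact: measurable_discount (ltW l0).
- by apply/measurable_EFinP; exact: measurable_indic.
move=> w _; rewrite lee_fin indicE.
have /andP[_ d1] := discount_itv w (ltW l0).
have [hw|hw] := pselect ((~` A1 `|` ~` A2) w); first by rewrite mem_set.
rewrite memNset// /discount infty //=.
- by apply: contrapT => hA; apply: hw; left.
- by apply: contrapT => hA; apply: hw; right.
Qed.

End Stationary_cost.

(** * Semigroups with convergent Laplace transforms *)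

Section Ergodicity.
Context {R : realType}.
Local Notation BR := (measurableTypeR R).
Local Notation Rge0 := (`[0%R, +oo[%classic : set BR).
Variable Q : R -> R.-pker BR ~> BR.
Hypothesis Q_mass : forall t x, 0 <= t -> 0 <= x -> Q t x Rge0 = 1%E.
Variable L : R -> R.
Hypothesis Q_laplace : forall (u_ : nat -> R) x l, (forall k, 0 < u_ k) ->
  u_ @ \oo --> +oo -> 0 <= x -> 0 <= l ->
  laplace (Q (u_ k) x) l @[k --> \oo] --> (L l)%:E.

Let QT t x : 0 <= t -> 0 <= x -> Q t x setT = 1%E.
Proof. by move=> t0 x0; exact: prob_kernel. Qed.

Let natoo : (fun k => k.+1%:R : R) @ \oo --> +oo.
Proof.
apply/cvgryPge => A; exists (Num.truncn A) => // k /= kA.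
rewrite ltW//; apply: (lt_le_trans (truncnS_gt _)).
by rewrite ler_nat ltnS.
Qed.

Let exp_cts (l : R) : continuous (fun y : R => expR (- (l * y))).
Proof.
move=> y; have h1 : - (l * z) @[z --> y] --> - (l * y).
  by apply: cvgN; apply: cvgM; [exact: cvg_cst|exact: cvg_id].
exact: (cvg_comp _ _ h1 (@continuous_expR R (- (l * y)))).
Qed.

Let expl_cts (l : R) : {within `[0, +oo[, continuous (fun y : R => expR (- (l * y)))}.
Proof. by apply: continuous_subspaceT; exact: exp_cts. Qed.

Let mexpl (l : R) : measurable_fun Rge0 (fun y : R => expR (- (l * y))).
Proof. by apply: measurable_funTS; apply: continuous_measurable_fun; exact: exp_cts. Qed.

Let expl_le1 (l y : R) : 0 <= l -> 0 <= y -> `|expR (- (l * y))| <= 1.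
Proof. by move=> l0 y0; rewrite ger0_norm ?expR_ge0// expR_le1 oppr_le0 mulr_ge0. Qed.

Let laplace_Rintegral (nu : {measure set BR -> \bar R}) l : nu Rge0 = 1%E -> 0 <= l ->
  nu.-integrable Rge0 (EFin \o (fun y => expR (- (l * y)))) /\
  laplace nu l = (\int[nu]_(y in `[0, +oo[) expR (- (l * y)))%:E.
Proof.
move=> nu1 l0.
have mR : measurable Rge0 by exact: measurable_itv.
have i1 : nu.-integrable Rge0 (EFin \o (fun y => expR (- (l * y)))).
  apply: measurable_bounded_integrable => //.
  - by rewrite nu1 ltry.
  - exists 1; split; first exact: num_real.
    move=> K K1 y; rewrite /= in_itv/= andbT => y0.
    exact: le_trans (expl_le1 l0 y0) (ltW K1).
by split => //; rewrite /Rintegral fineK//; exact: integrable_fin_num.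
Qed.

Lemma laplace_of_ergodic (mu : probability BR R) l : ergodic_limit Q mu -> 0 <= l ->
  laplace mu l = (L l)%:E.
Proof.
move=> [mu1 hmu] l0; have [_ ->] := laplace_Rintegral mu1 l0; congr (_%:E).
have bd : exists M, forall y, 0 <= y -> `|expR (- (l * y))| <= M.
  by exists 1 => y; exact: expl_le1.
have /cvg_pinftyP /(_ _ natoo) c1 := hmu 0 (lexx 0) _ (@expl_cts l) bd.
have c2 : fine (laplace (Q k.+1%:R 0) l) @[k --> \oo] --> L l.
  by apply: fine_cvg; exact: Q_laplace.
have c3 : \int[Q k.+1%:R 0]_(y in `[0, +oo[) expR (- (l * y)) @[k --> \oo] --> L l.
  apply: (cvg_trans _ c2); apply: near_eq_cvg; apply: nearW => k /=.
  by have [_ ->] := laplace_Rintegral (Q_mass (ler0n R k.+1) (lexx 0)) l0.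
exact: (cvg_unique _ c1 c3).
Qed.

Lemma laplace_probability_cvg1 (mu : probability BR R) (l_ : nat -> R) : mu Rge0 = 1%E ->
  (forall k, 0 <= l_ k <= 1) -> l_ @ \oo --> (0 : R) -> laplace mu (l_ k) @[k --> \oo] --> 1%E.
Proof.
move=> mu1 l01 lc.
have mR : measurable Rge0 by exact: measurable_itv.
have [||||_ c1] := @Rdominated_cvg _ BR R mu Rge0 mR (fun k y => expR (- (l_ k * y))) (cst 1) (cst 1).
- by move=> k; exact: mexpl.
- move=> y _; rewrite -[X in _ --> X](_ : expR (- (0 * y)) = 1); last by rewrite mul0r oppr0 expR0.
  have h1 : - (l_ k * y) @[k --> \oo] --> - (0 * y).
    by apply: cvgN; apply: cvgM => //; exact: cvg_cst.
  exact: (cvg_comp _ _ h1 (@continuous_expR R (- (0 * y)))).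
- by have [i1 _] := laplace_Rintegral mu1 (lexx 0); apply: eq_integrable i1 => // y _ /=;
    rewrite mul0r oppr0 expR0.
- move=> k y; rewrite /= in_itv/= andbT => y0; apply: expl_le1 => //.
  by have /andP[] := l01 k.
have e1 : \int[mu]_(y in Rge0) cst (1 : R) y = 1.
  apply: (etrans (@Rintegral_cst _ _ _ mu Rge0 mR 1)).
  by apply: (etrans (congr1 (fun z => 1 * fine z) mu1)); exact: mulr1.
rewrite e1 in c1.
have c2 : (\int[mu]_(y in `[0, +oo[) expR (- (l_ k * y)))%:E @[k --> \oo] --> 1%:E.
  by apply: cvg_EFin; [exact: nearW|exact: c1].
apply: (cvg_trans _ c2).
apply: near_eq_cvg; apply: nearW => k /=; have /andP[lk0 _] := l01 k.
by have [_ ->] := laplace_Rintegral mu1 lk0.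
Qed.

(** The limit law is found along integer times from 0. To see that another starting
point and another sequence of times lead to the same law, interleave both
sequences: the combined sequence has convergent Laplace transforms, hence a weak
limit, which each of its two subsequences inherits. *)
Lemma ergodic_of_laplace (lam : nat -> R) : (forall k, 0 < lam k) ->
  L (lam k) @[k --> \oo] --> (1 : R) -> exists mu : probability BR R, ergodic_limit Q mu.
Proof.
move=> lam0 lam1.
have [mu [mu1 hmu]] : exists mu : probability BR R, mu Rge0 = 1%E /\
    forall f : R -> R, {within `[0, +oo[, continuous f} ->
    (exists M, forall y, 0 <= y -> `|f y| <= M) ->
    \int[Q k.+1%:R 0]_(y in `[0, +oo[) f y @[k --> \oo] --> \int[mu]_(y in `[0, +oo[) f y.
  apply: (@laplace_continuity R (fun k => Q k.+1%:R 0) _ _ L _ lam) => //.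
  - by move=> k; exact: QT.
  - by move=> k; exact: Q_mass.
  - by move=> l l0; exact: Q_laplace.
exists mu; split => // x x0 f cf bf; apply/cvg_pinftyP => u_ uoo.
pose u1 k := Num.max 1 (u_ k).
have u10 k : 0 < u1 k by rewrite lt_max ltr01.
have u1oo : u1 @ \oo --> +oo.
  apply/cvgryPge => A; move/cvgryPge : uoo => /(_ A); apply: filterS => k h.
  by rewrite le_max h orbT.
pose nu_ k : {measure set BR -> \bar R} :=
  if odd k then Q (u1 k./2) x else Q (k./2).+1%:R 0.
have half_oo : (fun k => k./2) @ \oo --> \oo.
  apply/cvgnyPge => A; exists A.*2 => // k /= Ak.
  by rewrite -(doubleK A); exact: half_leq.
have split_cvg (U : topologicalType) (F G : nat -> U) (H : U) : F @ \oo --> H -> G @ \oo --> H ->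
    (if odd k then F k./2 else G k./2) @[k --> \oo] --> H.
  move=> cF cG A HA.
  have hF := cvg_comp _ _ half_oo cF; have hG := cvg_comp _ _ half_oo cG.
  have HF : \forall k \near \oo, A (F k./2) by exact: (hF A HA).
  have HG : \forall k \near \oo, A (G k./2) by exact: (hG A HA).
  suff : \forall k \near \oo, A (if odd k then F k./2 else G k./2) by [].
  by apply: filterS2 HF HG => k h1 h2; case: ifP.
have [mu' [mu'1 hmu']] : exists mu : probability BR R, mu Rge0 = 1%E /\
    forall f : R -> R, {within `[0, +oo[, continuous f} ->
    (exists M, forall y, 0 <= y -> `|f y| <= M) ->
    \int[nu_ k]_(y in `[0, +oo[) f y @[k --> \oo] --> \int[mu]_(y in `[0, +oo[) f y.
  apply: (@laplace_continuity R nu_ _ _ L _ lam) => //.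
  - by move=> k; rewrite /nu_; case: ifP => _; apply: QT => //; exact: ltW.
  - by move=> k; rewrite /nu_; case: ifP => _; apply: Q_mass => //; exact: ltW.
  - move=> l l0; have cF := Q_laplace u10 u1oo x0 l0.
    have cG := Q_laplace (fun k => ltr0Sn R k) natoo (lexx 0) l0.
    apply: (cvg_trans _ (split_cvg _ _ _ _ cF cG)); apply: near_eq_cvg; apply: nearW => k /=.
    by rewrite /nu_; case: ifP.
have c1 := hmu' f cf bf; have c2 := hmu f cf bf.
have evenoo : (fun k => k.*2) @ \oo --> \oo.
  apply/cvgnyPge => A; exists A => // k /= Ak; apply: leq_trans Ak _.
  by rewrite -addnn leq_addr.
have oddoo : (fun k => k.*2.+1) @ \oo --> \oo.
  apply/cvgnyPge => A; exists A => // k /= Ak; apply: leq_trans Ak _.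
  by rewrite -addnn -addnS leq_addr.
have c3 := cvg_comp _ _ evenoo c1; have c4 := cvg_comp _ _ oddoo c1.
have e : \int[mu]_(y in `[0, +oo[) f y = \int[mu']_(y in `[0, +oo[) f y.
  have c5 : \int[Q k.+1%:R 0]_(y in `[0, +oo[) f y @[k --> \oo] --> \int[mu']_(y in `[0, +oo[) f y.
    apply: (cvg_trans _ c3); apply: near_eq_cvg; apply: nearW => k /=.
    by rewrite /nu_ odd_double doubleK.
  exact: (cvg_unique _ c2 c5).
rewrite e; apply: (cvg_trans _ c4); apply: near_eq_cvg.
move/cvgryPge : uoo => /(_ 1); apply: filterS => k uk /=.
by rewrite /nu_ /= odd_double /= uphalf_double /u1 (max_idPr uk).
Qed.

End Ergodicity.

(** * Ergodicity of the process *)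

Theorem theorem5p6 (R : realType) (d : measure_display) (T : measurableType d)
  (P : probability T R)
  (b c : R) (m : {measure set (measurableTypeR R) -> \bar R})
  (hm : branching_mechanism c m)
  (h : R) (n : {measure set (measurableTypeR R) -> \bar R})
  (hn : immigration_mechanism h n)
  (a sigma : R) (nu : {measure set (measurableTypeR R) -> \bar R})
  (B : R -> T -> measurableTypeR R)
  (N : R.-ker T ~> (measurableTypeR R * measurableTypeR R)%type)
  (xi xi' : R -> T -> measurableTypeR R)
  (hxi : levy_process P xi)
  (hxi_ito : levy_ito P a sigma nu B N xi)
  (hxi' : independent_copy P xi xi')
  (v : T -> R -> R -> R -> R)
  (hv : forall (w : T) (t lambda : R), 0 <= lambda ->
     unique_positive_solution (phi b c m) (two_sided xi xi' ^~ w) t lambda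
       (fun r => v w r t lambda))
  (Q : R -> R.-pker (measurableTypeR R) ~> (measurableTypeR R))
  (hQ : transition_semigroup Q)
  (hQ_laplace : forall t x lambda : R, 0 <= t -> 0 <= x -> 0 <= lambda ->
     laplace (Q t x) lambda =
     ('E_P[(fun w => expR (- (x * v w 0 t lambda)
              - \int[lebesgue_measure]_(s in `[0, t])
                  psi h n (v w s t lambda)))%R])%E)
  (a1 : R)
  (ha1_int : P.-integrable setT (EFin \o xi 1))
  (ha1 : ('E_P[xi 1%R] = a1%:E)%E)
  (hab : a1 < b) :
  ((exists mu : probability (measurableTypeR R) R, ergodic_limit Q mu) <->
   (\int[n]_(u in `[1%R, +oo[) (ln u)%:E < +oo)%E) /\
  ((\int[n]_(u in `[1%R, +oo[) (ln u)%:E < +oo)%E ->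
   forall mu : probability (measurableTypeR R) R, ergodic_limit Q mu ->
   forall lambda : R, 0 <= lambda ->
     laplace mu lambda =
     (\int[P]_w expeR (- \int[lebesgue_measure]_(s in `]-oo, 0%R])
                          (psi h n (v w s 0%R lambda))%:E))%E).
Proof.
have hv1 w t l : 0 <= l ->
    positive_solution (phi b c m) (two_sided xi xi' ^~ w) t l (fun r => v w r t l).
  by move=> l0; case: (hv w t l l0).
have Exi : (\int[P]_w (xi 1 w)%:E)%E = a1%:E by rewrite -ha1 unlock.
have Q_mass t x : 0 <= t -> 0 <= x -> Q t x `[0, +oo[%classic = 1%E by case: hQ => + _ _; apply.
pose L := limit_laplace P h n v.
have Q_laplace (u_ : nat -> R) x l : (forall k, 0 < u_ k) -> u_ @ \oo --> +oo ->
    0 <= x -> 0 <= l -> laplace (Q (u_ k) x) l @[k --> \oo] --> (L l)%:E.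
  move=> u0 uoo x0 l0.
  have cL := expectation_cvg hm hn hxi hxi' hv1 ha1_int Exi hab u0 uoo l0 x0.
  have cLE : (\int[P]_w expR (- backward_cost (psi h n) v 0 (u_ k) l x w))%:E @[k --> \oo]
      --> (L l)%:E.
    by apply: cvg_EFin; [exact: nearW|exact: cL].
  apply: (cvg_trans _ cLE); apply: near_eq_cvg; apply: nearW => k /=.
  rewrite hQ_laplace ?(ltW (u0 k))// unlock -Rintegral_unit.
  - by apply: eq_integral => w _; rewrite /backward_cost opprD.
  - do 2 apply: measurableT_comp => //.
    exact: (measurable_cost hm hn hxi hxi' hv1).
  - move=> w; rewrite expR_ge0 expR_le1 oppr_le0.
    exact: (backward_cost_ge0 hn hv1 w l0 x0 (ltW (u0 k))).
have LE l : 0 <= l -> (L l)%:E =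
    (\int[P]_w expeR (- \int[lebesgue_measure]_(s in `]-oo, 0%R])
      (psi h n (v w s 0%R l))%:E))%E.
  move=> l0; rewrite /L /limit_laplace -Rintegral_unit.
  - apply: eq_integral => w _; rewrite -(discountE hn hv1 w l0)//.
  - exact: (measurable_discount hm hn hxi hxi' hv1).
  - by move=> w; exact: (discount_itv hn hv1 w l0).
split; last first.
  by move=> _ mu hmu l l0; rewrite (laplace_of_ergodic Q_mass Q_laplace hmu l0) LE.
split; last first.
  move=> hlog.
  pose q := expR (- ((b - a1) / 2)).
  apply: (ergodic_of_laplace Q_mass Q_laplace (lam := fun j => q ^+ j)).
    by move=> j; rewrite exprn_gt0// expR_gt0.
  exact: (limit_laplace_cvg1 hm hn hxi hxi' hv1 ha1_int Exi hab hlog).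
move=> [mu hmu]; apply: contrapT => nlog.
(* A limit law would have a transform tending to 1 at 0, but it stays below 1/4. *)
have [l0 l00 hl0] := limit_laplace_small hm hn hxi hxi' hv1 ha1_int Exi hab nlog.
pose l1 := Num.min 1 l0.
have l10 : 0 < l1 by rewrite lt_min ltr01.
have l_01 k : 0 < l1 / k.+1%:R <= l1.
  by rewrite divr_gt0//= ler_pdivrMr// ler_peMr ?(ltW l10)// ler1n.
have cl : l1 / k.+1%:R @[k --> \oo] --> (0 : R).
  rewrite -[X in _ --> X](mulr0 l1); apply: cvgM; first exact: cvg_cst.
  exact: cvg_harmonic.
have [mu1 _] := hmu.
have c1 : laplace mu (l1 / k.+1%:R) @[k --> \oo] --> 1%E.
  apply: laplace_probability_cvg1 => // k; have /andP[h1 h2] := l_01 k.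
  by rewrite (ltW h1) (le_trans h2)// ge_min lexx.
have : (1 <= (4^-1)%:E :> \bar R)%E.
  rewrite -(cvg_lim _ c1)//; apply: lime_le; first by apply/cvg_ex; eexists; exact: c1.
  apply: nearW => k; have /andP[h1 h2] := l_01 k.
  rewrite (laplace_of_ergodic Q_mass Q_laplace hmu (ltW h1)) lee_fin.
  by apply: hl0 => //; rewrite (le_trans h2)// ge_min lexx orbT.
rewrite lee_fin leNgt invf_lt1// => /negP; apply.
by rewrite ltr1n.
Qed.
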